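(* Let $G$ be an $n$-dimensional Lie group with Lie algebra $\mathfrak g$, equipped with the left-invariant metric induced by an inner product on $\mathfrak g$, let $H(y)=\frac12|y|^2$ on $\mathfrak g^*$, and let $\varepsilon>0$. Let $M\subset\mathfrak g^*$ be a manifold which is invariant under the evolution by the Euler–Arnold equation $\dot y_k=\{H,y_k\}$, carrying the measure $m$ and the associated Laplace operator $L_M$ described in the context, and let $Z\subset\mathfrak g$ be the image of $M$ under the identification $\mathfrak g^*\cong\mathfrak g$ given by the metric. Assume that $M$ is a smooth analytic submanifold of $\mathfrak g^*$. Then the operator on $G\times M$ corresponding to the Fokker–Planck equation $$f_t+v^ke_kf+b_k\frac{\partial f}{\partial y_k}=\frac{\varepsilon^2}{2}L_Mf,\qquad v^k=\frac{\partial H}{\partial y_k},\quad b_k=\{H,y_k\},$$ (or, equivalently, the operator on $G\times Z$ corresponding to $f_t+z^ke_kf+q^k(z,z)\frac{\partial f}{\partial z^k}=\frac{\varepsilon^2}{2}Lf$) satisfies the (parabolic) Hörmander condition if and only if the p-hull of $Z$ coincides with $\mathfrak g$.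
   Context: Summation over repeated indices is used. $e_1,\dots,e_n$ is an orthonormal basis of $\mathfrak g$ with structure constants $[e_i,e_j]=c^k_{ij}e_k$; the same symbols denote the left-invariant vector fields on $G$, and $e_kf$ is the derivative in the variable $a\in G$. $y_k$ are the coordinates on $\mathfrak g^*$ in the dual basis; $\mathfrak g^*$ carries the dual inner product, and the Poisson bracket on functions on $\mathfrak g^*$ determined by $\{y_i,y_j\}=y_kc^k_{ij}$. $T^*G$ is identified with $G\times\mathfrak g^*$ by left translation. Measure $m$: $M$ is given locally as a non-degenerate level set $\{\phi_1=c_1,\dots,\phi_r=c_r\}$ of conserved quantities ($\{H,\phi_k\}=0$), and $m$ is the measure on $M$ obtained by restricting the volume of $\mathfrak g^*$ to $M_\delta=\{|\phi_k-c_k|<\delta,\ k=1,\dots,r\}$, multiplying by $(2\delta)^{-r}$ and letting $\delta\to0_+$. Densities $f$ on $G\times M$ are taken with respect to the product of the left Haar measure on $G$ with $m$. Operator $L_M$: let $\tilde g$ be the Riemannian metric induced on $M$ by the inner product on $\mathfrak g^*$, and let $\varkappa>0$ be the function such that the metric $\varkappa\tilde g$ has volume measure equal to $m$. $L_M$ is the Laplace operator on $M$ with respect to the metric $\varkappa\tilde g$. $L$ is the operator on $Z$ corresponding to $L_M$ under $M\cong Z$. The field $b_k\frac{\partial}{\partial y_k}$ is tangent to $M$; under $M\cong Z$ it becomes $q^k(z,z)\frac{\partial}{\partial z^k}$, where $q(x,y)=\frac12(\tilde q(x,y)+\tilde q(y,x))$ is the symmetrization of the bilinear map $\tilde q$ on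 $\mathfrak g$ defined by $([x,y],z)=(\tilde q(z,x),y)$ for $x,y,z\in\mathfrak g$, and $v^k$ becomes $z^k$. p-hull: the p-hull of a subset $S\subset\mathfrak g$ is the smallest Lie subalgebra $\mathfrak h\subset\mathfrak g$ such that (i) $\mathfrak h$ contains $S-S=\{s_1-s_2:\ s_1,s_2\in S\}$, and (ii) $\mathfrak h$ is invariant under the maps $z\mapsto[s,z]$ for each $s\in S$. Parabolic Hörmander condition: locally write the operator as $f_t+\mathcal X_0f-\sum_{j=1}^{d}\mathcal X_j^2f$, where $d=\dim Z$, $\mathcal X_1,\dots,\mathcal X_d$ are analytic vector fields on $G\times Z$ tangent to the $Z$ factor, depending only on $z$ and forming a basis of $T_zZ$ at each $z$, and $\mathcal X_0=z^ke_k+V$ with $V$ an analytic vector field on $Z$. Consider local analytic vector fields on $G\times Z$ of the form $X^k(z)e_k(a)+Y(z)$, with $Y$ tangent to $Z$, as a Lie module over the analytic functions of $z\in Z$, and let $\mathcal M$ be its smallest Lie submodule that contains $\mathcal X_1,\dots,\mathcal X_d$ and is invariant under $\mathcal X\mapsto[\mathcal X_0,\mathcal X]$ (Lie bracket of vector fields). The condition at a point $(a,z_0)$ is that the values at $(a,z_0)$ of the fields in $\mathcal M$ fill the tangent space $T_{(a,z_0)}(G\times Z)$; the operator satisfies the condition if this holds at every point.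
   Formalization: The manifold M is taken to be nonempty and connected (the claim fails for two parallel lines in the dual of R^2), and the conformal factor ϰ is assumed analytic on M, without which the operator cannot be written with analytic fields as the Hörmander condition requires. *)

(* Defs.v *)
From HB Require Import structures.
From mathcomp Require Import all_boot all_order all_algebra.
From mathcomp Require Import all_classical all_reals all_analysis.

Set Implicit Arguments.
Unset Strict Implicit.
Unset Printing Implicit Defensive.

Import Order.TTheory GRing.Theory Num.Theory.
Import numFieldNormedType.Exports.

Local Open Scope classical_set_scope.
Local Open Scope ring_scope.

Definition pd (R : realType) m (i : 'I_m) (f : 'rV[R]_m -> R)
  (x : 'rV[R]_m) : R := 'D_(delta_mx 0 i) f x.

Definition iter_pd (R : realType) m (s : seq 'I_m) (f : 'rV[R]_m -> R) :
  'rV[R]_m -> R := foldr (@pd R m) f s.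

(* C^oo on A (A is open wherever this is used): partial derivatives of all
   orders are differentiable, hence continuous, at the points of A. *)
Definition smooth_on (R : realType) m (A : set 'rV[R]_m)
  (f : 'rV[R]_m -> R) : Prop :=
  forall (s : seq 'I_m) x, A x -> differentiable (iter_pd s f) x.

(* The term of degree k of the power series sum_alpha a_alpha h^alpha, for an
   arbitrary function phi of the monomials; a multi-index of total degree k
   has all its entries in {0, ..., k}. *)
Definition deg_part (R : realType) m (phi : R -> R) (a : ('I_m -> nat) -> R)
  (h : 'rV[R]_m) (k : nat) : R :=
  \sum_(alpha : {ffun 'I_m -> 'I_k.+1} | (\sum_i alpha i == k)%N)
    phi (a (fun i => alpha i) * \prod_i h 0 i ^+ alpha i).

Definition analytic_at (R : realType) m (f : 'rV[R]_m -> R) (x : 'rV[R]_m) :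
  Prop :=
  exists (a : ('I_m -> nat) -> R) (r : R), 0 < r /\
  forall h : 'rV[R]_m, `|h| < r ->
    cvgn (series (deg_part Num.norm a h)) /\
    series (deg_part id a h) @ \oo --> f (x + h).

Definition analytic_on (R : realType) m (A : set 'rV[R]_m)
  (f : 'rV[R]_m -> R) : Prop := forall x, A x -> analytic_at f x.

Definition analytic_map (R : realType) m p (A : set 'rV[R]_m)
  (f : 'rV[R]_m -> 'rV[R]_p) : Prop :=
  forall i, analytic_on A (fun x => f x 0 i).

(* Integral over R^m with respect to the volume, as an iterated Lebesgue
   integral; it is only applied to nonnegative Borel functions. *)
Fixpoint vol_integral (R : realType) m : ('rV[R]_m -> \bar R) -> \bar R :=
  match m with
  | 0 => fun f => f 0
  | m'.+1 => fun f =>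
      (\int[lebesgue_measure]_x
         @vol_integral R m' (fun y => f (row_mx (x%:M : 'rV[R]_1) y)))%E
  end.

HB.mixin Record isTopGroup G of Topological G & Group G := {
  topgroup_mul_continuous :
    continuous (fun p : G * G => (p.1 * p.2)%g : G);
  topgroup_inv_continuous : continuous (fun x : G => (x^-1)%g : G)
}.

#[short(type="topGroupType")]
HB.structure Definition TopGroup :=
  {G of Topological G & Group G & isTopGroup G}.

(* A chart is defined on cdom; cinv is its inverse on the open set cimg. *)
Record chart (R : realType) (G : topologicalType) (n : nat) := Chart {
  cdom : set G;
  cmap : G -> 'rV[R]_n;
  cinv : 'rV[R]_n -> G
}.

Definition cimg (R : realType) (G : topologicalType) n (x : chart R G n) :
  set 'rV[R]_n := cmap x @` cdom x.

Definition is_chart (R : realType) (G : topologicalType) n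
  (x : chart R G n) : Prop :=
  [/\ open (cdom x), open (cimg x),
      (forall g, cdom x g -> cinv x (cmap x g) = g),
      {within cdom x, continuous (cmap x)} &
      {within cimg x, continuous (cinv x)}].

(* The charts cover G, and transition maps, product and inverse are C^oo in
   charts. *)
Definition is_lie_group (R : realType) (G : topGroupType) n
  (atlas : set (chart R G n)) : Prop :=
  [/\ hausdorff_space G, @second_countable G,
      (forall x, atlas x -> is_chart x) &
      (forall g, exists2 x, atlas x & cdom x g)] /\
  [/\ (forall x y, atlas x -> atlas y -> forall i,
        smooth_on [set u | cimg x u /\ cdom y (cinv x u)]
                  (fun u => cmap y (cinv x u) 0 i)),
      (forall x y z, atlas x -> atlas y -> atlas z -> forall i,
        smooth_on
          [set p : 'rV[R]_(n + n) | [/\ cimg x (lsubmx p), cimg y (rsubmx p) &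
             cdom z (cinv x (lsubmx p) * cinv y (rsubmx p))%g]]
          (fun p => cmap z (cinv x (lsubmx p) * cinv y (rsubmx p))%g 0 i)) &
      (forall x y, atlas x -> atlas y -> forall i,
        smooth_on [set u | cimg x u /\ cdom y (cinv x u)^-1%g]
                  (fun u => cmap y (cinv x u)^-1%g 0 i))].

Definition smooth_on_group (R : realType) (G : topologicalType) n
  (atlas : set (chart R G n)) (O : set G) (f : G -> R) : Prop :=
  forall x, atlas x ->
    smooth_on [set u | cimg x u /\ O (cinv x u)] (fun u => f (cinv x u)).

(* C^oo functions on O x W, for O open in G and W open in R^d. *)
Definition smooth_on_prod (R : realType) (G : topologicalType) n d
  (atlas : set (chart R G n)) (O : set G) (W : set 'rV[R]_d)
  (F : G -> 'rV[R]_d -> R) : Prop :=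
  forall x, atlas x ->
    smooth_on
      [set p : 'rV[R]_(n + d) |
         [/\ cimg x (lsubmx p), O (cinv x (lsubmx p)) & W (rsubmx p)]]
      (fun p => F (cinv x (lsubmx p)) (rsubmx p)).

(* The left-invariant vector field whose value at the unit is the tangent
   vector with coordinates (row k of E) in the chart x around the unit, acting
   on functions: (e_k f)(a) is the derivative of g |-> f (a g) at the unit
   along that vector. For E invertible, e_1, ..., e_n is an arbitrary basis of
   the Lie algebra. *)
Definition left_frame (R : realType) (G : topGroupType) n (x : chart R G n)
  (E : 'M[R]_n) (k : 'I_n) (f : G -> R) (a : G) : R :=
  'D_(row k E) (fun u => f (a * cinv x u)%g) (cmap x 1%g).

Definition structure_constants (R : realType) (G : topologicalType) n
  (atlas : set (chart R G n)) (e : 'I_n -> (G -> R) -> G -> R)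
  (c : 'I_n -> 'I_n -> 'I_n -> R) : Prop :=
  forall (O : set G) (f : G -> R), open O -> smooth_on_group atlas O f ->
  forall i j a, O a ->
    e i (e j f) a - e j (e i f) a = \sum_k c i j k * e k f a.

(* The basis e_1, ..., e_n is orthonormal: this is what specifies the inner
   product. A vector z^k e_k of the Lie algebra is the row of the z^k, a
   covector is the row of its coordinates y_k in the dual basis, and both
   inner products are the standard one. *)

Definition dot (R : realType) n (x y : 'rV[R]_n) : R :=
  \sum_k x 0 k * y 0 k.

(* Identification of the dual with the Lie algebra by the metric: sharp y is
   the z such that (z, e_k) = y_k for all k, that is z^k = y_k. *)
Definition sharp (R : realType) n (y : 'rV[R]_n) : 'rV[R]_n := y.

Definition lie_bracket (R : realType) n (c : 'I_n -> 'I_n -> 'I_n -> R)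
  (x y : 'rV[R]_n) : 'rV[R]_n :=
  \row_k \sum_i \sum_j c i j k * x 0 i * y 0 j.

Definition poisson (R : realType) n (c : 'I_n -> 'I_n -> 'I_n -> R)
  (f g : 'rV[R]_n -> R) (y : 'rV[R]_n) : R :=
  \sum_i \sum_j pd i f y * pd j g y * (\sum_k y 0 k * c i j k).

Definition hamiltonian (R : realType) n (y : 'rV[R]_n) : R :=
  2^-1 * dot y y.

Definition velocity (R : realType) n (y : 'rV[R]_n) : 'rV[R]_n :=
  \row_k pd k (@hamiltonian R n) y.

Definition euler_arnold (R : realType) n (c : 'I_n -> 'I_n -> 'I_n -> R)
  (y : 'rV[R]_n) : 'rV[R]_n :=
  \row_k poisson c (@hamiltonian R n) (fun y' => y' 0 k) y.

(* Solutions of the Euler-Arnold equation exist for all times, since |y|^2 is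
   conserved. *)
Definition euler_arnold_invariant (R : realType) n
  (c : 'I_n -> 'I_n -> 'I_n -> R) (M : set 'rV[R]_n) : Prop :=
  forall y : R -> 'rV[R]_n,
    (forall t : R, is_derive t 1 y (euler_arnold c (y t))) ->
    M (y 0) -> forall t, M (y t).

(* The bilinear map with ([x, y], z) = (q_tilde z x, y); take y = e_j. *)
Definition q_tilde (R : realType) n (c : 'I_n -> 'I_n -> 'I_n -> R)
  (z x : 'rV[R]_n) : 'rV[R]_n :=
  \row_j dot (lie_bracket c x (delta_mx 0 j)) z.

Definition q_sym (R : realType) n (c : 'I_n -> 'I_n -> 'I_n -> R)
  (x y : 'rV[R]_n) : 'rV[R]_n :=
  2^-1 *: (q_tilde c x y + q_tilde c y x).

Definition p_closed (R : realType) n (c : 'I_n -> 'I_n -> 'I_n -> R)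
  (S : set 'rV[R]_n) (h : {vspace 'rV[R]_n}) : Prop :=
  [/\ (forall x y, x \in h -> y \in h -> lie_bracket c x y \in h),
      (forall s1 s2, S s1 -> S s2 -> s1 - s2 \in h) &
      (forall s z, S s -> z \in h -> lie_bracket c s z \in h)].

Definition p_hull (R : realType) n (c : 'I_n -> 'I_n -> 'I_n -> R)
  (S : set 'rV[R]_n) : set 'rV[R]_n :=
  [set x | forall h : {vspace 'rV[R]_n}, p_closed c S h -> x \in h].

(* psi : W -> M is an analytic immersion and a homeomorphism onto M `&` O,
   with O open. The rows of 'J psi u are the partial derivatives of psi. *)
Definition local_param (R : realType) n d (M : set 'rV[R]_n)
  (W : set 'rV[R]_d) (psi : 'rV[R]_d -> 'rV[R]_n) (O : set 'rV[R]_n) : Prop :=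
  [/\ open W, open O, analytic_map W psi,
      (forall u, W u -> row_free ('J psi u)) & psi @` W = M `&` O] /\
  (exists2 psi' : 'rV[R]_n -> 'rV[R]_d,
     forall u, W u -> psi' (psi u) = u &
     {within M `&` O, continuous psi'}).

Definition analytic_submanifold (R : realType) n (d : nat)
  (M : set 'rV[R]_n) : Prop :=
  forall p, M p -> exists W psi O, @local_param R n d M W psi O /\ O p.

Definition analytic_function (R : realType) n (d : nat) (M : set 'rV[R]_n)
  (kappa : 'rV[R]_n -> R) : Prop :=
  forall W psi O, @local_param R n d M W psi O ->
    analytic_on W (fun u => kappa (psi u)).

(* The metric kappa g~ in the coordinates u, with g~ induced by R^n. *)
Definition metric (R : realType) n d (kappa : 'rV[R]_n -> R)
  (psi : 'rV[R]_d -> 'rV[R]_n) (u : 'rV[R]_d) : 'M[R]_d :=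
  kappa (psi u) *: ('J psi u *m ('J psi u)^T).

Definition vol_density (R : realType) n d (kappa : 'rV[R]_n -> R)
  (psi : 'rV[R]_d -> 'rV[R]_n) (u : 'rV[R]_d) : R :=
  Num.sqrt (\det (metric kappa psi u)).

Definition laplace (R : realType) n d (kappa : 'rV[R]_n -> R)
  (psi : 'rV[R]_d -> 'rV[R]_n) (f : 'rV[R]_d -> R) (u : 'rV[R]_d) : R :=
  (vol_density kappa psi u)^-1 *
  \sum_i pd i (fun w => \sum_j vol_density kappa psi w *
                 invmx (metric kappa psi w) i j * pd j f w) u.

Notation borelRn R n := (g_sigma_algebraType (@open 'rV[R]_n)).

(* Near each of its points M is a non-degenerate level set of conserved
   quantities phi_1, ..., phi_r, and m restricted to M is there the weak limit
   of the volume of M_delta multiplied by (2 delta)^(-r). *)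
Definition thickening_limit (R : realType) n (c : 'I_n -> 'I_n -> 'I_n -> R)
  (M : set 'rV[R]_n) (m : {measure set (borelRn R n) -> \bar R}) : Prop :=
  forall p, M p -> exists (O : set 'rV[R]_n) (r : nat)
    (phi : 'I_r -> 'rV[R]_n -> R) (lev : 'I_r -> R),
  [/\ open O, O p, M `&` O = [set y | O y /\ forall k, phi k y = lev k] &
    [/\ forall k, smooth_on O (phi k),
        forall k y, O y -> poisson c (@hamiltonian R n) (phi k) y = 0,
        forall y, (M `&` O) y -> row_free (\matrix_(k, i) pd i (phi k) y) &
        forall (g : 'rV[R]_n -> R) (K : set 'rV[R]_n),
          continuous g -> (forall y, 0 <= g y) ->
          compact K -> K `<=` O -> (forall y, ~ K y -> g y = 0) ->
          ((((2 * delta) ^- r)%:E *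
             vol_integral (fun y : 'rV[R]_n =>
               (\1_[set y | O y /\ forall k, `|phi k y - lev k| < delta] y
                * g y)%:E))%E
            @[delta --> 0^'+] --> \int[m]_(y in M) (g y)%:E)%E]].

Definition metric_volume (R : realType) n (d : nat) (M : set 'rV[R]_n)
  (kappa : 'rV[R]_n -> R) (m : {measure set (borelRn R n) -> \bar R}) :
  Prop :=
  forall W psi O, @local_param R n d M W psi O ->
  forall A : set (borelRn R n), measurable A -> A `<=` M `&` O ->
    m A = vol_integral (fun u : 'rV[R]_d =>
            (\1_[set u | W u /\ A (psi u)] u * vol_density kappa psi u)%:E).

(* (X, Y) stands for the vector field X^k(u) e_k(a) + Y^i(u) d/du^i. *)
Definition vfield (R : realType) (n d : nat) : Type :=
  (('rV[R]_d -> 'rV[R]_n) * ('rV[R]_d -> 'rV[R]_d))%type.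

Definition apply_field (R : realType) (G : topologicalType) n d
  (e : 'I_n -> (G -> R) -> G -> R) (A : vfield R n d)
  (F : G -> 'rV[R]_d -> R) (a : G) (u : 'rV[R]_d) : R :=
  (\sum_k A.1 u 0 k * e k (F^~ u) a) + 'D_(A.2 u) (F a) u.

Definition analytic_field (R : realType) n d (W : set 'rV[R]_d)
  (A : vfield R n d) : Prop := analytic_map W A.1 /\ analytic_map W A.2.

(* C = [A, B]: C acts on functions as the commutator of A and B. *)
Definition is_bracket (R : realType) (G : topologicalType) n d
  (atlas : set (chart R G n)) (e : 'I_n -> (G -> R) -> G -> R)
  (W : set 'rV[R]_d) (A B C : vfield R n d) : Prop :=
  forall (O : set G) (F : G -> 'rV[R]_d -> R),
    open O -> smooth_on_prod atlas O W F ->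
    forall a u, O a -> W u ->
      apply_field e C F a u =
      apply_field e A (apply_field e B F) a u -
      apply_field e B (apply_field e A F) a u.

Definition lie_submodule (R : realType) (G : topologicalType) n d
  (atlas : set (chart R G n)) (e : 'I_n -> (G -> R) -> G -> R)
  (W : set 'rV[R]_d) (N : set (vfield R n d)) : Prop :=
  [/\ N `<=` analytic_field W,
      N (fun=> 0, fun=> 0),
      forall A B, N A -> N B ->
        N (fun u => A.1 u + B.1 u, fun u => A.2 u + B.2 u),
      forall (f : 'rV[R]_d -> R) A, analytic_on W f -> N A ->
        N (fun u => f u *: A.1 u, fun u => f u *: A.2 u) &
      forall A B C, N A -> N B -> analytic_field W C ->
        is_bracket atlas e W A B C -> N C].

Definition hormander_module (R : realType) (G : topologicalType) n d
  (atlas : set (chart R G n)) (e : 'I_n -> (G -> R) -> G -> R)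
  (W : set 'rV[R]_d) (X0 : vfield R n d) (X : 'I_d -> vfield R n d) :
  set (vfield R n d) :=
  [set A | forall N : set (vfield R n d), lie_submodule atlas e W N ->
     (forall j, N (X j)) ->
     (forall B C, N B -> analytic_field W C ->
        is_bracket atlas e W X0 B C -> N C) ->
     N A].

(* Components of the value of A at (a, u) in the basis of the tangent space
   given by the chart x of G and the coordinates u. *)
Definition field_value (R : realType) (G : topologicalType) n d
  (e : 'I_n -> (G -> R) -> G -> R) (x : chart R G n) (A : vfield R n d)
  (a : G) (u : 'rV[R]_d) : 'rV[R]_n * 'rV[R]_d :=
  (\row_i \sum_k A.1 u 0 k * e k (fun g => cmap x g 0 i) a, A.2 u).

(* The operator P such that the Fokker-Planck equation is f_t + P f = 0, with
   transport v^k e_k, drift b (a vector field on R^n tangent to the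
   submanifold) and diffusion (eps^2 / 2) times the Laplacian of kappa g~, in
   the coordinates u. The row w *m pinvmx ('J psi u) contains the components
   of w in the basis d psi/du^i of the tangent space, for w tangent. *)
Definition fp_operator (R : realType) (G : topologicalType) n d
  (e : 'I_n -> (G -> R) -> G -> R) (v b : 'rV[R]_n -> 'rV[R]_n) (eps : R)
  (kappa : 'rV[R]_n -> R) (psi : 'rV[R]_d -> 'rV[R]_n)
  (F : G -> 'rV[R]_d -> R) (a : G) (u : 'rV[R]_d) : R :=
  \sum_k v (psi u) 0 k * e k (F^~ u) a
  + 'D_(b (psi u) *m pinvmx ('J psi u)) (F a) u
  - eps ^+ 2 / 2 * laplace kappa psi (F a) u.

(* P = X_0 - sum_j X_j^2 on G x W, with X_0 = v^k e_k + V; f_t is common to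
   both sides. The fields X_1, ..., X_d form a basis at each point. *)
Definition hormander_form (R : realType) (G : topologicalType) n d
  (atlas : set (chart R G n)) (e : 'I_n -> (G -> R) -> G -> R)
  (v b : 'rV[R]_n -> 'rV[R]_n) (eps : R) (kappa : 'rV[R]_n -> R)
  (W : set 'rV[R]_d) (psi : 'rV[R]_d -> 'rV[R]_n)
  (V : 'rV[R]_d -> 'rV[R]_d) (X : 'I_d -> 'rV[R]_d -> 'rV[R]_d) : Prop :=
  [/\ analytic_map W V, forall j, analytic_map W (X j),
      forall u, W u -> (\matrix_j X j u) \in unitmx &
      forall (O : set G) (F : G -> 'rV[R]_d -> R),
        open O -> smooth_on_prod atlas O W F ->
        forall a u, O a -> W u ->
          fp_operator e v b eps kappa psi F a u =
          apply_field e (fun w => v (psi w), V) F a u -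
          \sum_j apply_field e (fun=> 0, X j)
                   (apply_field e (fun=> 0, X j) F) a u].

Definition hormander_at (R : realType) (G : topologicalType) n d
  (atlas : set (chart R G n)) (e : 'I_n -> (G -> R) -> G -> R)
  (v b : 'rV[R]_n -> 'rV[R]_n) (eps : R) (kappa : 'rV[R]_n -> R)
  (S : set 'rV[R]_n) (a : G) (z : 'rV[R]_n) : Prop :=
  exists (W : set 'rV[R]_d) (psi : 'rV[R]_d -> 'rV[R]_n) (O : set 'rV[R]_n)
    (u : 'rV[R]_d) (V : 'rV[R]_d -> 'rV[R]_d)
    (X : 'I_d -> 'rV[R]_d -> 'rV[R]_d),
  [/\ local_param S W psi O, W u, psi u = z,
      hormander_form atlas e v b eps kappa W psi V X &
      forall (x : chart R G n), atlas x -> cdom x a ->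
      forall t : 'rV[R]_n * 'rV[R]_d,
        exists2 A : vfield R n d,
          hormander_module atlas e W (fun w => v (psi w), V)
            (fun j => (fun=> 0, X j)) A &
          field_value e x A a u = t].

Definition hormander (R : realType) (G : topologicalType) n (d : nat)
  (atlas : set (chart R G n)) (e : 'I_n -> (G -> R) -> G -> R)
  (v b : 'rV[R]_n -> 'rV[R]_n) (eps : R) (kappa : 'rV[R]_n -> R)
  (S : set 'rV[R]_n) : Prop :=
  forall a z, S z -> @hormander_at R G n d atlas e v b eps kappa S a z.

(* Main.v *)
Require Import Defs.
From HB Require Import structures.
From mathcomp Require Import all_boot all_order all_algebra.
From mathcomp Require Import all_classical all_reals all_analysis.
From mathcomp Require Import ring lra.

Set Implicit Arguments.
Unset Strict Implicit.
Unset Printing Implicit Defensive.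

Import Order.TTheory GRing.Theory Num.Theory.
Import numFieldNormedType.Exports.

Local Open Scope classical_set_scope.
Local Open Scope ring_scope.

(** Write a vector field X^k(u) e_k + Y(u) on G x W, where psi : W -> M is a
    local parametrization, as the pair (X, Y). Since e_k does not act on
    functions of u and d/du^j does not act on the coefficients of the e_k, the
    bracket of (X, Y) and (X', Y') is
      ([X, X'] + D_Y X' - D_Y' X, D_Y Y' - D_Y' Y),
    with the bracket of the Lie algebra taken pointwise. The drift is
    X_0 = (psi, V).

    Necessity of the hull. Let h be a subspace as in the definition of the
    p-hull of M. The fields whose G-component takes its values in h form a Lie
    submodule; it contains the vertical X_j, and it is stable under [X_0, .],
    because the values of psi bracket h into h and the derivatives of psi lie
    in h, as differences of points of M do. Hence it contains the Hormander
    module, and if the latter fills the tangent space then h is everything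
    (hormander_hull_full).

    Sufficiency. The X_j generate all vertical fields over the analytic
    functions, so only horizontal fields (Y, 0) matter. Those of the module are
    stable under addition, multiplication by functions, d/du^i, pointwise Lie
    bracket and Lie bracket with psi, and they contain the d psi/du^i, obtained
    from [X_0, d/du^i]. Let h be the space of their values at u_0. All
    derivatives of psi at u_0 lie in h; as psi is analytic, psi - psi(u_0) takes
    its values in h near u_0, and by analytic continuation along the connected
    M the whole of M lies in psi(u_0) + h. Hence h satisfies the conditions
    which define the p-hull, so h is everything (hull_full_hormander).

    Three facts make this argument available.

    The operator has the required form. The field of the Euler-Arnold equation
    is tangent to M, because it annihilates the conserved quantities which
    define M locally, and a vector in the kernel of their differentials is
    tangent to M (level_set_tangent, tangent_cone_param,
    euler_arnold_tangent). The metric on W is an analytic function with values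
    in the positive definite matrices, so it factors as L L^T with L analytic
    (cholesky), and the rows of a multiple of L^-1 turn the Laplacian into a
    sum of squares up to first-order terms (hormander_form_exists).

    Brackets of fields, which are defined by the action on functions, are given
    by the formula above. This is computed in charts, where it rests on the
    symmetry of second derivatives (schwarz), on the structure constants, and
    on the non-degeneracy of the left-invariant frame (is_bracket_field,
    is_bracket_unique).

    Real-analytic functions of several variables, defined by absolutely
    convergent power series, are closed under derivatives and products, and
    positive ones under inverses and square roots. They are characterized by
    the growth of their derivatives (analytic_onP), where a bound by the
    derivatives at 0 of the majorant C (1 - rho t)^(-A) is stable under all
    these operations. Termwise differentiation gives such a bound for a power
    series; Taylor's formula gives the converse, and with it the identity
    theorem. *)

(** * Differential calculus in coordinates *)

Lemma diff_remainder (R : realType) (V W : normedModType R) (f : V -> W) (x : V) :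
  differentiable f x -> forall e : R, 0 < e ->
  exists2 r, 0 < r & forall h, `|h| < r ->
    `|f (x + h) - f x - 'd f x h| <= e * `|h|.
Proof.
move=> /diff_locally df e e0.
have /eqaddoP /(_ e e0) := df.
rewrite -nbhs_nearE => /nbhs_normP[r /= r0 rP]; exists r => // h hr.
have := rP h; rewrite /= sub0r normrN => /(_ hr).
by rewrite !fctE /= opprD addrA (addrC h x).
Qed.

Lemma remainder_diff (R : realType) (V W : normedModType R) (f : V -> W) (x : V)
    (l : {linear V -> W}) : continuous l ->
  (forall e : R, 0 < e -> exists2 r, 0 < r & forall h, `|h| < r ->
    `|f (x + h) - f x - l h| <= e * `|h|) ->
  differentiable f x /\ 'd f x = l :> (V -> W).
Proof.
move=> lc H.
have E : f \o shift x = cst (f x) + l +o_ 0 id.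
  apply/eqaddoP => e e0; rewrite -nbhs_nearE; apply/nbhs_normP.
  have [r r0 rP] := H e e0; exists r => //= h.
  rewrite /= sub0r normrN => hr; rewrite !fctE /= opprD addrA (addrC h x).
  exact: rP.
have dE := diff_unique lc E.
split => //; apply/diff_locallyP; rewrite dE; split => //.
Qed.

Lemma coord_norm (R : realType) m (h : 'rV[R]_m) i : `|h 0 i| <= `|h|.
Proof.
rewrite [leRHS]/Num.Def.normr/= mx_normrE.
exact: (le_bigmax _ (fun x : 'I_1 * 'I_m => `|h x.1 x.2|) (0, i)).
Qed.

Lemma norm_rV_le (R : realType) m (h : 'rV[R]_m) (b : R) : 0 <= b ->
  (forall i, `|h 0 i| <= b) -> `|h| <= b.
Proof.
move=> b0 H; rewrite [leLHS]/Num.Def.normr/= mx_normrE.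
by apply: bigmax_le => // -[i j] _ /=; rewrite ord1.
Qed.

Lemma norm_rV_lt (R : realType) m (h : 'rV[R]_m) (b : R) : 0 < b ->
  (forall i, `|h 0 i| < b) -> `|h| < b.
Proof.
move=> b0 H; rewrite [ltLHS]/Num.Def.normr/= mx_normrE.
by apply: bigmax_lt => // -[i j] _ /=; rewrite ord1.
Qed.

Lemma linear_rV_continuous (R : realType) m (W : normedModType R)
    (f : {linear 'rV[R]_m -> W}) :
  continuous f.
Proof.
have -> : f = \sum_i (fun v : 'rV[R]_m => v 0 i *: f (delta_mx 0 i))
    :> (_ -> _).
  apply/funext => v; rewrite fct_sumE {1}(row_sum_delta v) linear_sum.
  by apply: eq_bigr => i _; rewrite linearZ.
move=> x; apply: differentiable_continuous; apply: differentiable_sum => i.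
by apply: differentiableZl; apply: differentiable_coord.
Qed.

Lemma diff_pd (R : realType) m (f : 'rV[R]_m -> R) x v : differentiable f x ->
  'D_v f x = \sum_i v 0 i * pd i f x.
Proof.
move=> df; rewrite deriveE// {1}(row_sum_delta v) linear_sum.
by apply: eq_bigr => i _; rewrite linearZ /pd deriveE.
Qed.

Definition linear_form (R : realType) m (l : 'I_m -> R) (v : 'rV[R]_m) : R :=
  \sum_i v 0 i * l i.

Lemma linear_form_is_linear (R : realType) m (l : 'I_m -> R) : linear (linear_form l).
Proof.
move=> a u v; rewrite /linear_form scaler_sumr -big_split /=; apply: eq_bigr => i _.
by rewrite !mxE mulrDl -mulrA.
Qed.

HB.instance Definition _ (R : realType) m (l : 'I_m -> R) :=
  GRing.isLinear.Build R 'rV[R]_m R _ (linear_form l) (linear_form_is_linear l).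

Lemma linear_form_delta (R : realType) m (l : 'I_m -> R) i :
  linear_form l (delta_mx 0 i) = l i.
Proof.
rewrite /linear_form (bigD1 i) //= big1 ?addr0 => [|j ji].
  by rewrite mxE !eqxx mul1r.
by rewrite mxE (negbTE ji) andbF mul0r.
Qed.

(** Differentiability is used in the form of an inequality for the remainder:
    such an inequality survives limits, which is how sums of power series are
    differentiated. *)
Lemma linear_remainder_diff (R : realType) m (f : 'rV[R]_m -> R) x (l : 'I_m -> R) :
  (forall e : R, 0 < e -> exists2 r, 0 < r & forall h, `|h| < r ->
    `|f (x + h) - f x - linear_form l h| <= e * `|h|) ->
  differentiable f x /\ forall i, pd i f x = l i.
Proof.
move=> H; have [df dE] := remainder_diff (@linear_rV_continuous _ _ _ (linear_form l)) H.
by split => // i; rewrite /pd deriveE// dE; exact: linear_form_delta.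
Qed.

Lemma pd_linear_form (R : realType) m (l : 'I_m -> R) (x : 'rV[R]_m) :
  differentiable (linear_form l) x /\ forall i, pd i (linear_form l) x = l i.
Proof.
apply: linear_remainder_diff => e e0; exists 1 => // h _.
rewrite linearD; set a := linear_form _ x; set b := linear_form _ h.
have -> : a + b - a - b = 0 by ring.
by rewrite normr0 mulr_ge0// ltW.
Qed.

Lemma diff_linear_remainder (R : realType) m (f : 'rV[R]_m -> R) x : differentiable f x ->
  forall e : R, 0 < e -> exists2 r, 0 < r & forall h, `|h| < r ->
    `|f (x + h) - f x - linear_form (fun i => pd i f x) h| <= e * `|h|.
Proof.
move=> df e e0; have [r r0 H] := diff_remainder df e0; exists r => // h hr.
have -> : linear_form (fun i => pd i f x) h = 'd f x h by rewrite -deriveE// diff_pd.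
exact: H.
Qed.

Lemma near_differentiable (R : realType) m (f g : 'rV[R]_m -> R) x :
  (\near x, f x = g x) -> differentiable f x -> differentiable g x.
Proof.
move=> fg df.
have fgx : f x = g x by exact: nbhs_singleton fg.
apply: (proj1 (linear_remainder_diff (l := fun i => pd i f x) _)) => e e0.
have [r r0 H] := diff_linear_remainder df e0.
move/nbhs_normP : fg => [s /= s0 fg].
exists (Num.min r s); first by rewrite lt_min r0.
move=> h; rewrite lt_min => /andP[hr hs].
rewrite -fgx -fg; first exact: H.
by rewrite /= opprD addNKr normrN.
Qed.

Lemma near_pd (R : realType) m (f g : 'rV[R]_m -> R) x i :
  (\near x, f x = g x) -> pd i f x = pd i g x.
Proof. exact: near_eq_derive. Qed.

Lemma open_near (T : topologicalType) (U : set T) (P : T -> Prop) x :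
  open U -> U x -> (forall y, U y -> P y) -> \near x, P x.
Proof.
by move=> oU Ux H; apply: filterS (open_nbhs_nbhs (conj oU Ux)) => y; exact: H.
Qed.

Lemma pdD (R : realType) m (f g : 'rV[R]_m -> R) x i : differentiable f x ->
  differentiable g x -> pd i (fun y => f y + g y) x = pd i f x + pd i g x.
Proof. by move=> df dg; rewrite /pd -deriveD//; exact: diff_derivable. Qed.

Lemma pdB (R : realType) m (f g : 'rV[R]_m -> R) x i : differentiable f x ->
  differentiable g x -> pd i (fun y => f y - g y) x = pd i f x - pd i g x.
Proof. by move=> df dg; rewrite /pd -deriveB//; exact: diff_derivable. Qed.

Lemma pdM (R : realType) m (f g : 'rV[R]_m -> R) x i : differentiable f x ->
  differentiable g x ->
  pd i (fun y => f y * g y) x = pd i f x * g x + f x * pd i g x.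
Proof.
move=> df dg; rewrite /pd deriveM; [|exact: diff_derivable..].
by rewrite addrC; congr (_ + _); exact: mulrC.
Qed.

Lemma pd_cst (R : realType) m (c : R) (x : 'rV[R]_m) i : pd i (fun=> c) x = 0.
Proof. exact: derive_cst. Qed.

Lemma pdZ (R : realType) m (c : R) (f : 'rV[R]_m -> R) x i :
  differentiable f x -> pd i (fun y => c * f y) x = c * pd i f x.
Proof.
by move=> df; rewrite pdM ?pd_cst ?mul0r ?add0r//; exact: differentiable_cst.
Qed.

Lemma differentiable_bigsum (R : realType) m (I : finType)
    (f : I -> 'rV[R]_m -> R) x :
  (forall k, differentiable (f k) x) -> differentiable (fun y => \sum_k f k y) x.
Proof.
move=> df; elim: (index_enum I) => [|k s IH].
  have -> : (fun y => \sum_(k <- [::]) f k y) = fun=> 0.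
    by apply/funext => y; rewrite big_nil.
  exact: differentiable_cst.
have -> : (fun y => \sum_(j <- k :: s) f j y) =
    fun y => f k y + \sum_(j <- s) f j y.
  by apply/funext => y; rewrite big_cons.
exact: differentiableD.
Qed.

Lemma pd_sum (R : realType) m (I : finType) (f : I -> 'rV[R]_m -> R) x i :
  (forall k, differentiable (f k) x) ->
  pd i (fun y => \sum_k f k y) x = \sum_k pd i (f k) x.
Proof.
move=> df.
suff [] : differentiable (fun y => \sum_k f k y) x /\
    pd i (fun y => \sum_k f k y) x = \sum_k pd i (f k) x by [].
elim: (index_enum I) => [|k s [IH1 IH2]].
  have -> : (fun y => \sum_(k <- [::]) f k y) = fun=> 0.
    by apply/funext => y; rewrite big_nil.
  by rewrite big_nil pd_cst; split; first exact: differentiable_cst.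
have -> : (fun y => \sum_(j <- k :: s) f j y) =
    fun y => f k y + \sum_(j <- s) f j y.
  by apply/funext => y; rewrite big_cons.
by rewrite big_cons pdD// IH2; split => //; exact: differentiableD.
Qed.

Lemma pd_sum_mul (R : realType) m (S T : 'I_m -> 'rV[R]_m -> R) x i :
  (forall j, differentiable (S j) x) -> (forall j, differentiable (T j) x) ->
  pd i (fun y => \sum_j S j y * T j y) x =
  \sum_j (pd i (S j) x * T j x + S j x * pd i (T j) x).
Proof.
move=> dS dT; rewrite (@pd_sum R m 'I_m (fun j y => S j y * T j y)); last first.
  by move=> j; exact: differentiableM.
by apply: eq_bigr => j _; rewrite pdM.
Qed.

Lemma pd_coord (R : realType) m (x : 'rV[R]_m) i k :
  pd i (fun y => y 0 k) x = (i == k)%:R.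
Proof.
have E : (fun y : 'rV[R]_m => y 0 k) = linear_form (fun j => (k == j)%:R).
  apply/funext => y; rewrite /linear_form (bigD1 k) //= eqxx mulr1 big1 ?addr0//.
  by move=> j jk; rewrite eq_sym (negbTE jk) mulr0.
rewrite E (proj2 (pd_linear_form _ _)).
by rewrite eq_sym.
Qed.

Lemma differentiable_rV (R : realType) (V : normedModType R) n
    (f : V -> 'rV[R]_n) x :
  (forall i, differentiable (fun y => f y 0 i) x) -> differentiable f x.
Proof.
move=> df.
have -> : f = \sum_i (fun y => f y 0 i *: delta_mx 0 i).
  by apply/funext => y; rewrite fct_sumE {1}(row_sum_delta (f y)).
by apply: differentiable_sum => i; apply: differentiableZl.
Qed.

Lemma differentiable_coord_of (R : realType) (V : normedModType R) n
    (f : V -> 'rV[R]_n) x i :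
  differentiable f x -> differentiable (fun y => f y 0 i) x.
Proof.
move=> df; apply: (@differentiable_comp _ _ _ _ f (fun v : 'rV_n => v 0 i)).
  exact: df.
exact: differentiable_coord.
Qed.

Lemma derive_rV (R : realType) (V : normedModType R) n (f : V -> 'rV[R]_n)
    x v i : differentiable f x -> 'D_v f x 0 i = 'D_v (fun y => f y 0 i) x.
Proof. by move=> df; rewrite derive_mx ?mxE//; exact: diff_derivable. Qed.

(** The inner map is defined on any normed space, so that the rule also covers
    curves and slices of functions on a product. *)
Lemma chain_D (R : realType) (V : normedModType R) n (f : V -> 'rV[R]_n)
    (g : 'rV[R]_n -> R) x v :
  differentiable f x -> differentiable g (f x) ->
  'D_v (fun y => g (f y)) x = \sum_i 'D_v (fun y => f y 0 i) x * pd i g (f x).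
Proof.
move=> df dg; rewrite deriveE; last exact: differentiable_comp.
rewrite (@diff_comp _ _ _ _ f g)//= -!deriveE// diff_pd//.
by apply: eq_bigr => i _; rewrite derive_rV.
Qed.

Lemma jacobianE (R : realType) m n (f : 'rV[R]_m -> 'rV[R]_n) x i j :
  differentiable f x -> 'J f x i j = pd i (fun y => f y 0 j) x.
Proof.
move=> df; rewrite /jacobian /lin1_mx mxE -deriveE// /pd -derive_rV//.
Qed.

Lemma is_derive_line (R : realType) (V : normedModType R) (f : V -> R) (x v : V)
    (s : R) : differentiable f (x + s *: v) ->
  is_derive s 1 (fun t : R => f (x + t *: v)) ('D_v f (x + s *: v)).
Proof.
move=> df.
have E : (fun h : R => h^-1 *: (((fun t : R => f (x + t *: v)) \o shift s) (h *: 1)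
      - f (x + s *: v))) =
    (fun h => h^-1 *: ((f \o shift (x + s *: v)) (h *: v) - f (x + s *: v))).
  apply/funext => h /=; congr (_ *: (f _ - _)).
  by rewrite -[h *: 1]/(h * 1) mulr1 scalerDl addrCA.
by apply: DeriveDef; rewrite /derivable ?/derive E//; exact: diff_derivable df.
Qed.

Lemma derive_shiftr (R : realType) (V : normedModType R) (f : V -> R) (x w v : V) :
  'D_v (fun y => f (y + w)) x = 'D_v f (x + w).
Proof.
rewrite /derive; set g1 := fun h => _; set g2 := fun h => _.
suff -> : g1 = g2 by [].
by apply/funext => h; rewrite /g1 /g2 /= addrA.
Qed.

Lemma differentiable_shiftr (R : realType) (V : normedModType R) (f : V -> R) (x w : V) :
  differentiable f (x + w) -> differentiable (fun y => f (y + w)) x.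
Proof.
move=> df; apply: (@differentiable_comp _ _ _ _ (fun y => y + w) f) => //.
Qed.

Lemma MVT_line (R : realType) (V : normedModType R) (f : V -> R) (x v : V)
    (h : R) : 0 < h ->
  (forall s, 0 <= s <= h -> differentiable f (x + s *: v)) ->
  exists2 c, 0 < c < h & f (x + h *: v) - f x = 'D_v f (x + c *: v) * h.
Proof.
move=> h0 df.
have [||c] := @MVT R (fun t => f (x + t *: v)) (fun t => 'D_v f (x + t *: v)) 0 h h0.
- move=> s; rewrite in_itv /= => /andP[s0 sh]; apply: is_derive_line.
  by apply: df; rewrite !ltW.
- apply: continuous_in_subspaceT => s; rewrite inE /= in_itv /= => sh.
  apply: differentiable_continuous.
  apply/derivable1_diffP.
  by case: (is_derive_line (df s sh)).
rewrite in_itv /= scale0r addr0 subr0 => ch ->.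
by exists c.
Qed.

Lemma norm_delta_le (R : realType) m (i : 'I_m) :
  `|delta_mx 0 i : 'rV[R]_m| <= 1.
Proof.
apply: norm_rV_le => // k; rewrite mxE /= normr_nat.
by case: eqP; rewrite ?lexx ?ler01.
Qed.

(** Only the first derivatives near x and the differentiability of one of them
    at x enter: the mean value theorem in direction i turns the second
    difference into a difference of values of that derivative, to which its
    linear approximation at x applies twice. *)
Lemma second_difference (R : realType) m (U : set 'rV[R]_m) (f : 'rV[R]_m -> R)
    x i j : open U -> U x -> (forall y, U y -> differentiable f y) ->
  differentiable (pd i f) x -> forall e, 0 < e -> exists2 r, 0 < r &
  forall h, 0 < h < r ->
   `|f (x + h *: delta_mx 0 j + h *: delta_mx 0 i) - f (x + h *: delta_mx 0 j)
     - (f (x + h *: delta_mx 0 i) - f x) - h ^+ 2 * pd j (pd i f) x|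
     <= e * h ^+ 2.
Proof.
move=> oU Ux fU dg e e0.
have /nbhs_normP[r0 /= r00 BU] := open_nbhs_nbhs (conj oU Ux).
have [|r1 r10 H] := diff_linear_remainder dg (e := e / 3); first by rewrite divr_gt0.
exists (Num.min r0 r1 / 2); first by rewrite divr_gt0// lt_min r00.
move=> h /andP[h0 hr].
have h2r : h + h < Num.min r0 r1 by lra.
have := h2r; rewrite lt_min => /andP[h2r0 h2r1].
have nD k (c : R) : `|c *: delta_mx 0 k : 'rV[R]_m| <= `|c|.
  by rewrite normrZ ler_piMr// norm_delta_le.
have nD2 c : 0 <= c <= h -> `|h *: delta_mx 0 j + c *: delta_mx 0 i : 'rV[R]_m| <= h + h.
  move=> /andP[c0 ch]; apply: (le_trans (ler_normD _ _)); apply: lerD.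
    by apply: (le_trans (nD _ _)); rewrite gtr0_norm.
  by apply: (le_trans (nD _ _)); rewrite ger0_norm.
pose F y := f (y + h *: delta_mx 0 j) - f y.
have [|c /andP[c0 ch]] := @MVT_line R _ F x (delta_mx 0 i) h h0.
  move=> s /andP[s0 sh]; apply: differentiableB.
    apply: (@differentiable_comp _ _ _ _ (fun y => y + h *: delta_mx 0 j) f).
      exact: differentiableD.
    apply: fU; apply: BU; rewrite /= opprD addrA opprD addrA subrr add0r.
    rewrite -normrN opprD !opprK addrC.
    by apply: le_lt_trans h2r0; apply: nD2; rewrite s0.
  apply: fU; apply: BU; rewrite /= opprD addrA subrr add0r normrN.
  apply: le_lt_trans h2r0; apply: (le_trans (nD _ _)); rewrite ger0_norm//.
  lra.
have d1 : differentiable f (x + c *: delta_mx 0 i).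
  apply: fU; apply: BU; rewrite /= opprD addrA subrr add0r normrN.
  apply: le_lt_trans h2r0; apply: (le_trans (nD _ _)); rewrite gtr0_norm//; lra.
have d2 : differentiable f (x + c *: delta_mx 0 i + h *: delta_mx 0 j).
  apply: fU; apply: BU; rewrite /= opprD addrA opprD addrA subrr add0r.
  rewrite -normrN opprD !opprK addrC.
  by apply: le_lt_trans h2r0; apply: nD2; rewrite !ltW.
have DF : 'D_(delta_mx 0 i) F (x + c *: delta_mx 0 i) =
   pd i f (x + (h *: delta_mx 0 j + c *: delta_mx 0 i)) - pd i f (x + c *: delta_mx 0 i).
  rewrite /F deriveB; [|apply: diff_derivable..]; last 2 first.
  - exact: differentiable_shiftr.
  - exact: d1.
  congr (_ - _); rewrite derive_shiftr.
  by rewrite /pd -addrA [c *: _ + _]addrC.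
rewrite DF.
have ch01 : 0 <= c <= h by rewrite !ltW.
have H2 := H _ (le_lt_trans (nD2 c ch01) h2r1).
have H1 : `|c *: delta_mx 0 i : 'rV[R]_m| <= h.
  by apply: (le_trans (nD _ _)); rewrite gtr0_norm// ltW.
have hr1 : h < r1 by lra.
have H3 := H _ (le_lt_trans H1 hr1).
rewrite /F.
have -> : x + h *: delta_mx 0 j + h *: delta_mx 0 i =
    x + h *: delta_mx 0 i + h *: delta_mx 0 j.
  by rewrite -addrA [X in _ + X]addrC addrA.
rewrite linearD !linearZ /= !linear_form_delta in H2.
rewrite linearZ /= linear_form_delta in H3.
have {}H2 := le_trans H2 (ler_wpM2l (ltW (divr_gt0 e0 (ltr0n _ 3))) (nD2 c ch01)).
have {}H3 := le_trans H3 (ler_wpM2l (ltW (divr_gt0 e0 (ltr0n _ 3))) H1).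
move: H2 H3; rewrite /GRing.scale /=.
set G2 := pd i f _; set G1 := pd i f (x + _); set g0 := pd i f x.
set pi := pd i _ x; set pj := pd j _ x => H2 H3 E.
set a := f _ in E *; set b := f _ in E *; set a' := f _ in E *; set b' := f _ in E *.
have -> : a - a' - (b - b') - h ^+ 2 * pj = h * (G2 - G1 - h * pj).
  by rewrite (_ : a - a' - (b - b') = (a - b) - (a' - b')); [rewrite E; ring|ring].
rewrite normrM gtr0_norm// expr2 [e * _]mulrCA ler_pM2l//.
have -> : G2 - G1 - h * pj = (G2 - g0 - (h * pj + c * pi)) - (G1 - g0 - c * pi).
  by ring.
by apply: (le_trans (ler_normB _ _)); apply: (le_trans (lerD H2 H3)); lra.
Qed.

(** The second difference does not depend on the order of the two directions,
    and both mixed derivatives are its limit after division by h^2. *)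
Lemma schwarz (R : realType) m (U : set 'rV[R]_m) (f : 'rV[R]_m -> R) x i j :
  open U -> U x -> (forall y, U y -> differentiable f y) ->
  differentiable (pd i f) x -> differentiable (pd j f) x ->
  pd i (pd j f) x = pd j (pd i f) x.
Proof.
move=> oU Ux fU di dj; apply/eqP; rewrite -subr_eq0 -normr_eq0 eq_le normr_ge0 andbT.
apply/ler_addgt0Pr => e e0; rewrite add0r.
have e2 : 0 < e / 2 by rewrite divr_gt0.
have [r r0 Hi] := second_difference j oU Ux fU di e2.
have [s s0 Hj] := second_difference i oU Ux fU dj e2.
pose h := Num.min r s / 2.
have m0 : 0 < Num.min r s by rewrite lt_min r0.
have h0 : 0 < h by rewrite divr_gt0.
have hm : h < Num.min r s by rewrite /h; lra.
have := hm; rewrite lt_min => /andP[hr hs].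
have /andP[] : 0 < h < r by rewrite h0.
move=> _ _; have := Hi h; rewrite h0 hr => /(_ isT); have := Hj h; rewrite h0 hs => /(_ isT).
have -> : x + h *: delta_mx 0 j + h *: delta_mx 0 i =
    x + h *: delta_mx 0 i + h *: delta_mx 0 j.
  by rewrite -addrA [X in _ + X]addrC addrA.
set a := f _; set b := f _; set c := f _; set z := f _ => H1 H2.
rewrite -(ler_pM2l (exprn_gt0 2 h0)).
rewrite -[X in X * `|_|](ger0_norm (ltW (exprn_gt0 2 h0))) -normrM.
move: H1 H2; set p := pd i _ x; set q := pd j _ x => H1 H2.
have -> : h ^+ 2 * (p - q) = (a - c - (b - z) - h ^+ 2 * q) - (a - b - (c - z) - h ^+ 2 * p).
  by ring.
apply: (le_trans (ler_normB _ _)); apply: (le_trans (lerD H2 H1)).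
by rewrite -mulrDl -splitr mulrC.
Qed.

(** * Functions whose derivatives grow factorially *)

(** In terms of the one-variable majorant C (1 - rho t)^(-A): a partial
    derivative of order j is at most C A (A + 1) ... (A + j - 1) rho^j, the j-th
    derivative of the majorant at 0. Differentiation replaces the majorant by
    the one with constants C A rho and A + 1; recursion on the number of
    derivatives along this rule makes the calculus below a matter of short
    inductions, with no higher Leibniz or chain rule. *)
Fixpoint majorized (R : realType) m (k : nat) (U : set 'rV[R]_m)
    (f : 'rV[R]_m -> R) (C A rho : R) : Prop :=
  (forall y, U y -> differentiable f y /\ `|f y| <= C) /\
  (if k is k'.+1 then forall i, majorized k' U (pd i f) (C * A * rho) (A + 1) rho
   else True).

Definition has_majorant (R : realType) m (U : set 'rV[R]_m) (f : 'rV[R]_m -> R) :=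
  exists C A rho, [/\ 0 <= C, 0 <= A, 0 <= rho &
    forall k, majorized k U f C A rho].

Lemma majorized_at (R : realType) m k U f (C A rho : R) (y : 'rV[R]_m) :
  majorized k U f C A rho -> U y -> differentiable f y /\ `|f y| <= C.
Proof. by case: k => [|k] [H _]; exact: H. Qed.

Lemma majorized_eq (R : realType) m k (U : set 'rV[R]_m) f g C A rho : open U ->
  (forall y, U y -> f y = g y) -> majorized k U f C A rho -> majorized k U g C A rho.
Proof.
move=> oU; elim: k f g C A rho => [|k IH] f g C A rho fg [H1 H2]; split => //.
- move=> y Uy; rewrite -fg//; have [df fC] := H1 y Uy; split => //.
  by apply: near_differentiable df; exact: open_near Uy fg.
- move=> y Uy; rewrite -fg//; have [df fC] := H1 y Uy; split => //.
  by apply: near_differentiable df; exact: open_near Uy fg.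
- move=> i; apply: IH (H2 i) => y Uy; apply: near_pd.
  exact: open_near Uy fg.
Qed.

Lemma majorizedW (R : realType) m k (U U' : set 'rV[R]_m) f (C C' A A' rho rho' : R) :
  U' `<=` U -> 0 <= C <= C' -> 0 <= A <= A' -> 0 <= rho <= rho' ->
  majorized k U f C A rho -> majorized k U' f C' A' rho'.
Proof.
move=> UU + + /andP[r0 rr].
elim: k f C C' A A' => [|k IH] f C C' A A' /andP[C0 CC] /andP[A0 AA] [H1 H2]; split => //.
- by move=> y /UU/H1[df fC]; split => //; exact: le_trans fC CC.
- by move=> y /UU/H1[df fC]; split => //; exact: le_trans fC CC.
- move=> i; apply: IH (H2 i); last by rewrite addr_ge0//= lerD2r.
  by rewrite !mulr_ge0//= !ler_pM// mulr_ge0.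
Qed.

Lemma majorized_cst (R : realType) m k (U : set 'rV[R]_m) (c C A rho : R) :
  `|c| <= C -> 0 <= A -> 0 <= rho -> majorized k U (fun=> c) C A rho.
Proof.
move=> + + r0; elim: k c C A => [|k IH] c C A cC A0; split => //.
move=> i; have -> : pd i (fun=> c) = fun=> 0 :> R by apply/funext => y; exact: pd_cst.
apply: IH; rewrite ?normr0 ?addr_ge0// !mulr_ge0//.
exact: le_trans (normr_ge0 c) cC.
Qed.

Lemma majorizedS (R : realType) m k (U : set 'rV[R]_m) f (C A rho : R) :
  majorized k.+1 U f C A rho -> majorized k U f C A rho.
Proof.
elim: k f C A => [|k IH] f C A [H1 H2]; split => // i.
exact: IH (H2 i).
Qed.

Lemma majorizedD (R : realType) m k (U : set 'rV[R]_m) f g (C D A rho : R) : open U ->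
  majorized k U f C A rho -> majorized k U g D A rho ->
  majorized k U (fun y => f y + g y) (C + D) A rho.
Proof.
move=> oU; elim: k f g C D A => [|k IH] f g C D A [H1 H2] [K1 K2]; split => //.
- move=> y Uy; have [df fC] := H1 y Uy; have [dg gD] := K1 y Uy.
  split; first exact: differentiableD.
  exact: (le_trans (ler_normD _ _) (lerD fC gD)).
- move=> y Uy; have [df fC] := H1 y Uy; have [dg gD] := K1 y Uy.
  split; first exact: differentiableD.
  exact: (le_trans (ler_normD _ _) (lerD fC gD)).
- move=> i; rewrite 2!mulrDl.
  apply: majorized_eq (IH _ _ _ _ _ (H2 i) (K2 i)) => // y Uy.
  have [df _] := H1 y Uy; have [dg _] := K1 y Uy.
  by rewrite pdD.
Qed.

(** Multiplying majorants adds their exponents; on the constants this is the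
    Leibniz rule (C A rho) D + C (D B rho) = C D (A + B) rho. *)
Lemma majorizedM (R : realType) m k (U : set 'rV[R]_m) f g (C D A B rho : R) :
  open U -> 0 <= C -> 0 <= D -> 0 <= A -> 0 <= B -> 0 <= rho ->
  majorized k U f C A rho -> majorized k U g D B rho ->
  majorized k U (fun y => f y * g y) (C * D) (A + B) rho.
Proof.
move=> oU + + + + r0.
elim: k f g C D A B => [|k IH] f g C D A B C0 D0 A0 B0 HH KK.
  split => // y Uy; have [df fC] := majorized_at HH Uy; have [dg gD] := majorized_at KK Uy.
  by split; [exact: differentiableM|rewrite normrM ler_pM].
have [H1 H2] := HH; have [K1 K2] := KK; split.
  move=> y Uy; have [df fC] := H1 y Uy; have [dg gD] := K1 y Uy.
  by split; [exact: differentiableM|rewrite normrM ler_pM].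
move=> i.
have L := IH _ _ _ _ _ _ _ D0 _ B0 (H2 i) (majorizedS KK).
have {}L := L (mulr_ge0 (mulr_ge0 C0 A0) r0) (addr_ge0 A0 ler01).
have K := IH _ _ _ _ _ _ C0 _ A0 _ (majorizedS HH) (K2 i).
have {}K := K (mulr_ge0 (mulr_ge0 D0 B0) r0) (addr_ge0 B0 ler01).
rewrite addrAC in L; rewrite addrA in K.
have := majorizedD oU L K.
have -> : C * A * rho * D + C * (D * B * rho) = C * D * (A + B) * rho by ring.
apply: majorized_eq => // y Uy.
have [df _] := H1 y Uy; have [dg _] := K1 y Uy.
by rewrite pdM.
Qed.

(** A chain rule of all orders, for a family phi_i of successive derivatives
    with factorial growth. The products phi_j(f) g are stable under
    differentiation, which gives phi_{j+1}(f) (f' g) + phi_j(f) g', so the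
    induction is over these products rather than over compositions. The factor
    j + 1 brought in by phi_{j+1} is absorbed by lowering the exponent from B to
    B - j + 1. The condition 2 j <= B is inherited by both terms, since f' g has
    exponent B + 2, and yields j + 1 <= B - j + 1 and B <= 2 (B - j + 1): hence
    the ratio (2 + tau C) rho. *)
Lemma majorized_comp (R : realType) m k (U : set 'rV[R]_m) (f g : 'rV[R]_m -> R)
    (phi : nat -> R -> R) (K tau C D B rho : R) (j : nat) :
  open U -> 0 <= K -> 0 <= tau -> 0 <= C -> 0 <= rho ->
  (forall i y, U y -> is_derive (f y) 1 (phi i) (phi i.+1 (f y)) /\
      `|phi i (f y)| <= K * i`!%:R * tau ^+ i) ->
  (forall k, majorized k U f C 1 rho) ->
  0 <= D -> j%:R *+ 2 <= B ->
  (forall k, majorized k U g D B rho) ->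
  majorized k U (fun y => phi j (f y) * g y) (K * j`!%:R * tau ^+ j * D)
     (B - j%:R + 1) ((2 + tau * C) * rho).
Proof.
move=> oU K0 t0 C0 r0 Hphi Hf.
have Hf0 y : U y -> differentiable f y by move=> Uy; case: (majorized_at (Hf 0%N) Uy).
have dphi i y : U y -> differentiable (fun y => phi i (f y)) y.
  move=> Uy; apply: (@differentiable_comp _ _ _ _ f (phi i)); first exact: Hf0.
  by apply/derivable1_diffP; have [[]] := Hphi i y Uy.
have pdphi i y l : U y ->
    pd l (fun y => phi i (f y)) y = phi i.+1 (f y) * pd l f y.
  move=> Uy; have [dp _] := Hphi i y Uy.
  have dp' : differentiable (phi i) (f y) by apply/derivable1_diffP; case: dp.
  rewrite /pd deriveE; last exact: dphi.
  rewrite (@diff_comp _ _ _ _ f (phi i))//=; last exact: Hf0.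
  rewrite -(deriveE _ (Hf0 y Uy)) deriv1E; last by case: dp.
  rewrite derive1E; have [_ ->] := dp.
  by rewrite mulrC.
elim: k g D B j => [|k IH] g D B j D0 jB Hg.
  split => // y Uy; have [dg gD] := majorized_at (Hg 0%N) Uy.
  have [_ b] := Hphi j y Uy.
  by split; [apply: differentiableM => //; exact: dphi|rewrite normrM ler_pM].
have j0 : 0 <= j%:R :> R by exact: ler0n.
split.
  move=> y Uy; have [dg gD] := majorized_at (Hg 0%N) Uy.
  have [_ b] := Hphi j y Uy.
  by split; [apply: differentiableM => //; exact: dphi|rewrite normrM ler_pM].
move=> i.
have Hfi l : majorized l U (pd i f) (C * rho) (1 + 1) rho.
  by have [_ /(_ i)] := Hf l.+1; rewrite mulr1.
have Hgi l : majorized l U (pd i g) (D * B * rho) (B + 1) rho.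
  by have [_ /(_ i)] := Hg l.+1.
have B0 : 0 <= B by apply: le_trans jB; rewrite mulrn_wge0.
(* the two terms of the derivative, each with its majorant *)
have I1 := IH (fun y => pd i f y * g y) (C * rho * D) (1 + 1 + B) j.+1.
have {}I1 := I1 (mulr_ge0 (mulr_ge0 C0 r0) D0).
have {}I1 := I1 _ (fun l => majorizedM oU (mulr_ge0 C0 r0) D0 _ B0 r0 (Hfi l) (Hg l)).
have {}I1 := I1 _ (addr_ge0 ler01 ler01).
have {}I1 : majorized k U (fun y => phi j.+1 (f y) * (pd i f y * g y))
    (K * j.+1`!%:R * tau ^+ j.+1 * (C * rho * D)) (B - j%:R + 1 + 1)
    ((2 + tau * C) * rho).
  have -> : B - j%:R + 1 + 1 = 1 + 1 + B - j.+1%:R + 1 by rewrite -natr1; ring.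
  by apply: I1; rewrite -natr1; lra.
have I2 := IH (pd i g) (D * B * rho) (B + 1) j.
have {}I2 := I2 (mulr_ge0 (mulr_ge0 D0 B0) r0) _ Hgi.
have {}I2 : majorized k U (fun y => phi j (f y) * pd i g y)
    (K * j`!%:R * tau ^+ j * (D * B * rho)) (B - j%:R + 1 + 1)
    ((2 + tau * C) * rho).
  have -> : B - j%:R + 1 + 1 = B + 1 - j%:R + 1 by ring.
  by apply: I2; lra.
have := majorizedD oU I1 I2.
move=> HH.
have {HH} : majorized k U (pd i (fun y => phi j (f y) * g y))
   (K * j.+1`!%:R * tau ^+ j.+1 * (C * rho * D) + K * j`!%:R * tau ^+ j * (D * B * rho))
   (B - j%:R + 1 + 1) ((2 + tau * C) * rho).
  apply: majorized_eq HH => // y Uy.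
  have [dg _] := majorized_at (Hg 0%N) Uy.
  by rewrite pdM//; [rewrite pdphi// mulrA|exact: dphi].
apply: majorizedW => //.
- apply/andP; split.
    apply: addr_ge0; rewrite !mulr_ge0// ?exprn_ge0//; exact: ler0n.
  set F := K * j`!%:R * tau ^+ j * (D * rho).
  have F0 : 0 <= F.
    rewrite /F !mulr_ge0// ?exprn_ge0//; exact: ler0n.
  have -> : K * j.+1`!%:R * tau ^+ j.+1 * (C * rho * D) +
      K * j`!%:R * tau ^+ j * (D * B * rho) = F * (tau * C * j.+1%:R + B).
    by rewrite factS natrM exprS /F; ring.
  have -> : K * j`!%:R * tau ^+ j * D * (B - j%:R + 1) * ((2 + tau * C) * rho) =
     F * ((2 + tau * C) * (B - j%:R + 1)) by rewrite /F; ring.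
  apply: ler_wpM2l => //.
  rewrite mulrDl addrC lerD//; first by lra.
  apply: ler_wpM2l; first exact: mulr_ge0.
  by rewrite -natr1; lra.
- by rewrite lexx andbT; lra.
- by rewrite lexx andbT !mulr_ge0// addr_ge0// mulr_ge0.
Qed.

(** A smaller exponent is paid for by a larger ratio, as
    A + i <= a (A' + i) for all i. *)
Lemma majorized_rescale (R : realType) m k (U : set 'rV[R]_m) f (C C' A A' rho a : R) :
  1 <= a -> 0 <= rho -> 0 <= C <= C' -> 0 <= A <= a * A' ->
  majorized k U f C A rho -> majorized k U f C' A' (a * rho).
Proof.
move=> a1 r0; elim: k f C C' A A' => [|k IH] f C C' A A' /andP[C0 CC] /andP[A0 AA] [H1 H2].
  by split => // y /H1[df fC]; split => //; exact: le_trans fC CC.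
split; first by move=> y /H1[df fC]; split => //; exact: le_trans fC CC.
move=> i; apply: IH (H2 i).
  rewrite !mulr_ge0//= mulrA ler_wpM2r// -mulrA [A' * a]mulrC ler_pM//.
by rewrite addr_ge0//= mulrDr lerD// mulr1.
Qed.

(** Normalizing the exponent to 1 gives two functions a common exponent and
    ratio, as needed for sums. *)
Lemma has_majorant_normal (R : realType) m (U : set 'rV[R]_m) f : has_majorant U f ->
  exists C rho, [/\ 0 <= C, 0 <= rho & forall k, majorized k U f C 1 rho].
Proof.
move=> [C [A [rho [C0 A0 r0 H]]]]; exists C, ((A + 1) * rho); split => //.
  by rewrite mulr_ge0// addr_ge0.
move=> k; apply: majorized_rescale (H k) => //; first by rewrite lerDr.
  by rewrite C0 lexx.
by rewrite A0 mulr1 lerDl ler01.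
Qed.

Lemma has_majorant_common (R : realType) m (U : set 'rV[R]_m) f g :
  has_majorant U f -> has_majorant U g ->
  exists C rho, [/\ 0 <= C, 0 <= rho, forall k, majorized k U f C 1 rho &
    forall k, majorized k U g C 1 rho].
Proof.
move=> /has_majorant_normal[C [r [C0 r0 H]]] /has_majorant_normal[D [s [D0 s0 K]]].
exists (C + D), (r + s); split; rewrite ?addr_ge0// => k.
  by apply: majorizedW (H k); rewrite ?C0 ?r0 ?lerDl ?lexx ?ler01.
by apply: majorizedW (K k); rewrite ?D0 ?s0 ?lerDr ?lexx ?ler01.
Qed.

Lemma has_majorantW (R : realType) m (U U' : set 'rV[R]_m) f :
  U' `<=` U -> has_majorant U f -> has_majorant U' f.
Proof.
move=> UU [C [A [rho [C0 A0 r0 H]]]]; exists C, A, rho; split => // k.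
by apply: majorizedW (H k); rewrite ?C0 ?A0 ?r0 ?lexx.
Qed.

Definition loc_majorant (R : realType) m (W : set 'rV[R]_m) (f : 'rV[R]_m -> R) :=
  forall x, W x -> exists U, [/\ open U, U x & has_majorant U f].

Lemma is_derive_inv (R : realType) (t : R) : t != 0 ->
  is_derive t 1 (fun s : R => s^-1) (- t ^- 2).
Proof.
move=> t0; apply: DeriveDef; first exact: (@derivableV R _ id).
by rewrite (@deriveV R _ id)// derive_id; exact: mulr1.
Qed.

Section loc_majorant.
Context {R : realType} {m : nat} (W : set 'rV[R]_m).
Implicit Types f g : 'rV[R]_m -> R.
Local Notation lm := (loc_majorant W).

Lemma lm_cst (c : R) : lm (fun=> c).
Proof.
move=> x _; exists setT; split => //; first exact: openT.
by exists `|c|, 0, 0; split => // k; exact: majorized_cst.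
Qed.

Lemma lm2 (F : ('rV[R]_m -> R) -> ('rV[R]_m -> R) -> 'rV[R]_m -> R) f g :
  (forall U f g, open U -> has_majorant U f -> has_majorant U g -> has_majorant U (F f g)) ->
  lm f -> lm g -> lm (F f g).
Proof.
move=> H lf lg x Wx.
have [U [oU Ux Uf]] := lf x Wx; have [V [oV Vx Vg]] := lg x Wx.
exists (U `&` V); split => //; first exact: openI.
apply: H; first exact: openI.
  by apply: has_majorantW Uf => y [].
by apply: has_majorantW Vg => y [].
Qed.

Lemma lm_add f g : lm f -> lm g -> lm (fun y => f y + g y).
Proof.
apply: (@lm2 (fun f g y => f y + g y)) => U {}f {}g oU bf bg.
have [C [r [C0 r0 H K]]] := has_majorant_common bf bg.
exists (C + C), 1, r; split; rewrite ?addr_ge0// => k.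
exact: majorizedD.
Qed.

Lemma lm_mul f g : lm f -> lm g -> lm (fun y => f y * g y).
Proof.
apply: (@lm2 (fun f g y => f y * g y)) => U {}f {}g oU bf bg.
have [C [r [C0 r0 H K]]] := has_majorant_common bf bg.
exists (C * C), (1 + 1), r; split; rewrite ?mulr_ge0// => k.
exact: majorizedM.
Qed.

Lemma lm_opp f : lm f -> lm (fun y => - f y).
Proof.
move=> lf; have -> : (fun y => - f y) = fun y => -1 * f y.
  by apply/funext => y; rewrite mulN1r.
by apply: lm_mul => //; exact: lm_cst.
Qed.

Lemma lm_sum (I : finType) (f : I -> 'rV[R]_m -> R) : (forall i, lm (f i)) ->
  lm (fun y => \sum_i f i y).
Proof.
move=> lf; elim: (index_enum I) => [|i s IH].
  have -> : (fun y => \sum_(i <- [::]) f i y) = fun=> 0.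
    by apply/funext => y; rewrite big_nil.
  exact: lm_cst.
have -> : (fun y => \sum_(j <- i :: s) f j y) = fun y => f i y + \sum_(j <- s) f j y.
  by apply/funext => y; rewrite big_cons.
exact: lm_add.
Qed.

Lemma lm_prod (I : finType) (f : I -> 'rV[R]_m -> R) : (forall i, lm (f i)) ->
  lm (fun y => \prod_i f i y).
Proof.
move=> lf; elim: (index_enum I) => [|i s IH].
  have -> : (fun y => \prod_(i <- [::]) f i y) = fun=> 1.
    by apply/funext => y; rewrite big_nil.
  exact: lm_cst.
have -> : (fun y => \prod_(j <- i :: s) f j y) = fun y => f i y * \prod_(j <- s) f j y.
  by apply/funext => y; rewrite big_cons.
exact: lm_mul.
Qed.

Lemma lm_pd f i : lm f -> lm (pd i f).
Proof.
move=> lf x /lf[U [oU Ux [C [A [r [C0 A0 r0 H]]]]]]; exists U; split => //.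
exists (C * A * r), (A + 1), r; split; rewrite ?addr_ge0 ?mulr_ge0// => k.
by have [_ /(_ i)] := H k.+1.
Qed.

Lemma lm_diff f x : lm f -> W x -> differentiable f x.
Proof.
move=> lf /lf[U [oU Ux [C [A [r [C0 A0 r0 H]]]]]].
by have [] := majorized_at (H 0%N) Ux.
Qed.

Lemma lm_eq f g : open W -> (forall x, W x -> f x = g x) -> lm f -> lm g.
Proof.
move=> oW fg lf x Wx; have [U [oU Ux [C [A [r [C0 A0 r0 H]]]]]] := lf x Wx.
exists (U `&` W); split => //; first exact: openI.
exists C, A, r; split => // k.
apply: (@majorized_eq _ _ _ _ f); first exact: openI.
  by move=> y [_ /fg].
by apply: majorizedW (H k); rewrite ?C0 ?A0 ?r0 ?lexx// => y [].
Qed.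

Lemma lm_near_pos f x : lm f -> W x -> 0 < f x -> exists U,
  [/\ open U, U x, has_majorant U f & forall y, U y -> f x / 2 < f y].
Proof.
move=> lf Wx fx0; have [U [oU Ux Uf]] := lf x Wx.
have cf : {for x, continuous f} by apply: differentiable_continuous; exact: lm_diff.
have /cf/nbhs_ballP[e /= e0 eP] : nbhs (f x) [set t | f x / 2 < t].
  apply: open_nbhs_nbhs; split; first exact: open_gt.
  by rewrite /= ltr_pdivrMr// ltr_pMr// ltr1n.
exists (U `&` ball x e); split.
- by apply: openI => //; exact: ball_open.
- by split => //; exact: ballxx.
- by apply: has_majorantW Uf => y [].
- by move=> y [_ /eP].
Qed.

(** The inverse and the square root together. If t u' = p u then the i-th
    derivative of u is p (p - 1) ... (p - i + 1) u(t) t^(-i), and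
    |p - j| <= j + 1 bounds the numerical factor by i!; the powers of t are
    controlled because f stays above f(x) / 2 near x. *)
Lemma lm_power (u : R -> R) (p : R) f :
  (forall t : R, 0 < t -> is_derive t 1 u (p * u t * t^-1)) ->
  (forall i : nat, `|p - i%:R| <= i%:R + 1) ->
  (forall a b : R, 0 < a -> exists2 K : R, 0 <= K &
     forall t, a < t -> t <= b -> `|u t| <= K) ->
  lm f -> (forall x, W x -> 0 < f x) -> lm (fun y => u (f y)).
Proof.
move=> du pi ub lf f0 x Wx; have fx0 := f0 x Wx.
have [U [oU Ux Uf Ufx]] := lm_near_pos lf Wx fx0.
exists U; split => //.
have [C [rho [C0 r0 HC]]] := has_majorant_normal Uf.
have a0 : 0 < f x / 2 by rewrite divr_gt0.
have [K K0 uK] := ub (f x / 2) C a0.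
pose c := fix c (i : nat) : R := if i is i'.+1 then c i' * (p - i'%:R) else 1.
pose phi i t := c i * u t * (t^-1) ^+ i.
have cB i : `|c i| <= i`!%:R.
  elim: i => [|i IH] /=; first by rewrite normr1.
  by rewrite normrM factS natrM mulrC ler_pM// -natr1.
have dphi i (t : R) : 0 < t -> is_derive t 1 (phi i) (phi i.+1 t).
  move=> t0; have tn0 : t != 0 by rewrite gt_eqF.
  have D1 := du t t0.
  have D2 := is_derive_inv tn0.
  have D3 := is_deriveX i D2.
  have D4 := is_deriveM (is_deriveM (is_derive_cst (c i) t 1) D1) D3.
  have -> : phi i = cst (c i) * u * (fun s : R => s^-1) ^+ i.
    by apply/funext => s; rewrite /phi !fctE.
  apply: is_derive_eq D4 _.
  rewrite /phi /GRing.scale /= !fctE mulr0 addr0.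
  case: i {D3} => [|i] /=.
    by rewrite !expr0 subr0; field.
  rewrite !exprS -natr1.
  by field.
exists (K * 0`!%:R * (f x / 2)^-1 ^+ 0 * 1), (0 - 0%:R + 1), ((2 + (f x / 2)^-1 * C) * rho).
have ia0 : 0 <= (f x / 2)^-1 by rewrite invr_ge0 ltW.
split; rewrite ?mulr_ge0 ?exprn_ge0// ?subr0 ?add0r ?addr_ge0 ?mulr_ge0//.
move=> k.
have := @majorized_comp R m k U f (fun=> 1) phi K (f x / 2)^-1 C 1 0 rho 0 oU K0 ia0 C0 r0.
move=> /(_ _ HC ler01 _ _).
have -> : (fun y => phi 0%N (f y) * 1) = fun y => u (f y).
  by apply/funext => y; rewrite /phi /= expr0 mul1r !mulr1.
rewrite subr0 add0r; apply => //.
- move=> i y Uy; have y0 : 0 < f y by apply: lt_trans (Ufx y Uy).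
  split; first exact: dphi.
  have [_ fyC] := majorized_at (HC 0%N) Uy.
  have := uK (f y) (Ufx y Uy) (le_trans (ler_norm _) fyC) => uKy.
  rewrite /phi !normrM [K * _]mulrC ler_pM//; first by rewrite ler_pM.
  have n1 : `|(f y)^-1| = (f y)^-1 by rewrite gtr0_norm ?invr_gt0.
  rewrite normrX n1; apply: lerXn2r; rewrite ?nnegrE ?invr_ge0 ?(ltW y0) ?(ltW a0)//.
  by rewrite lef_pV2 ?posrE// ltW// Ufx.
- by move=> k'; apply: majorized_cst => //; rewrite normr1.
Qed.

Lemma lm_inv f : lm f -> (forall x, W x -> 0 < f x) -> lm (fun y => (f y)^-1).
Proof.
apply: (@lm_power (fun t => t^-1) (-1) f).
- move=> t t0; have tn0 : t != 0 by rewrite gt_eqF.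
  apply: is_derive_eq (is_derive_inv tn0) _; by field.
- move=> i; rewrite -opprD normrN addrC ger0_norm//; exact: addr_ge0.
- move=> a b a0; exists a^-1; first by rewrite invr_ge0 ltW.
  move=> t /ltW at0 _; have t0 := lt_le_trans a0 at0.
  by rewrite gtr0_norm ?invr_gt0// lef_pV2 ?posrE.
Qed.

Lemma lm_sqrt f : lm f -> (forall x, W x -> 0 < f x) -> lm (fun y => Num.sqrt (f y)).
Proof.
apply: (@lm_power Num.sqrt (2^-1) f).
- move=> t t0; apply: is_derive_eq (is_derive1_sqrt t0) _.
  have s0 : Num.sqrt t != 0 by rewrite gt_eqF// sqrtr_gt0.
  rewrite -{3}(sqr_sqrtr (ltW t0)); by field.
- case=> [|i]; first by rewrite subr0 add0r ger0_norm; lra.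
  have i0 : 0 <= i%:R :> R by exact: ler0n.
  have -> : i.+1%:R = i%:R + 1 :> R by rewrite natr1.
  rewrite ler0_norm; lra.
- move=> a b a0; exists (Num.sqrt b); first exact: sqrtr_ge0.
  by move=> t _ tb; rewrite ger0_norm ?sqrtr_ge0// ler_wsqrtr.
Qed.

End loc_majorant.

(** * Homogeneous polynomials *)

Section homogeneous.
Context {R : realType} {m : nat}.
Implicit Types (p q : 'rV[R]_m -> R) (h : 'rV[R]_m) (B : R).

Fixpoint words (k : nat) : seq (seq 'I_m) :=
  if k is k'.+1 then [seq i :: s | i <- enum 'I_m, s <- words k'] else [:: [::]].

Definition word_monomial (s : seq 'I_m) (h : 'rV[R]_m) : R := \prod_(i <- s) h 0 i.

(** Homogeneous polynomials of degree k in noncommuting monomials, with B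
    bounding the sum of the absolute values of the coefficients. With words in
    place of multi-indices a polynomial of degree k + 1 is just
    sum_i h_i q_i(h), and no multinomial coefficients appear. *)
Definition hpoly (k : nat) (p : 'rV[R]_m -> R) (B : R) : Prop :=
  exists b : seq 'I_m -> R, (forall h, p h = \sum_(s <- words k) b s * word_monomial s h) /\
    \sum_(s <- words k) `|b s| <= B.

Lemma sum_words k (F : seq 'I_m -> R) :
  \sum_(s <- words k.+1) F s = \sum_i \sum_(s <- words k) F (i :: s).
Proof. by rewrite /= big_allpairs_dep /= big_enum. Qed.

Lemma hpoly0P p B : hpoly 0 p B <-> exists c, (forall h, p h = c) /\ `|c| <= B.
Proof.
split=> [[b [bE bB]]|[c [cE cB]]].
  exists (b [::]); rewrite /= !big_seq1 in bE bB; split => // h.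
  by rewrite bE big_seq1 /word_monomial big_nil mulr1.
exists (fun=> c); rewrite /= !big_seq1; split => // h.
by rewrite cE /word_monomial big_seq1 big_nil mulr1.
Qed.

Lemma hpolySP k p B : hpoly k.+1 p B <-> exists (q : 'I_m -> 'rV[R]_m -> R) (D : 'I_m -> R),
  [/\ forall i, hpoly k (q i) (D i), forall h, p h = \sum_i h 0 i * q i h &
      \sum_i D i <= B].
Proof.
split=> [[b [bE bB]]|[q [D [qD pE DB]]]].
  exists (fun i h => \sum_(s <- words k) b (i :: s) * word_monomial s h),
    (fun i => \sum_(s <- words k) `|b (i :: s)|); split.
  - by move=> i; exists (fun s => b (i :: s)).
  - move=> h; rewrite bE sum_words; apply: eq_bigr => i _.
    rewrite mulr_sumr; apply: eq_bigr => s _.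
    by rewrite /word_monomial big_cons mulrCA.
  - by rewrite sum_words in bB.
have /choice[b bP] : forall i, exists b : seq 'I_m -> R,
   (forall h, q i h = \sum_(s <- words k) b s * word_monomial s h) /\
    \sum_(s <- words k) `|b s| <= D i by move=> i; exact: qD.
exists (fun s => if s is i :: s' then b i s' else 0); split.
  move=> h; rewrite pE sum_words; apply: eq_bigr => i _.
  rewrite (bP i).1 mulr_sumr; apply: eq_bigr => s _.
  by rewrite /word_monomial big_cons mulrCA.
rewrite sum_words; apply: le_trans DB; apply: ler_sum => i _.
exact: (bP i).2.
Qed.

Lemma hpoly_ge0 k p B : hpoly k p B -> 0 <= B.
Proof. by move=> [b [_]]; apply: le_trans; exact: sumr_ge0. Qed.

Lemma hpoly_ext k p q B : (forall h, p h = q h) -> hpoly k p B -> hpoly k q B.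
Proof. by move=> pq [b [bE bB]]; exists b; split => // h; rewrite -pq. Qed.

Lemma hpolyW k p B D : B <= D -> hpoly k p B -> hpoly k p D.
Proof. by move=> BD [b [bE bB]]; exists b; split => //; exact: le_trans bB BD. Qed.

Lemma hpolyD k p q B D : hpoly k p B -> hpoly k q D -> hpoly k (fun h => p h + q h) (B + D).
Proof.
move=> [b [bE bB]] [c [cE cD]]; exists (fun s => b s + c s); split.
  by move=> h; rewrite bE cE -big_split; apply: eq_bigr => s _; rewrite mulrDl.
apply: le_trans (lerD bB cD); rewrite -big_split; apply: ler_sum => s _.
exact: ler_normD.
Qed.

Lemma hpolyZ k p B c : hpoly k p B -> hpoly k (fun h => c * p h) (`|c| * B).
Proof.
move=> [b [bE bB]]; exists (fun s => c * b s); split.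
  by move=> h; rewrite bE mulr_sumr; apply: eq_bigr => s _; rewrite mulrA.
by under eq_bigr do rewrite normrM; rewrite -mulr_sumr ler_wpM2l.
Qed.

Lemma hpoly_zero k : hpoly k (fun=> 0) 0.
Proof.
exists (fun=> 0); split; first by move=> h; rewrite big1// => s _; rewrite mul0r.
by rewrite big1// => s _; rewrite normr0.
Qed.

Lemma hpoly_sum k (I : Type) (r : seq I) (P : pred I) (p : I -> 'rV[R]_m -> R) (B : I -> R) :
  (forall i, P i -> hpoly k (p i) (B i)) ->
  hpoly k (fun h => \sum_(i <- r | P i) p i h) (\sum_(i <- r | P i) B i).
Proof.
move=> pB; elim: r => [|i r IH].
  rewrite big_nil; apply: hpoly_ext (hpoly_zero k) => h; by rewrite big_nil.
rewrite big_cons; case: ifPn => Pi.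
  apply: hpoly_ext (hpolyD (pB i Pi) IH) => h; by rewrite big_cons Pi.
by apply: hpoly_ext IH => h; rewrite big_cons (negbTE Pi).
Qed.

Lemma hpoly_bound k p B h t : hpoly k p B -> `|h| <= t -> `|p h| <= B * t ^+ k.
Proof.
elim: k p B => [|k IH] p B.
  by move=> /hpoly0P[c [-> cB]] _; rewrite expr0 mulr1.
move=> /hpolySP[q [D [qD -> DB]]] ht.
have t0 : 0 <= t by apply: le_trans ht.
apply: (le_trans (ler_norm_sum _ _ _)).
apply: (@le_trans _ _ (\sum_i D i * t ^+ k.+1)); last first.
  by rewrite -mulr_suml ler_wpM2r// exprn_ge0.
apply: ler_sum => i _; rewrite normrM exprS mulrCA ler_pM//.
  exact: le_trans (coord_norm _ _) ht.
exact: IH.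
Qed.

Lemma hpoly_lip k p B h e t : hpoly k p B -> `|h| <= t -> `|e| <= t ->
  t * `|p (h + e) - p h| <= B * (2 * t) ^+ k * `|e|.
Proof.
move=> + ht et.
have t0 : 0 <= t by apply: le_trans ht.
have hte : `|h + e| <= 2 * t.
  by apply: (le_trans (ler_normD _ _)); rewrite mulr2n mulrDl mul1r lerD.
elim: k p B => [|k IH] p B.
  move=> /hpoly0P[c [cE cB]]; rewrite !cE subrr normr0 mulr0 expr0 mulr1 mulr_ge0//.
  exact: le_trans cB.
move=> /hpolySP[q [D [qD pE DB]]].
rewrite !pE -sumrB.
apply: (@le_trans _ _ (\sum_i D i * (2 * t) ^+ k.+1 * `|e|)); last first.
  by rewrite -!mulr_suml -mulrA -[leRHS]mulrA ler_wpM2r// mulr_ge0// exprn_ge0// mulr_ge0.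
apply: (le_trans (ler_wpM2l t0 (ler_norm_sum _ _ _))).
rewrite mulr_sumr; apply: ler_sum => i _.
have -> : (h + e) 0 i * q i (h + e) - h 0 i * q i h =
   h 0 i * (q i (h + e) - q i h) + e 0 i * q i (h + e) by rewrite mxE; ring.
apply: (@le_trans _ _ (t * (D i * (2 * t) ^+ k * `|e|) +
    t * (`|e| * (D i * (2 * t) ^+ k)))); last first.
  by rewrite (exprS (2 * t)) le_eqVlt; apply/orP; left; apply/eqP; ring.
apply: (@le_trans _ _ (t * (`|h 0 i * (q i (h + e) - q i h)| + `|e 0 i * q i (h + e)|))).
  by apply: ler_wpM2l => //; exact: ler_normD.
rewrite mulrDr lerD//.
  rewrite normrM mulrCA ler_pM// ?mulr_ge0//; first exact: le_trans (coord_norm _ _) ht.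
  exact: IH (qD i).
apply: ler_wpM2l => //; rewrite normrM ler_pM//; first exact: coord_norm.
exact: hpoly_bound (qD i) hte.
Qed.

(** Derivative and second-order remainder. The factors t^2 and (2 t)^k avoid
    any polynomial factor in k, so that after summation over the degrees of a
    power series the remainder is still bounded by a geometric series. *)
Lemma hpoly_deriv k p B : hpoly k p B -> exists p' : 'I_m -> 'rV[R]_m -> R,
  (forall i, hpoly k.-1 (p' i) (k%:R * B)) /\
  forall h e t, `|h| <= t -> `|e| <= t ->
    t ^+ 2 * `|p (h + e) - p h - \sum_i e 0 i * p' i h| <=
    B * (2 * t) ^+ k * `|e| ^+ 2.
Proof.
elim: k p B => [|k IH] p B.
  move=> /hpoly0P[c [cE cB]]; exists (fun _ _ => 0); split.
    by move=> i; rewrite mul0r; exact: hpoly_zero.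
  move=> h e t ht et; rewrite !cE subrr sub0r big1 => [|i _]; last by rewrite mulr0.
  rewrite oppr0 normr0 mulr0 expr0 mulr1 mulr_ge0 ?exprn_ge0//.
  exact: le_trans cB.
move=> /hpolySP[q [D [qD pE DB]]].
have /choice[q' q'P] : forall j, exists q' : 'I_m -> 'rV[R]_m -> R,
    (forall i, hpoly k.-1 (q' i) (k%:R * D j)) /\
    forall h e t, `|h| <= t -> `|e| <= t ->
    t ^+ 2 * `|q j (h + e) - q j h - \sum_i e 0 i * q' i h| <=
    D j * (2 * t) ^+ k * `|e| ^+ 2 by move=> j; exact: IH.
exists (fun i h => q i h + \sum_j h 0 j * q' j i h); split.
  move=> i /=.
  have B0 : 0 <= B by apply: le_trans DB; apply: sumr_ge0 => j _; exact: hpoly_ge0 (qD j).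
  have DiB : D i <= B.
    apply: le_trans DB; rewrite (bigD1 i)//= lerDl; apply: sumr_ge0 => j _.
    exact: hpoly_ge0 (qD j).
  rewrite -natr1 mulrDl mul1r addrC; apply: hpolyD; first exact: hpolyW (qD i).
  case: k {IH} qD q'P => [|k] qD q'P.
    apply: (@hpolyW _ _ 0); first by rewrite mul0r.
    apply: hpoly_ext (hpoly_zero 0) => h; rewrite big1// => j _.
    have /hpoly0P[c [-> cB]] := (q'P j).1 i.
    move: cB; rewrite mul0r normr_le0 => /eqP ->.
    by rewrite mulr0.
  apply/hpolySP; exists (fun j => q' j i), (fun j => k.+1%:R * D j); split => //.
    by move=> j; exact: (q'P j).1.
  by rewrite -mulr_sumr ler_wpM2l.
move=> h e t ht et.
have t0 : 0 <= t by apply: le_trans ht.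
rewrite !pE.
have -> : \sum_i (h + e) 0 i * q i (h + e) - \sum_i h 0 i * q i h -
    \sum_i e 0 i * (q i h + \sum_j h 0 j * q' j i h) =
  \sum_j (h 0 j * (q j (h + e) - q j h - \sum_i e 0 i * q' j i h) +
          e 0 j * (q j (h + e) - q j h)).
  have -> : \sum_i e 0 i * (q i h + \sum_j h 0 j * q' j i h) =
    \sum_j (e 0 j * q j h + h 0 j * \sum_i e 0 i * q' j i h).
    under eq_bigr do rewrite mulrDr mulr_sumr.
    rewrite !big_split /=; congr (_ + _).
    rewrite exchange_big /=; apply: eq_bigr => j _.
    by rewrite mulr_sumr; apply: eq_bigr => i _; rewrite mulrCA.
  rewrite -!sumrB; apply: eq_bigr => j _; rewrite mxE; ring.
apply: (@le_trans _ _ (\sum_i D i * (2 * t) ^+ k.+1 * `|e| ^+ 2)); last first.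
  by rewrite -!mulr_suml -mulrA -[leRHS]mulrA ler_wpM2r// mulr_ge0// exprn_ge0// mulr_ge0.
apply: (le_trans (ler_wpM2l (exprn_ge0 2 t0) (ler_norm_sum _ _ _))).
rewrite mulr_sumr; apply: ler_sum => j _.
apply: (@le_trans _ _ (t * (D j * (2 * t) ^+ k * `|e| ^+ 2) +
    t * `|e| * (D j * (2 * t) ^+ k * `|e|))); last first.
  by rewrite (exprS (2 * t)) le_eqVlt; apply/orP; left; apply/eqP; ring.
set X := q j _ - _ - _; set Y := q j _ - _.
apply: (@le_trans _ _ (`|h 0 j| * (t ^+ 2 * `|X|) + (t * `|e 0 j|) * (t * `|Y|))).
  rewrite (_ : `|h 0 j| * (t ^+ 2 * `|X|) + (t * `|e 0 j|) * (t * `|Y|) =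
     t ^+ 2 * (`|h 0 j * X| + `|e 0 j * Y|)); last by rewrite !normrM; ring.
  by apply: ler_wpM2l; [exact: exprn_ge0|exact: ler_normD].
apply: lerD.
  apply: ler_pM => //; first by rewrite mulr_ge0// exprn_ge0.
    exact: le_trans (coord_norm _ _) ht.
  exact: (q'P j).2.
apply: ler_pM => //; rewrite ?mulr_ge0//.
  by apply: ler_wpM2l => //; exact: coord_norm.
exact: hpoly_lip.
Qed.

End homogeneous.

(** * Termwise differentiation of power series *)

Section power_series.
Context {R : realType} {m : nat}.
Implicit Types (p q f : 'rV[R]_m -> R) (h x : 'rV[R]_m).

(** The coefficient of t^k in (1 - t)^(-b-1). *)
Definition negbin (b k : nat) : R := 'C(b + k, k)%:R.

(** The derivative of (1 - t)^(-b-1) is (b + 1) (1 - t)^(-b-2), read on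
    coefficients. *)
Lemma negbinS b k : k.+1%:R * negbin b k.+1 = b.+1%:R * negbin b.+1 k.
Proof.
rewrite /negbin -!natrM; congr (_%:R).
by rewrite addnS addSn mul_bin_left -addSn addnK.
Qed.

Lemma negbin_ge0 b k : 0 <= negbin b k. Proof. exact: ler0n. Qed.

Lemma bin_le_exp2 n k : ('C(n, k) <= 2 ^ n)%N.
Proof.
elim: n k => [|n IH] [|k] //; first by rewrite bin0 expn_gt0.
by rewrite binS expnS mul2n -addnn leq_add.
Qed.

Lemma negbin_le b k : negbin b k <= 2 ^+ (b + k).
Proof. by rewrite /negbin -natrX ler_nat bin_le_exp2. Qed.

Lemma geo2 (x : R) N : 0 <= x -> x <= 2^-1 -> \sum_(0 <= k < N) x ^+ k <= 2.
Proof.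
move=> x0 x2; suff H : \sum_(0 <= k < N) x ^+ k <= 2 - 2 * 2^-1 ^+ N.
  by apply: le_trans H _; rewrite gerBl mulr_ge0// exprn_ge0// invr_ge0.
elim: N => [|N IH]; first by rewrite big_geq// expr0 mulr1 subrr.
rewrite big_nat_recr//=.
have xN : x ^+ N <= 2^-1 ^+ N by apply: lerXn2r; rewrite ?nnegrE ?invr_ge0.
have -> : 2 * 2^-1 ^+ N.+1 = 2^-1 ^+ N :> R by rewrite exprS mulrA divff// mul1r.
by apply: le_trans (lerD IH xN) _; rewrite le_eqVlt; apply/orP; left; apply/eqP; ring.
Qed.

Lemma summable_geo (u : nat -> R) (K : R) : (forall k, `|u k| <= K * 2^-1 ^+ k) ->
  cvgn (series (fun k => `|u k|)) /\ cvgn (series u).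
Proof.
move=> uK.
have c1 : cvgn (series (fun k => `|u k|)).
  apply: (@series_le_cvg _ (fun k => `|u k|) (geometric K 2^-1)) => //.
  - by move=> k; rewrite /= (le_trans _ (uK k)).
  - apply: is_cvg_geometric_series; rewrite ger0_norm ?invr_ge0//.
    by rewrite invf_lt1// ltr1n.
by split => //; exact: normed_cvg.
Qed.

(** Power series whose coefficients are dominated by those of
    C (1 - sg t)^(-b-1). This family of majorants is stable under
    differentiation, at a fixed radius r. *)
Definition has_power_series (C : R) (b : nat) (sg r : R) (x : 'rV[R]_m) (f : 'rV[R]_m -> R) :=
  exists p : nat -> 'rV[R]_m -> R, (forall k, hpoly k (p k) (C * negbin b k * sg ^+ k)) /\
    forall h, `|h| < r -> series (fun k => p k h) @ \oo --> f (x + h).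

Lemma norm_lim_le (u : nat -> R) l K : (u @ \oo --> l) -> (forall n, `|u n| <= K) ->
  `|l| <= K.
Proof.
move=> ul uK; have nl : `|u n| @[n --> \oo] --> `|l| by apply: cvg_norm.
apply: (cvgr_to_le nl); exact: nearW.
Qed.

Lemma quadratic_remainder_diff f x (l : 'I_m -> R) (K r : R) : 0 < r ->
  (forall e, `|e| < r -> `|f (x + e) - f x - linear_form l e| <= K * `|e| ^+ 2) ->
  differentiable f x /\ forall i, pd i f x = l i.
Proof.
move=> r0 H; apply: linear_remainder_diff => e e0.
exists (Num.min r (e / (`|K| + 1))).
  by rewrite lt_min r0 divr_gt0// ltr_wpDl.
move=> h; rewrite lt_min => /andP[hr]; rewrite ltr_pdivlMr ?ltr_wpDl// => he.
apply: (le_trans (H h hr)); rewrite expr2 mulrA ler_wpM2r//.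
apply: le_trans (ltW he); rewrite mulrC ler_wpM2l//.
by apply: (le_trans (ler_norm _)); rewrite lerDl ler01.
Qed.

Lemma weight_sum C b sg t N : 0 <= C -> 0 <= sg -> 0 <= t -> 4 * sg * t <= 2^-1 ->
  \sum_(0 <= k < N) C * negbin b k * sg ^+ k * (2 * t) ^+ k <= C * 2 ^+ b.+1.
Proof.
move=> C0 s0 t0 st.
apply: (@le_trans _ _ (\sum_(0 <= k < N) C * 2 ^+ b * (4 * sg * t) ^+ k)).
  apply: ler_sum => k _.
  rewrite (_ : 4 * sg * t = 2 * (sg * (2 * t))); last by ring.
  rewrite [X in _ <= _ * X]exprMn [X in _ <= _ * (_ * X)]exprMn !mulrA.
  do 2 (apply: ler_wpM2r; first by rewrite exprn_ge0// mulr_ge0).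
  rewrite -mulrA ler_wpM2l// -exprD; exact: negbin_le.
rewrite -mulr_sumr exprS [2 * _]mulrC mulrA ler_wpM2l ?mulr_ge0 ?exprn_ge0//.
by apply: geo2 => //; rewrite !mulr_ge0.
Qed.

(** The second-order remainders of the homogeneous parts sum up to a bound
    K |e|^2, so the sum of the series is differentiable with the termwise
    derivatives; these are again dominated, with b + 1 in place of b. *)
Lemma power_series_deriv C b sg r x f : 0 <= C -> 0 <= sg -> 8 * sg * r <= 1 ->
  has_power_series C b sg r x f ->
  (forall h, `|h| < r -> differentiable f (x + h) /\ `|f (x + h)| <= C * 2 ^+ b.+1) /\
  forall i, has_power_series (C * sg * b.+1%:R) b.+1 sg r x (pd i f).
Proof.
move=> C0 s0 sr [p [pB pf]].
have tB t : 0 <= t -> t < r -> 4 * sg * t <= 2^-1.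
  move=> t0 tr; have : sg * t <= sg * r by rewrite ler_wpM2l// ltW.
  by move=> h; lra.
have /choice[p' p'P] : forall k, exists p' : 'I_m -> 'rV[R]_m -> R,
    (forall i, hpoly k.-1 (p' i) (k%:R * (C * negbin b k * sg ^+ k))) /\
    forall h e t, `|h| <= t -> `|e| <= t ->
      t ^+ 2 * `|p k (h + e) - p k h - \sum_i e 0 i * p' i h| <=
      C * negbin b k * sg ^+ k * (2 * t) ^+ k * `|e| ^+ 2.
  by move=> k; exact: hpoly_deriv.
have p'0 i h : p' 0%N i h = 0.
  have /hpoly0P[c [-> cB]] := (p'P 0%N).1 i.
  by move: cB; rewrite mul0r normr_le0 => /eqP ->.
have p'S k i : hpoly k (p' k.+1 i) (C * sg * b.+1%:R * negbin b.+1 k * sg ^+ k).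
  apply: hpolyW ((p'P k.+1).1 i).
  have -> : k.+1%:R * (C * negbin b k.+1 * sg ^+ k.+1) =
    C * sg * (k.+1%:R * negbin b k.+1) * sg ^+ k by rewrite exprS; ring.
  by rewrite negbinS mulrA.
have cv i h : `|h| < r -> cvgn (series (fun k => p' k.+1 i h)).
  move=> hr; apply: (proj2 (@summable_geo _ (C * sg * b.+1%:R * 2 ^+ b.+1) _)) => k.
  apply: (le_trans (hpoly_bound (p'S k i) (lexx _))).
  have h2 : 2 * (sg * `|h|) <= 2^-1.
    have := tB `|h| (normr_ge0 _) hr => h4.
    have : 0 <= sg * `|h| by rewrite mulr_ge0.
    move=> h0; lra.
  apply: (@le_trans _ _ (C * sg * b.+1%:R * 2 ^+ b.+1 * (2 * (sg * `|h|)) ^+ k)).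
    rewrite [X in _ <= _ * X]exprMn [X in _ <= _ * (_ * X)]exprMn !mulrA.
    do 2 (apply: ler_wpM2r; first by rewrite exprn_ge0).
    rewrite -[leRHS]mulrA ler_wpM2l ?mulr_ge0// -exprD; exact: negbin_le.
  apply: ler_wpM2l; first by rewrite !mulr_ge0// exprn_ge0.
  by apply: lerXn2r; rewrite ?nnegrE ?invr_ge0 ?mulr_ge0.
have main h : `|h| < r -> differentiable f (x + h) /\
    forall i, pd i f (x + h) = limn (series (fun k => p' k.+1 i h)).
  move=> hr; pose t := (r + `|h|) / 2.
  have h0 := normr_ge0 h.
  have t0 : 0 < t by rewrite /t; lra.
  have tr : t < r by rewrite /t; lra.
  have ht : `|h| <= t by rewrite /t; lra.
  pose r1 := (r - `|h|) / 2.
  have r10 : 0 < r1 by rewrite /r1; lra.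
  apply: (@quadratic_remainder_diff f (x + h) _ (C * 2 ^+ b.+1 / t ^+ 2) r1) => // e er.
  have et : `|e| <= t by move: er; rewrite /r1 /t; lra.
  have her : `|h + e| < r.
    by apply: (le_lt_trans (ler_normD _ _)); move: er; rewrite /r1; lra.
  rewrite mulrAC ler_pdivlMr ?exprn_gt0// mulrC.
  rewrite -[t ^+ 2]ger0_norm ?exprn_ge0 ?(ltW t0)// -normrM.
  pose u N := t ^+ 2 * (series (fun k => p k (h + e)) N.+1 - series (fun k => p k h) N.+1
     - linear_form (fun i => series (fun k => p' k.+1 i h) N) e).
  apply: (@norm_lim_le u).
    rewrite /u; apply: cvgM; first exact: cvg_cst.
    apply: cvgB.
      apply: cvgB; first by rewrite -addrA (cvg_shiftS (series (fun k => p k (h + e)))); apply: pf.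
      by rewrite (cvg_shiftS (series (fun k => p k h))); apply: pf.
    apply: (cvg_big (op := +%R)) => [|i _]; first exact: add_continuous.
    by apply: cvgM; [exact: cvg_cst|exact: cv].
  move=> N; rewrite /u normrM ger0_norm ?exprn_ge0 ?(ltW t0)//.
  have -> : linear_form (fun i => series (fun k => p' k.+1 i h) N) e =
     \sum_(0 <= k < N.+1) \sum_i e 0 i * p' k i h.
    rewrite big_nat_recl//= big1 ?add0r; last by move=> i _; rewrite p'0 mulr0.
    rewrite /linear_form exchange_big /=; apply: eq_bigr => i _.
    by rewrite /series /= mulr_sumr.
  rewrite /series /= -!sumrB.
  apply: (le_trans (ler_wpM2l (exprn_ge0 2 (ltW t0)) (ler_norm_sum _ _ _))).
  rewrite mulr_sumr.
  apply: le_trans (ler_wpM2r (exprn_ge0 2 (normr_ge0 e))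
    (weight_sum b N.+1 C0 s0 (ltW t0) (tB t (ltW t0) tr))).
  rewrite mulr_suml; apply: ler_sum => k _; exact: (p'P k).2.
split.
  move=> h hr; split; first exact: (main h hr).1.
  apply: (norm_lim_le (pf h hr)) => N.
  apply: (le_trans (ler_norm_sum _ _ _)).
  apply: le_trans (weight_sum b N C0 s0 (normr_ge0 h) (tB _ (normr_ge0 h) hr)).
  apply: ler_sum => k _; apply: (le_trans (hpoly_bound (pB k) (lexx _))).
  apply: ler_wpM2l; first by rewrite !mulr_ge0 ?negbin_ge0// exprn_ge0.
  apply: lerXn2r; rewrite ?nnegrE ?mulr_ge0//.
  by rewrite ler_peMl// ler1n.
move=> i; exists (fun k => p' k.+1 i); split; first by move=> k; exact: p'S.
move=> h hr; rewrite (main h hr).2; exact: cv.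
Qed.

(** Differentiating as often as needed without shrinking the ball. *)
Lemma power_series_majorized k C b sg r x f : 0 <= C -> 0 <= sg -> 8 * sg * r <= 1 ->
  has_power_series C b sg r x f -> majorized k (ball x r) f (C * 2 ^+ b.+1) b.+1%:R (2 * sg).
Proof.
move=> + s0 sr; elim: k C b f => [|k IH] C b f C0 pf.
  have [H _] := power_series_deriv C0 s0 sr pf.
  split => // y; rewrite -ball_normE /= => xy.
  by have := H (y - x); rewrite [x + _]addrC subrK; apply; rewrite -normrN opprB.
have [H K] := power_series_deriv C0 s0 sr pf; split.
  move=> y; rewrite -ball_normE /= => xy.
  by have := H (y - x); rewrite [x + _]addrC subrK; apply; rewrite -normrN opprB.
move=> i; have := IH _ _ _ _ (K i); rewrite natr1.
rewrite (_ : C * 2 ^+ b.+1 * b.+1%:R * (2 * sg) = C * sg * b.+1%:R * 2 ^+ b.+2); last first.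
  by rewrite [in RHS]exprS; ring.
by apply; rewrite !mulr_ge0.
Qed.

End power_series.

(** * Analytic functions and Taylor series *)

Section power_series_iff.
Context {R : realType} {m : nat}.
Implicit Types (p q f : 'rV[R]_m -> R) (h x : 'rV[R]_m).

Lemma hpoly_monomial k (alpha : 'I_m -> nat) : (\sum_i alpha i = k)%N ->
  hpoly k (fun h : 'rV[R]_m => \prod_i h 0 i ^+ alpha i) 1.
Proof.
elim: k alpha => [|k IH] alpha ak.
  apply/hpoly0P; exists 1; split; last by rewrite normr1.
  move=> h; rewrite big1// => i _.
  have : (alpha i <= 0)%N by rewrite -ak (bigD1 i)//= leq_addr.
  by rewrite leqn0 => /eqP ->; rewrite expr0.
have [i ai] : exists i, (0 < alpha i)%N.
  apply/existsP; apply: contra_eqT ak; rewrite negb_exists => /forallP H.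
  rewrite big1// => i _; apply/eqP; rewrite -leqn0 leqNgt; exact: H.
pose al' j := (alpha j - (j == i))%N.
have al'k : (\sum_j al' j = k)%N.
  apply/eqP; rewrite -eqSS -ak (bigD1 i)//= [in X in _ == X](bigD1 i)//= /al' eqxx.
  rewrite -addSn -subSn// subn1 /=; apply/eqP; congr (_ + _)%N; apply: eq_bigr => j ji.
  by rewrite (negbTE ji) subn0.
apply/hpolySP; exists (fun j h => if j == i then \prod_l h 0 l ^+ al' l else 0),
  (fun j => (j == i)%:R); split.
- move=> j; case: eqP => _; first exact: IH.
  exact: hpoly_zero.
- move=> h; rewrite [RHS](bigD1 i)//= eqxx [X in _ + X]big1 ?addr0; last first.
    by move=> j ji; rewrite (negbTE ji) mulr0.
  rewrite [in LHS](bigD1 i)//= [in RHS](bigD1 i)//= mulrA -exprS /al' eqxx.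
  rewrite subn1 prednK//; congr (_ * _); apply: eq_bigr => j ji.
  by rewrite (negbTE ji) subn0.
- by rewrite (bigD1 i)//= eqxx big1 ?addr0// => j ji; rewrite (negbTE ji).
Qed.

Lemma hpoly_deg_part (a : ('I_m -> nat) -> R) k :
  hpoly k (fun h => deg_part id a h k)
    (\sum_(al : {ffun 'I_m -> 'I_k.+1} | (\sum_i al i == k)%N) `|a (fun i => al i)|).
Proof.
apply: hpoly_sum => al /eqP alk; rewrite /= -[`|_|]mulr1.
by apply: hpolyZ; exact: hpoly_monomial.
Qed.

Lemma deg_part_norm_const (a : ('I_m -> nat) -> R) k (t : R) : 0 <= t ->
  deg_part Num.norm a (const_mx t) k =
  (\sum_(al : {ffun 'I_m -> 'I_k.+1} | (\sum_i al i == k)%N) `|a (fun i => al i)|) * t ^+ k.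
Proof.
move=> t0; rewrite mulr_suml; apply: eq_bigr => al /eqP alk.
rewrite normrM; congr (_ * _); rewrite -[in RHS]alk -prodrXr ger0_norm; last first.
  by apply: prodr_ge0 => i _; rewrite mxE exprn_ge0.
by apply: eq_bigr => i _; rewrite mxE.
Qed.

(** Absolute convergence at the single point (t, ..., t) bounds the sums of the
    absolute values of the coefficients of degree k by K t^(-k). *)
Lemma analytic_at_has_majorant f x : analytic_at f x ->
  exists U, [/\ open U, U x & has_majorant U f].
Proof.
move=> [a [r [r0 H]]]; pose t := r / 2.
have t0 : 0 < t by rewrite divr_gt0.
have ht : `|const_mx t : 'rV[R]_m| < r.
  by apply: norm_rV_lt => // i; rewrite mxE gtr0_norm// /t; lra.
have [cv _] := H _ ht.
have [K K0 KP] : exists2 K, 0 <= K & forall k, deg_part Num.norm a (const_mx t) k <= K.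
  have [M [_ MP]] := cvg_series_bounded cv.
  have M1 : M < `|M| + 1 by apply: (le_lt_trans (ler_norm M)); rewrite ltrDl.
  have M0 := MP _ M1.
  exists (`|M| + 1) => [|k]; first by rewrite addr_ge0.
  apply: (le_trans (ler_norm _)); exact: M0.
pose s := Num.min r (t / 8).
have s0 : 0 < s by rewrite lt_min r0 divr_gt0.
have ps : has_power_series K 0 t^-1 s x f.
  exists (fun k h => deg_part id a h k); split.
    move=> k; apply: hpolyW (hpoly_deg_part a k).
    rewrite /negbin add0n binn mulr1 exprVn ler_pdivlMr ?exprn_gt0//.
    by rewrite -deg_part_norm_const ?(ltW t0).
  move=> h; rewrite lt_min => /andP[hr _].
  exact: (H h hr).2.
exists (ball x s); split; [exact: ball_open|exact: ballxx|].
have sg0 : 0 <= t^-1 by rewrite invr_ge0 ltW.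
exists (K * 2 ^+ 1), 1, (2 * t^-1); split; rewrite ?mulr_ge0// => k.
apply: power_series_majorized ps => //.
rewrite mulrAC ler_pdivrMr// mul1r.
have : s <= t / 8 by rewrite ge_min lexx orbT.
by move=> ?; lra.
Qed.

Lemma word_monomialE (s : seq 'I_m) (h : 'rV[R]_m) :
  word_monomial s h = \prod_i h 0 i ^+ count_mem i s.
Proof.
elim: s => [|j s IH]; first by rewrite /word_monomial big_nil big1.
rewrite /word_monomial big_cons -/(word_monomial s h) IH (bigD1 j)//= [in RHS](bigD1 j)//= eqxx.
rewrite add1n exprS mulrA; congr (_ * _); apply: eq_bigr => i ij.
by rewrite eq_sym (negbTE ij).
Qed.

Lemma size_words k (s : seq 'I_m) : s \in words k -> size s = k.
Proof.
elim: k s => [|k IH] s /=; first by rewrite inE => /eqP ->.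
by move=> /allpairsPdep[i [s' [_ /IH ? ->]]] /=; congr S.
Qed.

Lemma sum_count (s : seq 'I_m) : (\sum_i count_mem i s = size s)%N.
Proof.
elim: s => [|j s IH]; first by rewrite big1.
rewrite /= big_split /= IH (bigD1 j)//= eqxx big1// => i ij.
by rewrite eq_sym (negbTE ij).
Qed.

(** Words grouped by the numbers of occurrences of the letters, that is, the
    passage from noncommuting monomials back to multi-indices. *)
Lemma sum_content k (F : seq 'I_m -> R) :
  \sum_(al : {ffun 'I_m -> 'I_k.+1} | (\sum_i al i == k)%N)
     \sum_(s <- words k | [forall i, count_mem i s == al i]) F s =
  \sum_(s <- words k) F s.
Proof.
rewrite (exchange_big_dep xpredT)//= !big_seq; apply: eq_bigr => s /size_words sk.
pose al0 := [ffun i : 'I_m => inord (count_mem i s) : 'I_k.+1].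
have al0E i : (al0 i : nat) = count_mem i s.
  by rewrite ffunE inordK// ltnS -sk count_size.
rewrite (big_pred1 al0)// => al /=.
apply/andP/eqP => [[_ /forallP H]|->].
  by apply/ffunP => i; apply/val_inj; rewrite /= al0E; exact/esym/eqP.
split; last by apply/forallP => i; rewrite al0E.
by under eq_bigr do rewrite al0E; rewrite sum_count sk.
Qed.

Lemma hpoly_coefs k p B : hpoly k p B -> exists a : ('I_m -> nat) -> R,
  forall h, p h = deg_part id a h k /\ deg_part Num.norm a h k <= B * `|h| ^+ k.
Proof.
move=> [b [bE bB]].
exists (fun be => \sum_(s <- words k | [forall i, count_mem i s == be i]) b s) => h.
split.
  rewrite bE -sum_content; apply: eq_bigr => al alk /=.
  rewrite mulr_suml; apply: eq_bigr => s /forallP H; rewrite word_monomialE; congr (_ * _).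
  by apply: eq_bigr => i _; rewrite (eqP (H i)).
apply: (@le_trans _ _ ((\sum_(s <- words k) `|b s|) * `|h| ^+ k)); last first.
  by rewrite ler_wpM2r// exprn_ge0.
rewrite -sum_content mulr_suml; apply: ler_sum => al /eqP alk.
rewrite normrM ler_pM//; first exact: ler_norm_sum.
rewrite -[in leRHS]alk -prodrXr normr_prod; apply: ler_prod => i _.
rewrite normr_ge0 normrX /=; apply: lerXn2r; rewrite ?nnegrE//; exact: coord_norm.
Qed.

(** The k-th derivative in direction h, written so that it is visibly a
    homogeneous polynomial in h. *)
Fixpoint taylor (k : nat) f (h y : 'rV[R]_m) : R :=
  if k is k'.+1 then \sum_i h 0 i * taylor k' (pd i f) h y else f y.

Lemma taylor_derive U k f C A rho h x : open U ->
  (forall k, majorized k U f C A rho) -> U x ->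
  differentiable (taylor k f h) x /\ 'D_h (taylor k f h) x = taylor k.+1 f h x.
Proof.
move=> oU; elim: k f C A => [|k IH] f C A Hf Ux.
  have [df _] := majorized_at (Hf 0%N) Ux.
  by split => //=; rewrite diff_pd.
have Hi i l : majorized l U (pd i f) (C * A * rho) (A + 1) rho by have [_ /(_ i)] := Hf l.+1.
have IHi i := IH _ _ _ (Hi i) Ux.
have -> : taylor k.+1 f h = \sum_i (fun y => h 0 i * taylor k (pd i f) h y).
  by apply/funext => y; rewrite fct_sumE.
have di i : differentiable (fun y => h 0 i * taylor k (pd i f) h y) x.
  by apply: differentiableM; [exact: differentiable_cst|exact: (IHi i).1].
split; first exact: differentiable_sum.
rewrite derive_sum; last by move=> i; exact: diff_derivable.
apply: eq_bigr => i _.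
transitivity ('D_h (h 0 i \*: taylor k (pd i f) h) x); first by [].
rewrite deriveZ; first by rewrite (IHi i).2.
by apply: diff_derivable; exact: (IHi i).1.
Qed.

Fixpoint rising (A : R) (k : nat) : R := if k is k'.+1 then A * rising (A + 1) k' else 1.

Lemma taylor_bound U k f C A rho h x t : 0 <= t ->
  (forall k, majorized k U f C A rho) -> U x -> `|h| <= t ->
  `|taylor k f h x| <= C * rising A k * (m%:R * rho * t) ^+ k.
Proof.
move=> t0; elim: k f C A => [|k IH] f C A Hf Ux ht.
  by have [_ fC] := majorized_at (Hf 0%N) Ux; rewrite /= expr0 !mulr1.
have Hi i l : majorized l U (pd i f) (C * A * rho) (A + 1) rho by have [_ /(_ i)] := Hf l.+1.
apply: (le_trans (ler_norm_sum _ _ _)) => /=.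
apply: (@le_trans _ _ (\sum_(i < m) t * (C * A * rho * rising (A + 1) k * (m%:R * rho * t) ^+ k))).
  apply: ler_sum => i _; rewrite normrM ler_pM//; first exact: le_trans (coord_norm _ _) ht.
  exact: IH.
rewrite sumr_const card_ord -mulr_natl exprS le_eqVlt; apply/orP; left; apply/eqP; ring.
Qed.

Lemma taylor_hpoly k f (x : 'rV[R]_m) C A rho U :
  (forall k, majorized k U f C A rho) -> U x ->
  hpoly k (fun h => taylor k f h x) (C * rising A k * (m%:R * rho) ^+ k).
Proof.
elim: k f C A => [|k IH] f C A Hf Ux.
  have [_ fC] := majorized_at (Hf 0%N) Ux.
  by apply/hpoly0P; exists (f x); rewrite /= expr0 !mulr1.
have Hi i l : majorized l U (pd i f) (C * A * rho) (A + 1) rho by have [_ /(_ i)] := Hf l.+1.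
apply/hpolySP; exists (fun i h => taylor k (pd i f) h x),
  (fun i => C * A * rho * rising (A + 1) k * (m%:R * rho) ^+ k); split => //.
  by move=> i; exact: IH.
rewrite sumr_const card_ord -mulr_natl exprS le_eqVlt; apply/orP; left; apply/eqP.
by rewrite /=; ring.
Qed.

Lemma rising_le A k : 0 <= A -> rising A k <= (A + 1) ^+ k * k`!%:R.
Proof.
move=> A0; suff H j : rising (A + j%:R) k * j`!%:R <= (A + 1) ^+ k * (j + k)`!%:R.
  by have := H 0%N; rewrite addr0 mulr1 add0n.
elim: k j => [|k IH] j /=; first by rewrite expr0 addn0.
have := IH j.+1; rewrite -addrA natr1 => /(ler_wpM2l (addr_ge0 A0 ler01)).
rewrite (mulrA (A + 1) ((A + 1) ^+ k)) -exprS addSnnS; apply: le_trans.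
have P0 : 0 <= rising (A + j.+1%:R) k.
  have : 0 <= A + j.+1%:R by rewrite addr_ge0.
  elim: k (A + j.+1%:R) {IH} => [|k IH] B B0 //=.
  by rewrite mulr_ge0//; apply: IH; rewrite addr_ge0.
rewrite factS natrM.
have -> : (A + 1) * (rising (A + j.+1%:R) k * (j.+1%:R * j`!%:R)) =
    (rising (A + j.+1%:R) k * j`!%:R) * ((A + 1) * j.+1%:R) by ring.
have -> : (A + j%:R) * rising (A + j.+1%:R) k * j`!%:R =
    (rising (A + j.+1%:R) k * j`!%:R) * (A + j%:R) by ring.
apply: ler_wpM2l; first by rewrite mulr_ge0.
have j0 : 0 <= j%:R :> R by exact: ler0n.
have -> : j.+1%:R = j%:R + 1 :> R by rewrite natr1.
have : 0 <= A * j%:R by rewrite mulr_ge0.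
by move=> ?; lra.
Qed.

End power_series_iff.

Section taylor_expansion.
Context {R : realType} {m : nat}.
Implicit Types (p q f : 'rV[R]_m -> R) (h x : 'rV[R]_m).

(** Lagrange's form of the remainder, in the variant with (1 - c)^N: the
    derivative in s of the sum of the (1 - s)^k / k! times the k-th
    derivative at x + s h telescopes to its last term. *)
Lemma taylor_remainder U f C A rho h x (N : nat) : open U ->
  (forall k, majorized k U f C A rho) -> (forall s : R, 0 <= s <= 1 -> U (x + s *: h)) ->
  exists2 c : R, 0 < c < 1 &
    f (x + h) - \sum_(0 <= k < N.+1) k`!%:R^-1 * taylor k f h x =
    N`!%:R^-1 * (1 - c) ^+ N * taylor N.+1 f h (x + c *: h).
Proof.
move=> oU Hf Us.
pose T k (s : R) := taylor k f h (x + s *: h).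
have dT k (s : R) : 0 <= s <= 1 -> is_derive s 1 (T k) (T k.+1 s).
  move=> s01; have [d1 d2] := taylor_derive k h oU Hf (Us s s01).
  by rewrite /T -d2; exact: is_derive_line.
pose Phi N (s : R) := \sum_(0 <= k < N) k`!%:R^-1 * (1 - s) ^+ k * T k s.
have dPhi (s : R) : 0 <= s <= 1 ->
    is_derive s 1 (Phi N.+1) (N`!%:R^-1 * (1 - s) ^+ N * T N.+1 s).
  move=> s01; elim: N => [|N IH].
    have -> : Phi 1%N = T 0%N.
      by apply/funext => u; rewrite /Phi big_nat1 fact0 invr1 expr0 !mul1r.
    by rewrite fact0 invr1 expr0 !mul1r; exact: dT.
  have -> : Phi N.+2 = Phi N.+1 + cst (N.+1`!%:R^-1) * (cst 1 - id) ^+ N.+1 * T N.+1.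
    by apply/funext => u; rewrite /Phi [in LHS]big_nat_recr//= !fctE.
  have D1 : is_derive s 1 (cst 1 - id : R -> R) (0 - 1) by exact: is_deriveB.
  have D2 := is_deriveX N.+1 D1.
  have D3 := is_deriveM (is_deriveM (is_derive_cst ((N.+1`!%:R^-1) : R) s 1) D2) (dT N.+1 s s01).
  apply: is_derive_eq (is_deriveD IH D3) _.
  rewrite /GRing.scale /= !fctE mulr0 addr0 factS natrM.
  have f0 : N`!%:R != 0 :> R by rewrite pnatr_eq0 -lt0n fact_gt0.
  have n0 : N.+1%:R != 0 :> R by rewrite pnatr_eq0.
  rewrite exprS; move: f0 n0; set F := N`!%:R; set n := N.+1%:R.
  by clearbody F n => f0 n0; field; rewrite ?f0 ?n0.
have [||c] := @MVT R (Phi N.+1) (fun s => N`!%:R^-1 * (1 - s) ^+ N * T N.+1 s) 0 1 ltr01.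
- move=> s; rewrite in_itv /= => /andP[s0 s1]; apply: dPhi.
  by rewrite !ltW.
- apply: continuous_in_subspaceT => s; rewrite inE /= in_itv /= => s01.
  apply: differentiable_continuous; apply/derivable1_diffP.
  by case: (dPhi s s01).
rewrite in_itv /= => c01; rewrite subr0 mulr1 => E; exists c => //.
rewrite -/(T N.+1 c) -E; congr (_ - _).
  rewrite /Phi big_nat_recl//= fact0 invr1 expr0 !mul1r big1 ?addr0.
    by rewrite /T scale1r.
  by move=> k _; rewrite subrr expr0n mulr0 mul0r.
rewrite /Phi; apply: eq_bigr => k _.
by rewrite subr0 expr1n mulr1 /T scale0r addr0.
Qed.

Lemma leq_exp2 k : (k <= 2 ^ k)%N.
Proof. by rewrite ltnW// ltn_expl. Qed.

(** The N-th remainder is at most C (N + 1) tau^(N + 1), where the factor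
    (A + 1)^k of tau comes from rising_le. *)
Lemma taylor_cvg U f C A rho h x : open U -> 0 <= C -> 0 <= A -> 0 <= rho ->
  (forall k, majorized k U f C A rho) -> (forall s : R, 0 <= s <= 1 -> U (x + s *: h)) ->
  (A + 1) * (m%:R * rho * `|h|) <= 4^-1 ->
  series (fun k => k`!%:R^-1 * taylor k f h x) @ \oo --> f (x + h).
Proof.
move=> oU C0 A0 r0 Hf Us h4.
set tau := (A + 1) * _ in h4.
have tau0 : 0 <= tau by rewrite !mulr_ge0// addr_ge0.
rewrite -(@cvg_shiftS _ (series _)).
apply/cvgrPdist_le => e e0.
have /cvgrPdist_le/(_ e e0) : (fun N => C * 2^-1 ^+ N : R) @ \oo --> 0.
  by apply: cvg_geometric; rewrite ger0_norm ?invr_ge0// invf_lt1// ltr1n.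
move=> -[N0 _ NP]; exists N0 => // N NN.
have := NP N NN; rewrite sub0r normrN; apply: le_trans.
have [c /andP[c0 c1] E] := taylor_remainder N oU Hf Us.
have Uc : U (x + c *: h) by apply: Us; rewrite !ltW.
rewrite /series /= E.
apply: le_trans (ler_norm _).
have f0 : 0 < N`!%:R :> R by rewrite ltr0n fact_gt0.
have c1' : `|(1 - c) ^+ N| <= 1.
  rewrite normrX ger0_norm; last by lra.
  by apply: exprn_ile1; lra.
have TB := taylor_bound N.+1 (normr_ge0 h) Hf Uc (lexx _).
rewrite 2!normrM (ger0_norm (ltW _)) ?invr_gt0//.
apply: (@le_trans _ _ (N`!%:R^-1 * 1 * (C * rising A N.+1 * (m%:R * rho * `|h|) ^+ N.+1))).
  apply: ler_pM => //; apply: ler_wpM2l => //; by rewrite invr_ge0 (ltW f0).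
apply: (@le_trans _ _ (N`!%:R^-1 * 1 *
    (C * ((A + 1) ^+ N.+1 * N.+1`!%:R) * (m%:R * rho * `|h|) ^+ N.+1))).
  apply: ler_wpM2l; first by rewrite mulr1 invr_ge0 ltW.
  apply: ler_wpM2r; first by rewrite exprn_ge0// !mulr_ge0.
  by apply: ler_wpM2l => //; exact: rising_le.
have -> : N`!%:R^-1 * 1 * (C * ((A + 1) ^+ N.+1 * N.+1`!%:R) * (m%:R * rho * `|h|) ^+ N.+1) =
   C * (N.+1%:R * tau ^+ N.+1).
  rewrite /tau [in RHS]exprMn factS natrM.
  by rewrite mulr1; field; rewrite gt_eqF.
apply: ler_wpM2l => //.
apply: (@le_trans _ _ (2 ^+ N.+1 * 4^-1 ^+ N.+1)).
  apply: ler_pM => //; first exact: exprn_ge0.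
    by rewrite -natrX ler_nat leq_exp2.
  by apply: lerXn2r; rewrite ?nnegrE ?invr_ge0.
rewrite -exprMn (_ : 2 * 4^-1 = 2^-1 :> R); last by lra.
by rewrite exprS ler_piMl ?exprn_ge0 ?invr_ge0//; lra.
Qed.

Lemma has_majorant_taylor (U : set 'rV[R]_m) f x : open U -> U x -> has_majorant U f ->
  exists2 r : R, 0 < r & forall h, `|h| < r ->
    series (fun k => k`!%:R^-1 * taylor k f h x) @ \oo --> f (x + h).
Proof.
move=> oU Ux [C [A [rho [C0 A0 r0 Hf]]]].
have /nbhs_normP[d /= d0 dU] := open_nbhs_nbhs (conj oU Ux).
pose tau := (A + 1) * (m%:R * rho).
have tau0 : 0 <= tau by rewrite !mulr_ge0// addr_ge0.
exists (Num.min d ((4 * (tau + 1))^-1)).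
  by rewrite lt_min d0 invr_gt0 mulr_gt0// ltr_wpDl.
move=> h; rewrite lt_min => /andP[hd ht]; apply: (taylor_cvg oU C0 A0 r0 Hf).
  move=> s /andP[s0 s1]; apply: dU; rewrite /= opprD addrA subrr add0r normrN.
  apply: le_lt_trans hd; rewrite normrZ ger0_norm// ler_piMl//.
rewrite mulrA -/tau.
have t1 : 0 < 4 * (tau + 1) by rewrite mulr_gt0// ltr_wpDl.
have : (tau + 1) * `|h| <= 4^-1.
  by move: ht; rewrite -(ltr_pM2l t1) divff ?gt_eqF// => ?; lra.
by apply: le_trans; rewrite ler_wpM2r// lerDl.
Qed.

Lemma has_majorant_analytic_at (U : set 'rV[R]_m) f x : open U -> U x ->
  has_majorant U f -> analytic_at f x.
Proof.
move=> oU Ux bf; have [r r0 cv] := has_majorant_taylor oU Ux bf.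
have [C [A [rho [C0 A0 rho0 Hf]]]] := bf.
pose tau := (A + 1) * (m%:R * rho).
have tau0 : 0 <= tau by rewrite !mulr_ge0// addr_ge0.
have /choice[a aP] : forall k, exists a : ('I_m -> nat) -> R, forall h,
   k`!%:R^-1 * taylor k f h x = deg_part id a h k /\
   deg_part Num.norm a h k <= C * tau ^+ k * `|h| ^+ k.
  move=> k.
  have [a aP] := hpoly_coefs (hpolyZ (k`!%:R^-1) (@taylor_hpoly _ _ k f x C A rho U Hf Ux)).
  exists a => h; have [-> aB] := aP h; split => //; apply: le_trans aB _.
  apply: ler_wpM2r; first exact: exprn_ge0.
  have f0 : 0 < k`!%:R :> R by rewrite ltr0n fact_gt0.
  rewrite ger0_norm ?invr_ge0 ?(ltW f0)// ler_pdivrMl//.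
  have -> : k`!%:R * (C * tau ^+ k) = C * ((A + 1) ^+ k * k`!%:R) * (m%:R * rho) ^+ k.
    by rewrite /tau [in LHS]exprMn; ring.
  apply: ler_wpM2r; first by rewrite exprn_ge0// mulr_ge0.
  by apply: ler_wpM2l => //; exact: rising_le.
exists (fun al => a (\sum_i al i)%N al), (Num.min r ((2 * (tau + 1))^-1)); split.
  by rewrite lt_min r0 invr_gt0 mulr_gt0// ltr_wpDl.
move=> h; rewrite lt_min => /andP[hr ht].
have E phi k : deg_part phi (fun al => a (\sum_i al i)%N al) h k = deg_part phi (a k) h k.
  by apply: eq_bigr => al /eqP ->.
have t1 : 0 < 2 * (tau + 1) by rewrite mulr_gt0// ltr_wpDl.
have h2 : tau * `|h| <= 2^-1.
  have : (tau + 1) * `|h| <= 2^-1.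
    by move: ht; rewrite -(ltr_pM2l t1) divff ?gt_eqF// => ?; lra.
  by apply: le_trans; rewrite ler_wpM2r// lerDl.
split.
  have H k : `|deg_part Num.norm (fun al => a (\sum_i al i)%N al) h k| <= C * 2^-1 ^+ k.
    rewrite E ger0_norm; last by apply: sumr_ge0 => al _.
    apply: (le_trans (aP k h).2); rewrite -mulrA -exprMn ler_wpM2l//.
    by apply: lerXn2r; rewrite ?nnegrE ?invr_ge0// mulr_ge0.
  exact: (summable_geo H).2.
have := cv h hr; apply: cvg_trans.
have -> // : series (fun k => k`!%:R^-1 * taylor k f h x) =
   series (deg_part id (fun al => a (\sum_i al i)%N al) h).
by congr series; apply/funext => k; rewrite E -(aP k h).1.
Qed.

(** Analyticity as a condition on the growth of derivatives: in this form its
    stability under algebraic operations needs no manipulation of series. *)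
Lemma analytic_onP (W : set 'rV[R]_m) f : analytic_on W f <-> loc_majorant W f.
Proof.
split=> [H x Wx|H x Wx]; first exact/analytic_at_has_majorant/H.
by have [U [oU Ux Uf]] := H x Wx; exact: has_majorant_analytic_at Uf.
Qed.

Definition flat f x := forall s : seq 'I_m, iter_pd s f x = 0.

Lemma taylor_flat k f h x : flat f x -> taylor k f h x = 0.
Proof.
elim: k f => [|k IH] f fx; first exact: (fx [::]).
rewrite /= big1// => i _; rewrite IH ?mulr0// => s.
by have := fx (rcons s i); rewrite /iter_pd foldr_rcons.
Qed.

Lemma flat_near (W : set 'rV[R]_m) f x : loc_majorant W f -> W x -> flat f x ->
  \forall y \near x, f y = 0.
Proof.
move=> lf Wx fx; have [U [oU Ux Uf]] := lf x Wx.
have [r r0 cv] := has_majorant_taylor oU Ux Uf.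
apply/nbhs_normP; exists r => //= y xy.
have := cv (y - x); rewrite -normrN opprB => /(_ xy).
have -> : series (fun k => k`!%:R^-1 * taylor k f (y - x) x) = fun=> 0.
  by apply/funext => N; rewrite /series /= big1// => k _; rewrite taylor_flat ?mulr0.
rewrite [x + _]addrC subrK => c0.
have := @cvg_lim _ _ _ _ _ _ _ c0; rewrite lim_cst// => -> //; exact: norm_hausdorff.
Qed.

Lemma near_zero_flat f x : (\forall y \near x, f y = 0) -> flat f x.
Proof.
move=> f0 s.
suff : \forall y \near x, iter_pd s f y = 0 by exact: nbhs_singleton.
elim: s => [|i s IH] //=.
move: IH => /nbhs_interior IH; near=> y.
rewrite -[RHS](pd_cst 0 y i); apply: near_pd.
near: y; exact: IH.
Unshelve. all: by end_near. Qed.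

Lemma lm_iter_pd (W : set 'rV[R]_m) f s : loc_majorant W f -> loc_majorant W (iter_pd s f).
Proof. by move=> lf; elim: s => [|i s IH] //=; exact: lm_pd. Qed.

(** The identity theorem along a segment. The parameters of the points near
    which f vanishes form an open set; it is also closed, since at a limit
    point all derivatives vanish by continuity and the Taylor series is zero.
    Segments suffice because domains are reduced to balls. *)
Lemma identity_segment (W : set 'rV[R]_m) f x h : loc_majorant W f ->
  (forall s : R, 0 <= s <= 1 -> W (x + s *: h)) ->
  (\forall y \near x, f y = 0) -> f (x + h) = 0.
Proof.
move=> lf Ws f0.
have cl : continuous (fun s : R => x + s *: h).
  move=> s; apply: cvgD; first exact: cvg_cst.
  by apply: cvgZr_tmp; exact: cvg_id.
pose Z := [set y : 'rV[R]_m | \forall z \near y, f z = 0].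
have oZ : open Z by rewrite openE => y /nbhs_interior.
pose B := [set s : R | 0 <= s <= 1 /\ Z (x + s *: h)].
have BE : B = [set` `[0, 1]%R].
  apply: (@segment_connected R 0 1).
  - by exists 0; split; rewrite ?lexx ?ler01// scale0r addr0.
  - exists ((fun s : R => x + s *: h) @^-1` Z).
      by apply: open_comp oZ => s _; exact: cl.
    by apply/seteqP; split => s; rewrite /B /= in_itv.
  - exists (closure B); first exact: closed_closure.
    apply/seteqP; split => s.
      by move=> Bs; split; [rewrite /= in_itv; case: Bs|exact: subset_closure].
    rewrite /= in_itv /= => -[s01 cB]; split => //.
    apply: (flat_near lf (Ws s s01)) => w; apply: contrapT => /eqP wn0.
    have lw := lm_iter_pd w lf.
    have cw : {for x + s *: h, continuous (iter_pd w f)}.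
      by apply: differentiable_continuous; apply: (lm_diff lw); exact: Ws.
    (* a nonzero derivative at a limit point would be nonzero nearby, where f
       vanishes identically *)
    have : nbhs s [set t : R | iter_pd w f (x + t *: h) != 0].
      have : nbhs (iter_pd w f (x + s *: h)) [set u | u != 0].
        by apply: open_nbhs_nbhs; split => //; exact: open_neq.
      by move=> /cw; exact: cl.
    move=> /cB[t [[t01 /near_zero_flat tZ] /=]].
    by rewrite tZ eqxx.
have : B 1 by rewrite BE /= in_itv /= ler01 lexx.
by move=> [_ /nbhs_singleton]; rewrite scale1r.
Qed.

End taylor_expansion.

(** * Tangent vectors of level sets *)

Lemma contraction_fixpoint (R : realType) r (F : 'rV[R]_r -> 'rV[R]_r) (s : R) :
  0 <= s ->
  (forall w w', `|w| <= s -> `|w'| <= s -> `|F w - F w'| <= 2^-1 * `|w - w'|) ->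
  `|F 0| <= s / 2 -> exists2 w, `|w| <= s & F w = w.
Proof.
move=> s0 Fc F0.
pose X : completeNormedModType R := HB.pack 'rV[R]_r.
pose U := [set w : X | `|w| <= s].
have FU : set_fun U U F.
  move=> w Uw; have := Fc w 0 Uw; rewrite normr0 => /(_ s0); rewrite subr0 => H.
  rewrite /U /= -(subrK (F 0) (F w)); apply: (le_trans (ler_normD _ _)).
  by move: Uw H F0; rewrite /U /=; lra.
pose f : {fun U >-> U} := HB.pack F (isFun.Build _ _ U U F FU).
have cf : is_contraction f.
  have h0 : 0 <= 2^-1 :> R by rewrite invr_ge0.
  exists (NngNum h0); split; first by rewrite /= invf_lt1// ltr1n.
  by move=> [w w'] [/= Uw Uw']; exact: Fc.
have [||w Uw fw] := banach_fixed_point cf.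
- rewrite /U.
  have -> : [set w : 'rV[R]_r | `|w| <= s] = Num.norm @^-1` [set t : R | t <= s] by [].
  by apply: closed_comp; [move=> w _; exact: norm_continuous|exact: closed_le].
- by exists 0; rewrite /U /= normr0.
- by exists w.
Qed.

Lemma mulmx_bound (R : realType) m n (B : 'M[R]_(m, n)) :
  exists2 K : R, 0 <= K & forall v : 'rV[R]_m, `|v *m B| <= K * `|v|.
Proof.
exists (\sum_i \sum_j `|B i j|).
  by apply: sumr_ge0 => i _; exact: sumr_ge0.
move=> v; apply: norm_rV_le => [|j].
  by rewrite mulr_ge0//; apply: sumr_ge0 => i _; exact: sumr_ge0.
rewrite mxE mulr_suml; apply: (le_trans (ler_norm_sum _ _ _)).
apply: ler_sum => i _; rewrite normrM mulrC ler_pM//; last exact: coord_norm.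
by rewrite (bigD1 j)//= lerDl; exact: sumr_ge0.
Qed.

Lemma ball_convex (R : realType) n (p y y' : 'rV[R]_n) (r s : R) :
  `|y - p| < r -> `|y' - p| < r -> 0 <= s <= 1 -> `|y' + s *: (y - y') - p| < r.
Proof.
move=> yp yp' /andP[s0 s1].
have -> : y' + s *: (y - y') - p = s *: (y - p) + (1 - s) *: (y' - p).
  by apply/rowP => i; rewrite !mxE; ring.
apply: (le_lt_trans (ler_normD _ _)); rewrite !normrZ !ger0_norm ?subr_ge0//.
have [->|sn] := eqVneq s 0; first by rewrite mul0r add0r subr0 mul1r.
have s_gt0 : 0 < s by rewrite lt_def sn.
have : s * `|y - p| < s * r by rewrite ltr_pM2l.
have : (1 - s) * `|y' - p| <= (1 - s) * r by rewrite ler_wpM2l ?subr_ge0// ltW.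
lra.
Qed.

Lemma small_pd_lip (R : realType) n (f : 'rV[R]_n -> R) (p : 'rV[R]_n) (r eta : R) :
  (forall y, `|y - p| < r -> differentiable f y /\ forall i, `|pd i f y| <= eta) ->
  forall y y', `|y - p| < r -> `|y' - p| < r ->
  `|f y - f y'| <= n%:R * eta * `|y - y'|.
Proof.
move=> H y y' yp yp'.
have [|c /andP[c0 c1]] := @MVT_line R _ f y' (y - y') 1 ltr01.
  by move=> s s01; apply: (H _ _).1; exact: ball_convex.
rewrite scale1r mulr1 [y' + _]addrC subrK => ->.
have [dc pc] := H (y' + c *: (y - y')) (ball_convex yp yp' (introT andP (conj (ltW c0) (ltW c1)))).
rewrite diff_pd//; apply: (le_trans (ler_norm_sum _ _ _)).
apply: (@le_trans _ _ (\sum_(i < n) eta * `|y - y'|)).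
  apply: ler_sum => i _; rewrite normrM mulrC ler_pM//; exact: coord_norm.
by rewrite sumr_const card_ord -[leLHS]mulr_natl mulrA.
Qed.

Lemma finite_radius (R : realType) (V : normedModType R) (I : finType)
    (P : I -> V -> Prop) :
  (forall k, exists2 r : R, 0 < r & forall h, `|h| < r -> P k h) ->
  exists2 r : R, 0 < r & forall h, `|h| < r -> forall k, P k h.
Proof.
move=> H; have /choice[r rP] : forall k, exists r : R,
    0 < r /\ forall h, `|h| < r -> P k h.
  by move=> k; have [r r0 rP] := H k; exists r.
have S0 : 0 <= \sum_k (r k)^-1.
  by apply: sumr_ge0 => k _; rewrite invr_ge0 ltW// (rP k).1.
exists (1 + \sum_k (r k)^-1)^-1; first by rewrite invr_gt0 ltr_pwDl.
move=> h hr k; apply: (rP k).2; apply: (lt_le_trans hr).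
rewrite invf_ple ?posrE ?ltr_pwDl// ?(rP k).1//.
rewrite (bigD1 k)//= addrCA lerDl addr_ge0//.
by apply: sumr_ge0 => l _; rewrite invr_ge0 ltW// (rP l).1.
Qed.

(** Lyusternik's theorem: a kernel vector b of the surjective differential of
    phi is a tangent vector of the level set. The point p + t b is corrected by
    w B^T, where B is a right inverse of the differential, and w is the fixed
    point of w |-> w - (phi - lev); for small t this map is a contraction
    of a ball of radius e' t, because the derivatives of phi are nearly constant
    near p. *)
Lemma level_set_tangent (R : realType) n r (U : set 'rV[R]_n)
    (phi : 'I_r -> 'rV[R]_n -> R) (lev : 'I_r -> R) (p b : 'rV[R]_n) :
  open U -> U p ->
  (forall k y, U y -> differentiable (phi k) y) ->
  (forall k i, {for p, continuous (pd i (phi k))}) ->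
  row_free (\matrix_(k, i) pd i (phi k) p) ->
  (forall k, phi k p = lev k) ->
  (forall k, \sum_i b 0 i * pd i (phi k) p = 0) ->
  forall e, 0 < e -> exists2 t0, 0 < t0 & forall t, 0 < t < t0 ->
    exists y, [/\ U y, forall k, phi k y = lev k & `|y - (p + t *: b)| <= e * t].
Proof.
move=> oU Up dphi cphi rf plev db e e0.
set A := \matrix_(k, i) _ in rf.
move: (pinvmx A) (mulmxVp rf) => B AB.
have [K K0 KB] := mulmx_bound B^T.
(* eta makes the contraction constant n K eta at most 1/2 *)
pose eta : R := (2 * (n%:R * K + 1))^-1.
have nK0 : 0 <= n%:R * K by rewrite mulr_ge0.
have eta0 : 0 < eta by rewrite invr_gt0 mulr_gt0// ltr_wpDl.
have [r1 r10 Hr1] : exists2 r1 : R, 0 < r1 & forall y, `|y - p| < r1 ->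
    U y /\ forall k i, `|pd i (phi k) y - pd i (phi k) p| <= eta.
  have : \forall y \near p, U y /\ forall k i, `|pd i (phi k) y - pd i (phi k) p| <= eta.
    near=> y; split; first by near: y; exact: open_nbhs_nbhs.
    near: y; apply: filter_forall => k; apply: filter_forall => i.
    by have /cvgrPdist_le/(_ eta eta0) := cphi k i; apply: filterS => y; rewrite distrC.
  move=> /nbhs_normP[r1 /= r10 H]; exists r1 => // y yp; apply: H.
  by rewrite /= distrC.
pose e' := e / (K + 1).
have K10 : 0 < K + 1 by rewrite ltr_wpDl.
have e'0 : 0 < e' by rewrite divr_gt0.
pose e2 := e' / (2 * (`|b| + 1)).
have b10 : 0 < `|b| + 1 by rewrite ltr_wpDl.
have e20 : 0 < e2 by rewrite divr_gt0// mulr_gt0.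
have [r2 r20 Hr2] : exists2 r2 : R, 0 < r2 & forall h, `|h| < r2 -> forall k,
    `|phi k (p + h) - phi k p - linear_form (fun i => pd i (phi k) p) h| <= e2 * `|h|.
  apply: (@finite_radius R _ _ (fun k h => `|phi k (p + h) - phi k p -
    linear_form (fun i => pd i (phi k) p) h| <= e2 * `|h|)) => k.
  exact: diff_linear_remainder (dphi k p Up) e2 e20.
exists (Num.min (r1 / (`|b| + e + 1)) (r2 / (`|b| + 1))).
  by rewrite lt_min !divr_gt0// ltr_wpDl// addr_ge0// ltW.
move=> t /andP[t0]; rewrite lt_min !ltr_pdivlMr//; last first.
  by rewrite ltr_wpDl// addr_ge0// ltW.
move=> /andP[tr1 tr2].
have tb : `|t *: b| < r2.
  rewrite normrZ gtr0_norm//; apply: le_lt_trans tr2.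
  by rewrite ler_wpM2l ?(ltW t0)// lerDl.
pose Y (w : 'rV[R]_r) := p + t *: b + w *m B^T.
pose s := e' * t.
have s0 : 0 <= s by rewrite mulr_ge0// ltW.
have Ks : K * s <= e * t.
  rewrite /s /e' mulrA ler_wpM2r ?(ltW t0)// mulrCA ler_piMr ?(ltW e0)//.
  by rewrite ler_pdivrMr// mul1r lerDl.
have Yr w : `|w| <= s -> `|Y w - p| < r1.
  move=> ws; have -> : Y w - p = t *: b + w *m B^T.
    by rewrite /Y addrAC [p + _]addrC addrK.
  apply: (le_lt_trans (ler_normD _ _)); apply: le_lt_trans tr1.
  rewrite normrZ gtr0_norm//; have := KB w.
  have : K * `|w| <= K * s by exact: ler_wpM2l.
  move=> H1 H2; rewrite -addrA mulrDr lerD2l mulrDr mulr1.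
  apply: (le_trans H2); apply: (le_trans H1); apply: (le_trans Ks).
  by rewrite mulrC lerDl ltW.
pose F (w : 'rV[R]_r) : 'rV[R]_r := \row_k (w 0 k - (phi k (Y w) - lev k)).
have lB k (w : 'rV[R]_r) : linear_form (fun i => pd i (phi k) p) (w *m B^T) = w 0 k.
  transitivity ((w *m (A *m B)^T) 0 k); last by rewrite AB trmx1 mulmx1.
  rewrite (trmx_mul A B) mulmxA [in RHS]mxE /linear_form.
  apply: eq_bigr => i _.
  by rewrite [A^T i k]mxE [A k i]mxE.
have [||w ws Fw] := @contraction_fixpoint R r F s s0.
- move=> w w' ws ws'; apply: norm_rV_le => [|k]; first by rewrite mulr_ge0// invr_ge0.
  pose psi y := phi k y - linear_form (fun i => pd i (phi k) p) y.
  have -> : (F w - F w') 0 k = - (psi (Y w) - psi (Y w')).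
    have lY v : linear_form (fun i => pd i (phi k) p) (Y v) =
        linear_form (fun i => pd i (phi k) p) (p + t *: b) + v 0 k.
      by rewrite /Y linearD /= lB.
    by rewrite !mxE /psi !lY; ring.
  rewrite normrN.
  have H y : `|y - p| < r1 -> differentiable psi y /\ forall i, `|pd i psi y| <= eta.
    move=> yr; have [Uy Hy] := Hr1 y yr.
    have [dl pl] := pd_linear_form (fun i => pd i (phi k) p) y.
    split; first by apply: differentiableB => //; exact: dphi.
    by move=> i; rewrite pdB// ?pl//; exact: dphi.
  apply: (le_trans (small_pd_lip H (Yr w ws) (Yr w' ws'))).
  have -> : Y w - Y w' = (w - w') *m B^T.
    by rewrite mulmxBl /Y opprD addrACA subrr add0r.
  apply: (@le_trans _ _ (n%:R * eta * (K * `|w - w'|))).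
    by apply: ler_wpM2l => //; rewrite mulr_ge0// ltW.
  rewrite mulrA ler_wpM2r// mulrAC.
  have -> : n%:R * K * eta = (n%:R * K) / (n%:R * K + 1) * 2^-1.
    by rewrite /eta invfM; ring.
  rewrite ler_piMl ?invr_ge0// ler_pdivrMr ?ltr_wpDl// mul1r lerDl//.
- apply: norm_rV_le => [|k]; first by rewrite divr_ge0.
  rewrite !mxE sub0r normrN /Y mul0mx addr0.
  have := Hr2 (t *: b) tb k; rewrite plev.
  have -> : linear_form (fun i => pd i (phi k) p) (t *: b) = 0.
    by rewrite linearZ /=; rewrite /linear_form db; exact: mulr0.
  rewrite subr0 => /le_trans; apply.
  have e2b : e2 * (`|b| + 1) = e' / 2 by rewrite /e2; field; rewrite gt_eqF.
  rewrite normrZ gtr0_norm//.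
  apply: (@le_trans _ _ (t * (e2 * (`|b| + 1)))); last by rewrite e2b /s; lra.
  by rewrite mulrCA ler_wpM2l ?(ltW t0)// ler_wpM2l ?(ltW e20)// lerDl.
exists (Y w); split.
- exact: (Hr1 _ (Yr w ws)).1.
- move=> k; have /rowP/(_ k) := Fw; rewrite mxE => /eqP.
  by rewrite -subr_eq0 addrAC subrr add0r oppr_eq0 subr_eq0 => /eqP.
- rewrite /Y [_ + _ *m _]addrC addrK; apply: (le_trans (KB w)); apply: le_trans Ks.
  by apply: ler_wpM2l.
Unshelve. all: by end_near. Qed.

Lemma within_cont_at (R : realType) m n (A : set 'rV[R]_m) (f : 'rV[R]_m -> 'rV[R]_n) p :
  {within A, continuous f} -> A p -> forall e : R, 0 < e ->
  exists2 r : R, 0 < r & forall y, A y -> `|y - p| < r -> `|f y - f p| < e.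
Proof.
move=> /subspace_continuousP/(_ p) cf Ap e e0.
have /cvgrPdist_lt/(_ e e0) := cf Ap.
rewrite near_withinE => /nbhs_normP[r /= r0 H]; exists r => // y Ay yp.
by rewrite distrC; apply: H => //=; rewrite distrC.
Qed.

Lemma local_param_mem (R : realType) n d (M : set 'rV[R]_n) W
    (psi : 'rV[R]_d -> 'rV[R]_n) O u : local_param M W psi O -> W u -> M (psi u).
Proof.
move=> [[_ _ _ _ psiW] _] Wu.
by have [] : (M `&` O) (psi u) by rewrite -psiW; exists u.
Qed.

(** Continuity of the inverse of a parametrization: the points of M near
    psi(u) come from parameters near u. *)
Lemma local_param_near (R : realType) n d (M : set 'rV[R]_n) W
    (psi : 'rV[R]_d -> 'rV[R]_n) O u (r : R) : local_param M W psi O -> W u -> 0 < r ->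
  \forall y \near psi u, M y -> exists w, [/\ W w, psi w = y & `|w - u| < r].
Proof.
move=> [[_ oO _ _ psiW] [psi' psiK cpsi']] Wu r0.
have uMO : (M `&` O) (psi u) by rewrite -psiW; exists u.
have [dl dl0 H] := within_cont_at cpsi' uMO r0.
have nO : nbhs (psi u) O by apply: open_nbhs_nbhs; split => //; case: uMO.
have nB : nbhs (psi u) [set y | `|y - psi u| < dl].
  by apply/nbhs_ballP; exists dl => //= y; rewrite -ball_normE /= distrC.
apply: filterS2 nO nB => y Oy /= yu My.
have := H y (conj My Oy) yu.
have [w Ww <-] : (psi @` W) y by rewrite psiW.
by rewrite !psiK// => wu; exists w.
Qed.

Lemma diff_mulJ (R : realType) m n (f : 'rV[R]_m -> 'rV[R]_n) (u h : 'rV[R]_m) :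
  'd f u h = h *m 'J f u.
Proof. by rewrite /jacobian mul_rV_lin1. Qed.

Lemma analytic_map_diff (R : realType) m n (W : set 'rV[R]_m)
    (f : 'rV[R]_m -> 'rV[R]_n) u : analytic_map W f -> W u -> differentiable f u.
Proof.
move=> af Wu; apply: differentiable_rV => i.
by apply: (lm_diff (W := W)) => //; exact/analytic_onP.
Qed.

(** A vector b approximated to first order by points of M lies in the image of
    the differential of psi. The parameters of the approximating points are
    within O(t) of u, as psi has a continuous inverse and an injective
    differential J; so t b differs from a vector of the image of J by o(t), and
    its class modulo that image vanishes. *)
Lemma tangent_cone_param (R : realType) n d (M : set 'rV[R]_n) W
    (psi : 'rV[R]_d -> 'rV[R]_n) O u b : local_param M W psi O -> W u ->
  (forall e, 0 < e -> exists2 t0, 0 < t0 & forall t, 0 < t < t0 ->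
    exists2 y, M y & `|y - (psi u + t *: b)| <= e * t) ->
  (b <= 'J psi u)%MS.
Proof.
move=> [[oW oO apsi rf psiW] [psi' psiK cpsi']] Wu H.
set J := 'J psi u; set p := psi u.
have pMO : (M `&` O) p by rewrite -psiW; exists u.
have dpsi : differentiable psi u by exact: analytic_map_diff apsi Wu.
rewrite submxE -normr_eq0 eq_le normr_ge0 andbT.
have [K K0 KP] := mulmx_bound (cokermx J).
have [P P0 PP] := mulmx_bound (pinvmx J).
have JP := mulmxVp (rf u Wu).
apply/ler_addgt0Pr => e e0; rewrite add0r.
pose B := `|b| + 1.
have B0 : 0 < B by rewrite ltr_wpDl.
pose e1 := Num.min ((2 * (P + 1))^-1) (e / (4 * (K + 1) * (P + 1) * B)).
have P1 : 0 < P + 1 by rewrite ltr_wpDl.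
have K1 : 0 < K + 1 by rewrite ltr_wpDl.
have e10 : 0 < e1 by rewrite lt_min invr_gt0 divr_gt0 ?mulr_gt0.
have [r1 r10 Hd] := diff_remainder dpsi e10.
have [r2 r20 Hc] := within_cont_at cpsi' pMO r10.
have /nbhs_normP[r3 /= r30 HO] : nbhs p O by apply: open_nbhs_nbhs; split => //; case: pMO.
pose e2 := Num.min 1 (e / (2 * (K + 1))).
have e20 : 0 < e2 by rewrite lt_min ltr01 divr_gt0 ?mulr_gt0.
have [t0 t00 Ht] := H e2 e20.
pose t := Num.min t0 (Num.min r2 r3 / B) / 2.
have mt0 : 0 < Num.min t0 (Num.min r2 r3 / B).
  by rewrite lt_min t00 divr_gt0// lt_min r20.
have t_gt0 : 0 < t by rewrite divr_gt0.
have : t < Num.min t0 (Num.min r2 r3 / B) by rewrite /t; lra.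
rewrite lt_min ltr_pdivlMr// lt_min => /andP[tt0 /andP[tr2 tr3]].
have /Ht[y My yt] : 0 < t < t0 by rewrite t_gt0.
have yp : `|y - p| <= t * B.
  have -> : y - p = (y - (p + t *: b)) + t *: b.
    by apply/rowP => i; rewrite !mxE; ring.
  apply: (le_trans (ler_normD _ _)); rewrite normrZ gtr0_norm// /B mulrDr addrC lerD2l.
  apply: (le_trans yt); rewrite mulr1 ler_piMl ?(ltW t_gt0)//.
  by rewrite /e2 ge_min lexx.
have yO : O y by apply: HO; rewrite /= distrC; exact: le_lt_trans yp tr3.
have [u' Wu' u'y] : (psi @` W) y by rewrite psiW.
have u'u : `|u' - u| < r1.
  have := Hc y (conj My yO) (le_lt_trans yp tr2).
  by rewrite -u'y !psiK.
have := Hd _ u'u; rewrite [u + _]addrC subrK u'y diff_mulJ -/J -/p.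
set h := u' - u => hd.
(* injectivity of J gives |h| <= (P + 1) |h J|, which turns the estimate of
   the remainder into |h| = O(|y - p|) *)
have hP : `|h| <= (P + 1) * `|h *m J|.
  rewrite -{1}[h]mulmx1 -JP mulmxA; apply: (le_trans (PP _)).
  by rewrite ler_wpM2r// lerDl.
have hJ : `|h *m J| <= `|y - p| + e1 * `|h|.
  have -> : h *m J = (y - p) - (y - p - h *m J) by rewrite opprB addrC subrK.
  by apply: (le_trans (ler_normB _ _)); rewrite lerD2l.
have hle : `|h| <= 2 * (P + 1) * `|y - p|.
  have : (P + 1) * `|h *m J| <= (P + 1) * (`|y - p| + e1 * `|h|) by rewrite ler_wpM2l// ltW.
  have : (P + 1) * (e1 * `|h|) <= 2^-1 * `|h|.
    rewrite mulrA ler_wpM2r//.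
    have : (P + 1) * e1 <= (P + 1) * (2 * (P + 1))^-1.
      by rewrite ler_wpM2l ?(ltW P1)// /e1 ge_min lexx.
    by rewrite invfM [(2^-1 * _)]mulrC mulrA divff ?gt_eqF// mul1r.
  rewrite [(P + 1) * (_ + _)]mulrDr => H1 H2.
  have := le_trans hP H2; have := normr_ge0 h; lra.
have bE : t *: (b *m cokermx J) =
   (y - p - h *m J) *m cokermx J - (y - (p + t *: b)) *m cokermx J.
  rewrite -mulmxBl.
  have -> : y - p - h *m J - (y - (p + t *: b)) = t *: b - h *m J.
    by apply/rowP => i; rewrite !mxE; ring.
  by rewrite mulmxBl -mulmxA mulmx_coker mulmx0 subr0 scalemxAl.
have : t * `|b *m cokermx J| <= K * (e1 * `|h|) + K * (e2 * t).
  rewrite -{1}(gtr0_norm t_gt0) -normrZ bE; apply: (le_trans (ler_normB _ _)).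
  apply: lerD; [apply: (le_trans (KP _))|apply: (le_trans (KP _))]; exact: ler_wpM2l.
have : K * (e1 * `|h|) <= t * (e / 2).
  apply: (@le_trans _ _ ((K + 1) * (e1 * (2 * (P + 1) * (t * B))))).
    apply: ler_pM => //; first by rewrite mulr_ge0// ltW.
      by rewrite lerDl.
    apply: ler_wpM2l; first exact: ltW.
    apply: (le_trans hle); rewrite ler_wpM2l// mulr_ge0// ltW//.
  have : e1 <= e / (4 * (K + 1) * (P + 1) * B) by rewrite /e1 ge_min lexx orbT.
  rewrite ler_pdivlMr ?mulr_gt0// => He1.
  rewrite (_ : (K + 1) * (e1 * (2 * (P + 1) * (t * B))) =
     t * (e1 * (4 * (K + 1) * (P + 1) * B) / 2)); last by field.
  by apply: ler_wpM2l; [exact: ltW|rewrite ler_wpM2r// invr_ge0].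
have : K * (e2 * t) <= t * (e / 2).
  have : e2 <= e / (2 * (K + 1)) by rewrite /e2 ge_min lexx orbT.
  rewrite ler_pdivlMr ?mulr_gt0// => He2.
  apply: (@le_trans _ _ (t * (e2 * (2 * (K + 1)) / 2))); last first.
    by apply: ler_wpM2l; [exact: ltW|rewrite ler_wpM2r// invr_ge0].
  rewrite (_ : t * (e2 * (2 * (K + 1)) / 2) = (K + 1) * (e2 * t)); last by field.
  by rewrite ler_wpM2r ?lerDl// mulr_ge0// ltW.
move=> H1 H2 H3.
rewrite -(ler_pM2l t_gt0); apply: (le_trans H3).
have -> : t * e = t * (e / 2) + t * (e / 2) by field.
exact: lerD.
Qed.

Lemma pd_hamiltonian (R : realType) n (y : 'rV[R]_n) i :
  pd i (@hamiltonian R n) y = y 0 i.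
Proof.
have dsq k : differentiable (fun y : 'rV[R]_n => y 0 k * y 0 k) y.
  by apply: differentiableM; exact: differentiable_coord.
have ds : differentiable (fun y : 'rV[R]_n => \sum_k y 0 k * y 0 k) y.
  exact: differentiable_bigsum.
have ps : pd i (fun y : 'rV[R]_n => \sum_k y 0 k * y 0 k) y =
    \sum_k pd i (fun y : 'rV[R]_n => y 0 k * y 0 k) y by exact: pd_sum.
have dk k := @differentiable_coord R 1 n y 0 k.
rewrite /hamiltonian /dot pdZ// ps (bigD1 i)//= big1 => [|k ki].
  by rewrite pdM// pd_coord eqxx mulr1n; field.
by rewrite pdM// pd_coord eq_sym (negbTE ki) mul0r mulr0 addr0.
Qed.

Lemma velocity_id (R : realType) n : @velocity R n = id.
Proof. by apply/funext => y; apply/rowP => i; rewrite mxE pd_hamiltonian. Qed.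

Lemma euler_arnoldE (R : realType) n c (y : 'rV[R]_n) k :
  euler_arnold c y 0 k = \sum_i y 0 i * \sum_l y 0 l * c i k l.
Proof.
rewrite mxE /poisson; apply: eq_bigr => i _.
rewrite [LHS](bigD1 k)//= [X in _ + X]big1 ?addr0 => [|j jk].
  by rewrite pd_hamiltonian pd_coord eqxx mulr1.
by rewrite pd_coord (negbTE jk) mulr0 mul0r.
Qed.

Lemma poisson_hamiltonian (R : realType) n c (f : 'rV[R]_n -> R) y :
  poisson c (@hamiltonian R n) f y = \sum_j euler_arnold c y 0 j * pd j f y.
Proof.
rewrite /poisson exchange_big /=; apply: eq_bigr => j _.
rewrite euler_arnoldE mulr_suml; apply: eq_bigr => i _.
by rewrite pd_hamiltonian mulrAC.
Qed.

(** The transport of the Euler-Arnold field to the Lie algebra. *)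
Lemma q_sym_euler_arnold (R : realType) n c (z : 'rV[R]_n) :
  q_sym c z z = euler_arnold c z.
Proof.
have h2 (t : R) : 2^-1 * (t + t) = t by field.
apply/rowP => k; rewrite /q_sym euler_arnoldE !mxE h2.
have E j : dot (lie_bracket c z (delta_mx 0 j)) z =
    \sum_i z 0 i * \sum_l z 0 l * c i j l.
  rewrite /dot; under eq_bigr do rewrite mxE mulr_suml.
  rewrite exchange_big /=; apply: eq_bigr => i _.
  rewrite mulr_sumr; apply: eq_bigr => l _.
  rewrite (bigD1 j)//= big1 ?addr0 => [|j' jj].
    by rewrite mxE !eqxx mulr1; ring.
  by rewrite mxE eqxx (negbTE jj) mulr0.
by rewrite E.
Qed.

(** The conserved quantities phi_k satisfy {H, phi_k} = 0, which says that the
    Euler-Arnold field is in the kernel of their differentials; thus tangency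
    follows without the flow. *)
Lemma euler_arnold_tangent (R : realType) n d c (M : set 'rV[R]_n)
    (m : {measure set (borelRn R n) -> \bar R}) W (psi : 'rV[R]_d -> 'rV[R]_n) O u :
  thickening_limit c M m -> local_param M W psi O -> W u ->
  (euler_arnold c (psi u) <= 'J psi u)%MS.
Proof.
move=> tl lp Wu; apply: (tangent_cone_param lp Wu) => e e0.
have Mp := local_param_mem lp Wu.
have [U [r [phi [lev [oU Up MU [sphi pphi rf _]]]]]] := tl _ Mp.
have plev k : phi k (psi u) = lev k.
  by have : (M `&` U) (psi u) by []; rewrite MU => -[_].
have [||||t0 t00 H] := @level_set_tangent R n r U phi lev (psi u)
    (euler_arnold c (psi u)) oU Up _ _ _ plev _ e e0.
- by move=> k y Uy; exact: (sphi k [::]).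
- by move=> k i; apply: differentiable_continuous; exact: (sphi k [:: i]).
- exact: rf.
- by move=> k; rewrite -poisson_hamiltonian pphi.
exists t0 => // t t01; have [y [Uy ylev yt]] := H t t01.
exists y => //.
by have [] : (M `&` U) y by rewrite MU; split.
Qed.

(** * Functions on products and commutators of vector fields *)

Section slices.
Context {R : realType} {n d : nat}.

Lemma delta_lshift (i : 'I_n) :
  delta_mx 0 (lshift d i) = row_mx (delta_mx 0 i) 0 :> 'rV[R]_(n + d).
Proof.
apply/rowP => k; rewrite -[k]splitK; case: (fintype.split k) => l /=.
  by rewrite row_mxEl !mxE eq_lshift.
by rewrite row_mxEr !mxE eq_rlshift andbF.
Qed.

Lemma delta_rshift (i : 'I_d) :
  delta_mx 0 (rshift n i) = row_mx 0 (delta_mx 0 i) :> 'rV[R]_(n + d).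
Proof.
apply/rowP => k; rewrite -[k]splitK; case: (fintype.split k) => l /=.
  by rewrite row_mxEl !mxE eq_lrshift andbF.
by rewrite row_mxEr !mxE eq_rshift.
Qed.

(** Directional derivatives only see the function along a line, which relates
    derivatives on spaces of different dimensions. *)
Lemma eq_derive (V V' : normedModType R) (f : V -> R) (g : V' -> R) a v a' v' :
  (forall h : R, f (h *: v + a) = g (h *: v' + a')) -> 'D_v f a = 'D_v' g a'.
Proof.
move=> H; rewrite /derive.
have H0 : f a = g a' by have := H 0; rewrite !scale0r !add0r.
suff -> : (fun h => h^-1 *: ((f \o shift a) (h *: v) - f a)) =
          (fun h => h^-1 *: ((g \o shift a') (h *: v') - g a')) by [].
by apply/funext => h; rewrite /= H H0.
Qed.

Lemma derive_slice_r (F : 'rV[R]_(n + d) -> R) v u h :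
  'D_h (fun w => F (row_mx v w)) u = 'D_(row_mx 0 h) F (row_mx v u).
Proof. by apply: eq_derive => t; rewrite scale_row_mx add_row_mx scaler0 add0r. Qed.

Lemma derive_slice_l (F : 'rV[R]_(n + d) -> R) v u h :
  'D_h (fun w => F (row_mx w u)) v = 'D_(row_mx h 0) F (row_mx v u).
Proof. by apply: eq_derive => t; rewrite scale_row_mx add_row_mx scaler0 add0r. Qed.

Lemma pd_slice_r (F : 'rV[R]_(n + d) -> R) v u j :
  pd j (fun w => F (row_mx v w)) u = pd (rshift n j) F (row_mx v u).
Proof. by rewrite /pd derive_slice_r delta_rshift. Qed.

Lemma pd_slice_l (F : 'rV[R]_(n + d) -> R) v u i :
  pd i (fun w => F (row_mx w u)) v = pd (lshift d i) F (row_mx v u).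
Proof. by rewrite /pd derive_slice_l delta_lshift. Qed.

Lemma row_mx_entry (v : 'rV[R]_n) (u : 'rV[R]_d) k :
  row_mx v u 0 k = match fintype.split k with inl i => v 0 i | inr j => u 0 j end.
Proof. by rewrite mxE. Qed.

Lemma differentiable_row_mx_r (v : 'rV[R]_n) u :
  differentiable (fun w : 'rV[R]_d => row_mx v w) u.
Proof.
apply: differentiable_rV => k.
under eq_fun do rewrite row_mx_entry; case: (fintype.split k) => j.
  exact: differentiable_cst.
exact: differentiable_coord.
Qed.

Lemma differentiable_row_mx_l v (u : 'rV[R]_d) :
  differentiable (fun w : 'rV[R]_n => row_mx w u) v.
Proof.
apply: differentiable_rV => k.
under eq_fun do rewrite row_mx_entry; case: (fintype.split k) => j.
  exact: differentiable_coord.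
exact: differentiable_cst.
Qed.

Lemma differentiable_slice_r (F : 'rV[R]_(n + d) -> R) v u :
  differentiable F (row_mx v u) -> differentiable (fun w => F (row_mx v w)) u.
Proof.
move=> dF; apply: (@differentiable_comp _ _ _ _ (fun w => row_mx v w) F) => //.
exact: differentiable_row_mx_r.
Qed.

Lemma differentiable_slice_l (F : 'rV[R]_(n + d) -> R) v u :
  differentiable F (row_mx v u) -> differentiable (fun w => F (row_mx w u)) v.
Proof.
move=> dF; apply: (@differentiable_comp _ _ _ _ (fun w => row_mx w u) F) => //.
exact: differentiable_row_mx_l.
Qed.

Lemma pd_lsub_l (f : 'rV[R]_n -> R) (p : 'rV[R]_(n + d)) i :
  pd (lshift d i) (fun p => f (lsubmx p)) p = pd i f (lsubmx p).
Proof.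
apply: eq_derive => t; rewrite linearP /=; congr (f (_ *: _ + _)).
by rewrite delta_lshift row_mxKl.
Qed.

Lemma pd_lsub_r (f : 'rV[R]_n -> R) (p : 'rV[R]_(n + d)) j :
  pd (rshift n j) (fun p => f (lsubmx p)) p = 0.
Proof.
rewrite -[RHS](derive_cst (f (lsubmx p)) p (delta_mx 0 (rshift n j))).
apply: eq_derive => t; rewrite linearP /= delta_rshift row_mxKl scaler0 add0r//.
Qed.

Lemma pd_rsub_r (f : 'rV[R]_d -> R) (p : 'rV[R]_(n + d)) j :
  pd (rshift n j) (fun p => f (rsubmx p)) p = pd j f (rsubmx p).
Proof.
apply: eq_derive => t; rewrite linearP /=; congr (f (_ *: _ + _)).
by rewrite delta_rshift row_mxKr.
Qed.

Lemma pd_rsub_l (f : 'rV[R]_d -> R) (p : 'rV[R]_(n + d)) i :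
  pd (lshift d i) (fun p => f (rsubmx p)) p = 0.
Proof.
rewrite -[RHS](derive_cst (f (rsubmx p)) p (delta_mx 0 (lshift d i))).
apply: eq_derive => t; rewrite linearP /= delta_lshift row_mxKr scaler0 add0r//.
Qed.

Lemma differentiable_lsub (f : 'rV[R]_n -> R) (p : 'rV[R]_(n + d)) :
  differentiable f (lsubmx p) -> differentiable (fun p => f (lsubmx p)) p.
Proof.
move=> df; apply: (@differentiable_comp _ _ _ _ (@lsubmx R 1 n d) f) => //.
exact: differentiable_lsubmx.
Qed.

Lemma differentiable_rsub (f : 'rV[R]_d -> R) (p : 'rV[R]_(n + d)) :
  differentiable f (rsubmx p) -> differentiable (fun p => f (rsubmx p)) p.
Proof.
move=> df; apply: (@differentiable_comp _ _ _ _ (@rsubmx R 1 n d) f) => //.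
exact: differentiable_rsubmx.
Qed.

Lemma smooth_on_lsub (D : set 'rV[R]_n) (D' : set 'rV[R]_(n + d)) f :
  (forall p, D' p -> D (lsubmx p)) -> smooth_on D f ->
  smooth_on D' (fun p => f (lsubmx p)).
Proof.
move=> DD sf s p Dp.
have : (exists s', iter_pd s (fun p => f (lsubmx p)) = fun p => iter_pd s' f (lsubmx p)) \/
    iter_pd s (fun p => f (lsubmx p)) = fun=> 0.
  elim: s => [|k s [[s' IH]|IH]] /=; first by left; exists [::].
    rewrite IH -[k]splitK; case: (fintype.split k) => j /=.
      by left; exists (j :: s'); apply/funext => q; exact: pd_lsub_l.
    by right; apply/funext => q; exact: pd_lsub_r.
  by right; rewrite IH; apply/funext => q; exact: pd_cst.
move=> [[s' ->]|->]; last exact: differentiable_cst.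
by apply: differentiable_lsub; apply: sf; exact: DD.
Qed.

Lemma continuous_lsubmx : continuous (@lsubmx R 1 n d).
Proof. by move=> p; apply: differentiable_continuous; exact: differentiable_lsubmx. Qed.

Lemma continuous_rsubmx : continuous (@rsubmx R 1 n d).
Proof. by move=> p; apply: differentiable_continuous; exact: differentiable_rsubmx. Qed.

End slices.

(** The second-order terms cancel by the symmetry of second derivatives. *)
Lemma commutator_pd (R : realType) m (U : set 'rV[R]_m) (P Q : 'rV[R]_m -> 'I_m -> R)
    (F : 'rV[R]_m -> R) x :
  open U -> U x -> smooth_on U F ->
  (forall i, differentiable (fun y => P y i) x) ->
  (forall i, differentiable (fun y => Q y i) x) ->
  \sum_i P x i * pd i (fun y => \sum_j Q y j * pd j F y) x -
  \sum_i Q x i * pd i (fun y => \sum_j P y j * pd j F y) x =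
  \sum_j (\sum_i P x i * pd i (fun y => Q y j) x -
          \sum_i Q x i * pd i (fun y => P y j) x) * pd j F x.
Proof.
move=> oU Ux sF dP dQ.
have dF j : differentiable (pd j F) x by exact: (sF [:: j]).
have step S i := @pd_sum_mul R m S (fun j => pd j F) x i ^~ dF.
under eq_bigr do rewrite (step (fun j y => Q y j))// mulr_sumr.
under [X in _ - X]eq_bigr do rewrite (step (fun j y => P y j))// mulr_sumr.
rewrite exchange_big /= [X in _ - X]exchange_big /=.
have S2 : \sum_j \sum_i P x i * (Q x j * pd i (pd j F) x) =
    \sum_j \sum_i Q x i * (P x j * pd i (pd j F) x).
  rewrite exchange_big /=; apply: eq_bigr => i _; apply: eq_bigr => j _.
  rewrite (schwarz (U := U))//; first by ring.
  by move=> y Uy; exact: (sF [::]).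
under eq_bigr => j _ do (under eq_bigr => i _ do rewrite mulrDr; rewrite big_split /=).
rewrite big_split /= S2.
under [X in _ - X]eq_bigr => j _ do (under eq_bigr => i _ do rewrite mulrDr; rewrite big_split /=).
rewrite [X in _ - X]big_split /= opprD addrACA subrr addr0 -sumrB.
apply: eq_bigr => j _; rewrite mulrBl !mulr_suml.
by congr (_ - _); apply: eq_bigr => i _; rewrite mulrA.
Qed.

(** * Left-invariant fields in charts *)

Section lie_group.
Context {R : realType} {n : nat} {G : topGroupType}.
Variables (atlas : set (chart R G n)) (x1 : chart R G n) (E : 'M[R]_n).
Hypotheses (lieG : is_lie_group atlas) (ax1 : atlas x1) (x11 : cdom x1 1%g).
Hypothesis (Eunit : E \in unitmx).

Local Notation e := (left_frame x1 E).
Local Notation u1 := (cmap x1 1%g).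

Lemma atlas_chart x : atlas x -> is_chart x.
Proof. by move=> ax; case: lieG => -[_ _ + _] _; apply. Qed.

Lemma cimg_open x : atlas x -> open (cimg x).
Proof. by move=> /atlas_chart[]. Qed.

Lemma cdom_open x : atlas x -> open (cdom x).
Proof. by move=> /atlas_chart[]. Qed.

Lemma cinvK x g : atlas x -> cdom x g -> cinv x (cmap x g) = g.
Proof. by move=> /atlas_chart[_ _ + _ _]; apply. Qed.

Lemma cimg_cmap (x : chart R G n) g : cdom x g -> cimg x (cmap x g).
Proof. by exists g. Qed.

Lemma cmapK x v : atlas x -> cimg x v -> cmap x (cinv x v) = v.
Proof. by move=> ax [g xg <-]; rewrite cinvK. Qed.

Lemma cdom_cinv x v : atlas x -> cimg x v -> cdom x (cinv x v).
Proof. by move=> ax [g xg <-]; rewrite cinvK. Qed.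

Lemma cinv_cont x v : atlas x -> cimg x v -> {for v, continuous (cinv x)}.
Proof.
move=> ax xv; have [_ oc _ _ /subspace_continuousP ci] := atlas_chart ax.
have := ci v xv; rewrite within_interior//.
by move: oc; rewrite openE; apply.
Qed.

Lemma mulg_cont (g h : G) (A : set G) : nbhs (g * h)%g A ->
  nbhs (g, h) [set p : G * G | A (p.1 * p.2)%g].
Proof. by move=> nA; have := @topgroup_mul_continuous G (g, h); apply. Qed.

Definition chart_mul (x y z : chart R G n) (p : 'rV[R]_(n + n)) : 'rV[R]_n :=
  cmap z (cinv x (lsubmx p) * cinv y (rsubmx p))%g.

Definition chart_mul_dom (x y z : chart R G n) : set 'rV[R]_(n + n) :=
  [set p | [/\ cimg x (lsubmx p), cimg y (rsubmx p) &
    cdom z (cinv x (lsubmx p) * cinv y (rsubmx p))%g]].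

Lemma chart_mul_dom_open x y z : atlas x -> atlas y -> atlas z -> open (chart_mul_dom x y z).
Proof.
move=> ax ay az; rewrite openE => p [px py pz]; rewrite /interior.
have n1 : nbhs p [set q | cimg x (@lsubmx R 1 n n q)].
  by apply: continuous_lsubmx; apply: open_nbhs_nbhs; split => //; exact: cimg_open.
have n2 : nbhs p [set q | cimg y (@rsubmx R 1 n n q)].
  by apply: continuous_rsubmx; apply: open_nbhs_nbhs; split => //; exact: cimg_open.
have n3 : nbhs p [set q | cdom z (cinv x (@lsubmx R 1 n n q) * cinv y (rsubmx q))%g].
  have /mulg_cont : nbhs (cinv x (lsubmx p) * cinv y (rsubmx p))%g (cdom z).
    by apply: open_nbhs_nbhs; split => //; exact: cdom_open.
  have cl : (fun q : 'rV[R]_(n + n) => cinv x (lsubmx q)) q @[q --> p] --> cinv x (lsubmx p).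
    by apply: (@cvg_comp _ _ _ (@lsubmx R 1 n n) (cinv x));
      [exact: continuous_lsubmx|exact: cinv_cont].
  have cr : (fun q : 'rV[R]_(n + n) => cinv y (rsubmx q)) q @[q --> p] --> cinv y (rsubmx p).
    by apply: (@cvg_comp _ _ _ (@rsubmx R 1 n n) (cinv y));
      [exact: continuous_rsubmx|exact: cinv_cont].
  exact: (cvg_pair cl cr).
by near=> q; split; near: q.
Unshelve. all: by end_near. Qed.

Lemma chart_mul_smooth x y z i : atlas x -> atlas y -> atlas z ->
  smooth_on (chart_mul_dom x y z) (fun p => chart_mul x y z p 0 i).
Proof. by move=> ax ay az; case: lieG => _ [_ + _]; apply. Qed.

Lemma chart_mul_diff x y z p : atlas x -> atlas y -> atlas z -> chart_mul_dom x y z p ->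
  differentiable (chart_mul x y z) p.
Proof.
by move=> ax ay az dp; apply: differentiable_rV => i; exact: (chart_mul_smooth i ax ay az [::]).
Qed.

Lemma unit_dom x v : atlas x -> cimg x v -> chart_mul_dom x x1 x (row_mx v u1).
Proof.
move=> ax xv; rewrite /chart_mul_dom /= row_mxKl row_mxKr; split => //.
  exact: cimg_cmap.
by rewrite cinvK// mulg1; exact: cdom_cinv.
Qed.

Lemma chart_mul_unit x v : atlas x -> cimg x v -> chart_mul x x1 x (row_mx v u1) = v.
Proof.
by move=> ax xv; rewrite /chart_mul row_mxKl row_mxKr cinvK// mulg1 cmapK.
Qed.

(** The i-th component of e_k in the chart x at the point with coordinates v:
    left-invariant fields are derivatives of the multiplication in its second
    argument at the unit. *)
Definition frame_coef (x : chart R G n) (v : 'rV[R]_n) (k i : 'I_n) : R :=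
  \sum_q E k q * pd (rshift n q) (fun p => chart_mul x x1 x p 0 i) (row_mx v u1).

Lemma frame_coef_diff x k i v : atlas x -> cimg x v ->
  differentiable (fun v => frame_coef x v k i) v.
Proof.
move=> ax xv.
apply: differentiable_bigsum => q.
apply: differentiableM; first exact: differentiable_cst.
apply: (@differentiable_slice_l R n n).
by apply: (chart_mul_smooth i ax ax1 ax [:: rshift n q]); exact: unit_dom.
Qed.

Lemma near_unit_dom x v : atlas x -> cimg x v ->
  \forall w \near u1, chart_mul_dom x x1 x (row_mx v w).
Proof.
move=> ax xv.
have oD := chart_mul_dom_open ax ax1 ax.
have : nbhs (row_mx v u1) (chart_mul_dom x x1 x).
  by apply: open_nbhs_nbhs; split => //; exact: unit_dom.
apply: differentiable_continuous; exact: differentiable_row_mx_r.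
Qed.

Lemma frame_chart x k (f : G -> R) a : atlas x -> cdom x a ->
  differentiable (fun v => f (cinv x v)) (cmap x a) ->
  e k f a = \sum_i frame_coef x (cmap x a) k i * pd i (fun v => f (cinv x v)) (cmap x a).
Proof.
move=> ax xa df; set v := cmap x a in df *.
have xv : cimg x v by exact: cimg_cmap.
rewrite /left_frame.
have -> : 'D_(row k E) (fun u => f (a * cinv x1 u)%g) u1 =
   'D_(row k E) (fun w => (fun v => f (cinv x v)) (chart_mul x x1 x (row_mx v w))) u1.
  apply: near_eq_derive; apply: filterS (near_unit_dom ax xv) => w [].
  rewrite /chart_mul row_mxKl row_mxKr => _ xw xvw.
  by rewrite (cinvK ax xvw) /v cinvK.
have dm : differentiable (chart_mul x x1 x) (row_mx v u1).
  by apply: chart_mul_diff => //; exact: unit_dom.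
have dm1 : differentiable (fun w => chart_mul x x1 x (row_mx v w)) u1.
  apply: (@differentiable_comp _ _ _ _ (fun w => row_mx v w) (chart_mul x x1 x)) => //.
  exact: differentiable_row_mx_r.
rewrite [LHS](chain_D (g := fun v => f (cinv x v)) _ dm1) /=; last by rewrite chart_mul_unit.
rewrite chart_mul_unit//; apply: eq_bigr => i _; congr (_ * _).
rewrite diff_pd; last exact: differentiable_coord_of.
rewrite /frame_coef; apply: eq_bigr => q _; rewrite mxE; congr (_ * _).
exact: (pd_slice_r (fun p => chart_mul x x1 x p 0 i)).
Qed.

Lemma frame_coord x k i a : atlas x -> cdom x a ->
  e k (fun g => cmap x g 0 i) a = frame_coef x (cmap x a) k i.
Proof.
move=> ax xa; have xv := cimg_cmap xa.
have nE : nbhs (cmap x a) [set v : 'rV[R]_n | v 0 i = cmap x (cinv x v) 0 i].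
  by apply: open_near (cimg_open ax) xv _ => v xw /=; rewrite cmapK.
rewrite (frame_chart k ax xa); last first.
  by apply: near_differentiable nE _; exact: differentiable_coord.
rewrite (bigD1 i)//= -(near_pd _ nE) pd_coord eqxx mulr1 big1 ?addr0// => j ji.
by rewrite -(near_pd _ nE) pd_coord (negbTE ji) mulr0.
Qed.

Lemma coord_smooth x i : atlas x ->
  smooth_on_group atlas (cdom x) (fun g => cmap x g 0 i).
Proof. by move=> ax y ay; case: lieG => _ [+ _ _]; apply. Qed.

Lemma frame_frame_coord x k l i a : atlas x -> cdom x a ->
  e k (e l (fun g => cmap x g 0 i)) a =
  \sum_j frame_coef x (cmap x a) k j * pd j (fun v => frame_coef x v l i) (cmap x a).
Proof.
move=> ax xa; have xv := cimg_cmap xa.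
have nE : nbhs (cmap x a) [set v : 'rV[R]_n |
    frame_coef x v l i = e l (fun g => cmap x g 0 i) (cinv x v)].
  apply: open_near (cimg_open ax) xv _ => v xw /=.
  by rewrite frame_coord ?cmapK//; exact: cdom_cinv.
rewrite (frame_chart k ax xa); last first.
  by apply: near_differentiable nE _; exact: frame_coef_diff.
by apply: eq_bigr => j _; rewrite (near_pd _ nE).
Qed.

Variable c : 'I_n -> 'I_n -> 'I_n -> R.
Hypothesis scE : structure_constants atlas e c.

(** [e_k, e_l] = c_kl^m e_m, evaluated on the coordinates of the chart. *)
Lemma frame_coef_structure x k l i a : atlas x -> cdom x a ->
  \sum_j frame_coef x (cmap x a) k j * pd j (fun v => frame_coef x v l i) (cmap x a) -
  \sum_j frame_coef x (cmap x a) l j * pd j (fun v => frame_coef x v k i) (cmap x a) =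
  \sum_m c k l m * frame_coef x (cmap x a) m i.
Proof.
move=> ax xa; rewrite -!frame_frame_coord//.
rewrite (scE (cdom_open ax) (coord_smooth i ax))//.
by apply: eq_bigr => m _; rewrite frame_coord.
Qed.

(** Left translation by a has the inverse left translation by a^-1, so its
    differential at the unit, read in charts, is an invertible matrix. *)
Lemma frame_coef_unit x a : atlas x -> cdom x a ->
  (\matrix_(k, i) frame_coef x (cmap x a) k i) \in unitmx.
Proof.
move=> ax xa; have xv := cimg_cmap xa; set v := cmap x a in xv *.
pose Mm : 'M[R]_n := \matrix_(q, i) pd q (fun w => chart_mul x x1 x (row_mx v w) 0 i) u1.
have -> : (\matrix_(k, i) frame_coef x v k i) = E *m Mm.
  apply/matrixP => k i; rewrite !mxE; apply: eq_bigr => q _; rewrite mxE.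
  by rewrite (pd_slice_r (fun p => chart_mul x x1 x p 0 i)).
rewrite unitmx_mul Eunit /=.
have [x' ax' x'a] : exists2 x', atlas x' & cdom x' (a^-1)%g.
  by case: lieG => -[_ _ _ +] _; apply.
pose nu w := chart_mul x' x x1 (row_mx (cmap x' (a^-1)%g) w).
have vdom : chart_mul_dom x' x x1 (row_mx (cmap x' (a^-1)%g) v).
  rewrite /chart_mul_dom /= row_mxKl row_mxKr; split => //; first exact: cimg_cmap.
  by rewrite cinvK// /v cinvK// mulVg.
have dnu : differentiable nu v.
  apply: (@differentiable_comp _ _ _ _ (fun w => row_mx (cmap x' (a^-1)%g) w) (chart_mul x' x x1)).
    exact: differentiable_row_mx_r.
  exact: chart_mul_diff.
pose N : 'M[R]_n := \matrix_(i, q) pd i (fun w => nu w 0 q) v.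
have dm : differentiable (fun w => chart_mul x x1 x (row_mx v w)) u1.
  apply: (@differentiable_comp _ _ _ _ (fun w => row_mx v w) (chart_mul x x1 x)).
    exact: differentiable_row_mx_r.
  by apply: chart_mul_diff => //; exact: unit_dom.
have MN : Mm *m N = 1%:M.
  apply/matrixP => q r; rewrite !mxE -(pd_coord u1 q r).
  have nE : nbhs u1 [set w : 'rV[R]_n | w 0 r = nu (chart_mul x x1 x (row_mx v w)) 0 r].
    apply: filterS (near_unit_dom ax xv) => w [] /=.
    rewrite /nu /chart_mul !row_mxKl !row_mxKr => _ xw xvw.
    by rewrite (cinvK ax xvw) (cinvK ax' x'a) /v (cinvK ax xa) mulgA mulVg mul1g cmapK.
  rewrite (near_pd _ nE) /pd [RHS](chain_D (g := fun y => nu y 0 r) _ dm) /=; last first.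
    by rewrite chart_mul_unit//; exact: differentiable_coord_of.
  by apply: eq_bigr => i _; rewrite chart_mul_unit// !mxE.
by have [] := mulmx1_unit MN.
Qed.

(** * Brackets of vector fields on the product *)

Lemma row_addsub (x y z : 'rV[R]_n) k : (x + y - z) 0 k = x 0 k + y 0 k - z 0 k.
Proof. by rewrite !mxE. Qed.

Variable d : nat.

Lemma row_sub (x y : 'rV[R]_d) k : (x - y) 0 k = x 0 k - y 0 k.
Proof. by rewrite !mxE. Qed.

Implicit Types (A B C : vfield R n d) (W : set 'rV[R]_d) (F : G -> 'rV[R]_d -> R).

Definition in_chart (x : chart R G n) (F : G -> 'rV[R]_d -> R) (p : 'rV[R]_(n + d)) : R :=
  F (cinv x (lsubmx p)) (rsubmx p).

Definition chart_field (x : chart R G n) A (p : 'rV[R]_(n + d)) (q : 'I_(n + d)) : R :=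
  match fintype.split q with
  | inl i => \sum_k A.1 (rsubmx p) 0 k * frame_coef x (lsubmx p) k i
  | inr j => A.2 (rsubmx p) 0 j
  end.

Lemma chart_field_l x A p i :
  chart_field x A p (lshift d i) = \sum_k A.1 (rsubmx p) 0 k * frame_coef x (lsubmx p) k i.
Proof. by rewrite /chart_field (unsplitK (inl i)). Qed.

Lemma chart_field_r x A p j : chart_field x A p (rshift n j) = A.2 (rsubmx p) 0 j.
Proof. by rewrite /chart_field (unsplitK (inr j)). Qed.

Lemma apply_field_chart x A F a u : atlas x -> cdom x a ->
  differentiable (in_chart x F) (row_mx (cmap x a) u) ->
  apply_field e A F a u = \sum_q chart_field x A (row_mx (cmap x a) u) q *
    pd q (in_chart x F) (row_mx (cmap x a) u).
Proof.
move=> ax xa dF; rewrite big_split_ord /apply_field /=.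
have El : (fun v => F (cinv x v) u) = fun v => in_chart x F (row_mx v u).
  by apply/funext => v; rewrite /in_chart row_mxKl row_mxKr.
have Er : F a = fun w => in_chart x F (row_mx (cmap x a) w).
  by apply/funext => w; rewrite /in_chart row_mxKl row_mxKr cinvK.
congr (_ + _).
  transitivity (\sum_k \sum_i A.1 u 0 k * (frame_coef x (cmap x a) k i *
      pd (lshift d i) (in_chart x F) (row_mx (cmap x a) u))).
    apply: eq_bigr => k _; rewrite -mulr_sumr; congr (_ * _).
    rewrite (frame_chart k ax xa) El; last exact: differentiable_slice_l.
    by apply: eq_bigr => i _; rewrite pd_slice_l.
  rewrite exchange_big /=; apply: eq_bigr => i _.
  rewrite chart_field_l row_mxKr row_mxKl mulr_suml; apply: eq_bigr => k _.
  by rewrite mulrA.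
rewrite Er diff_pd; last exact: differentiable_slice_r.
by apply: eq_bigr => j _; rewrite chart_field_r row_mxKr pd_slice_r.
Qed.

Definition field_differentiable A u := (forall k, differentiable (fun w => A.1 w 0 k) u) /\
  (forall j, differentiable (fun w => A.2 w 0 j) u).

Lemma chart_field_diff x A v u q : atlas x -> cimg x v -> field_differentiable A u ->
  differentiable (fun p => chart_field x A p q) (row_mx v u).
Proof.
move=> ax xv [d1 d2]; rewrite -[q]splitK; case: (fintype.split q) => i /=.
  under eq_fun do rewrite chart_field_l.
  apply: differentiable_bigsum => k; apply: differentiableM.
    by apply: (differentiable_rsub (f := fun u => A.1 u 0 k)); rewrite row_mxKr.
  apply: (differentiable_lsub (f := fun v => frame_coef x v k i)).
  by rewrite row_mxKl; exact: frame_coef_diff.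
under eq_fun do rewrite chart_field_r.
by apply: (differentiable_rsub (f := fun u => A.2 u 0 i)); rewrite row_mxKr.
Qed.

Lemma prod_dom_open x (O : set G) W : atlas x -> open O -> open W ->
  open [set p : 'rV[R]_(n + d) |
         [/\ cimg x (lsubmx p), O (cinv x (lsubmx p)) & W (rsubmx p)]].
Proof.
move=> ax oO oW; rewrite openE => p [px pO pW]; rewrite /interior.
have n1 : nbhs p [set q | cimg x (@lsubmx R 1 n d q)].
  by apply: continuous_lsubmx; apply: open_nbhs_nbhs; split => //; exact: cimg_open.
have n2 : nbhs p [set q | W (@rsubmx R 1 n d q)].
  by apply: continuous_rsubmx; apply: open_nbhs_nbhs; split.
have n3 : nbhs p [set q | O (cinv x (@lsubmx R 1 n d q))].
  have : nbhs (lsubmx p) [set v | O (cinv x v)].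
    by apply: cinv_cont => //; apply: open_nbhs_nbhs; split.
  exact: continuous_lsubmx.
by near=> q; split; near: q.
Unshelve. all: by end_near. Qed.

(** The bracket, computed from the facts that e_k annihilates functions of u
    and that d/du^j annihilates the coefficients of the frame. *)
Definition bracket_field A B : vfield R n d :=
  (fun u => lie_bracket c (A.1 u) (B.1 u) + 'D_(A.2 u) B.1 u - 'D_(B.2 u) A.1 u,
   fun u => 'D_(A.2 u) B.2 u - 'D_(B.2 u) A.2 u).

Lemma bracket_field1E A B u k : field_differentiable A u -> field_differentiable B u ->
  (bracket_field A B).1 u 0 k = \sum_i \sum_j c i j k * A.1 u 0 i * B.1 u 0 j
    + \sum_j A.2 u 0 j * pd j (fun w => B.1 w 0 k) u
    - \sum_j B.2 u 0 j * pd j (fun w => A.1 w 0 k) u.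
Proof.
move=> [a1 a2] [b1 b2]; rewrite /bracket_field /= row_addsub mxE.
by rewrite !derive_rV ?diff_pd//; exact: differentiable_rV.
Qed.

Lemma bracket_field2E A B u j : field_differentiable A u -> field_differentiable B u ->
  (bracket_field A B).2 u 0 j = \sum_i A.2 u 0 i * pd i (fun w => B.2 w 0 j) u
    - \sum_i B.2 u 0 i * pd i (fun w => A.2 w 0 j) u.
Proof.
move=> [a1 a2] [b1 b2]; rewrite /bracket_field /= row_sub.
by rewrite !derive_rV ?diff_pd//; exact: differentiable_rV.
Qed.

Lemma chart_field_derive_r x A B p u j : atlas x -> u = rsubmx p -> field_differentiable B u ->
  \sum_q chart_field x A p q * pd q (fun p => chart_field x B p (rshift n j)) p =
  \sum_i A.2 u 0 i * pd i (fun w => B.2 w 0 j) u.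
Proof.
move=> ax uE [b1 b2]; rewrite big_split_ord /= [X in X + _]big1 ?add0r; last first.
  move=> i _; under eq_fun do rewrite chart_field_r.
  by rewrite (pd_rsub_l (fun w => B.2 w 0 j)) mulr0.
apply: eq_bigr => i _; rewrite chart_field_r -uE; congr (_ * _).
under eq_fun do rewrite chart_field_r.
by rewrite (pd_rsub_r (fun w => B.2 w 0 j)) -uE.
Qed.

(** The components along G involve both the derivative of the frame, which
    antisymmetrization turns into structure constants, and the derivative of
    the coefficients along W. *)
Lemma chart_field_derive_l x A B p v u i : atlas x -> cimg x v ->
  p = row_mx v u -> field_differentiable B u ->
  \sum_q chart_field x A p q * pd q (fun p => chart_field x B p (lshift d i)) p =
  \sum_l \sum_k A.1 u 0 l * B.1 u 0 k *
    (\sum_j frame_coef x v l j * pd j (fun v => frame_coef x v k i) v) +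
  \sum_k (\sum_j A.2 u 0 j * pd j (fun w => B.1 w 0 k) u) * frame_coef x v k i.
Proof.
move=> ax xv pE [b1 b2].
have pl : lsubmx p = v by rewrite pE row_mxKl.
have pr : rsubmx p = u by rewrite pE row_mxKr.
have dB k : differentiable (fun p : 'rV[R]_(n + d) => B.1 (rsubmx p) 0 k) p.
  by apply: (differentiable_rsub (f := fun u => B.1 u 0 k)); rewrite pr.
have dx k : differentiable (fun p : 'rV[R]_(n + d) => frame_coef x (lsubmx p) k i) p.
  apply: (differentiable_lsub (f := fun v => frame_coef x v k i)).
  by rewrite pl; exact: frame_coef_diff.
have pdV q : pd q (fun p => chart_field x B p (lshift d i)) p =
    \sum_k (pd q (fun p : 'rV[R]_(n + d) => B.1 (rsubmx p) 0 k) p * frame_coef x v k i +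
            B.1 u 0 k * pd q (fun p : 'rV[R]_(n + d) => frame_coef x (lsubmx p) k i) p).
  under eq_fun do rewrite chart_field_l.
  rewrite (@pd_sum R (n + d) 'I_n
    (fun k p => B.1 (rsubmx p) 0 k * frame_coef x (lsubmx p) k i)); last first.
    by move=> k; exact: differentiableM.
  by apply: eq_bigr => k _; rewrite pdM// pl pr.
rewrite big_split_ord /=; congr (_ + _).
  transitivity (\sum_i' \sum_l \sum_k A.1 u 0 l * B.1 u 0 k *
      (frame_coef x v l i' * pd i' (fun v => frame_coef x v k i) v)).
    apply: eq_bigr => i' _; rewrite chart_field_l pl pr mulr_suml; apply: eq_bigr => l _.
    rewrite pdV mulr_sumr; apply: eq_bigr => k _.
    rewrite (pd_rsub_l (fun u => B.1 u 0 k)) (pd_lsub_l (fun v => frame_coef x v k i)) pl.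
    by ring.
  rewrite exchange_big /=; apply: eq_bigr => l _.
  rewrite exchange_big /=; apply: eq_bigr => k _.
  by rewrite mulr_sumr.
transitivity (\sum_j \sum_k A.2 u 0 j * pd j (fun w => B.1 w 0 k) u * frame_coef x v k i).
  apply: eq_bigr => j _; rewrite chart_field_r pr pdV mulr_sumr; apply: eq_bigr => k _.
  rewrite (pd_rsub_r (fun u => B.1 u 0 k)) (pd_lsub_r (fun v => frame_coef x v k i)) pr.
  by ring.
by rewrite exchange_big /=; apply: eq_bigr => k _; rewrite mulr_suml.
Qed.

Lemma chart_field_bracket x A B C a u r : atlas x -> cdom x a ->
  field_differentiable A u -> field_differentiable B u ->
  C.1 u = (bracket_field A B).1 u -> C.2 u = (bracket_field A B).2 u ->
  let p := row_mx (cmap x a) u in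
  chart_field x C p r = \sum_q chart_field x A p q * pd q (fun p => chart_field x B p r) p -
               \sum_q chart_field x B p q * pd q (fun p => chart_field x A p r) p.
Proof.
move=> ax xa dA dB C1 C2 p; have xv := cimg_cmap xa.
have pr : u = rsubmx p by rewrite row_mxKr.
rewrite -[r]splitK; case: (fintype.split r) => i /=; last first.
  rewrite (chart_field_derive_r A i ax pr dB) (chart_field_derive_r B i ax pr dA).
  by rewrite chart_field_r -pr C2 bracket_field2E.
rewrite (chart_field_derive_l A i ax xv (erefl p) dB) (chart_field_derive_l B i ax xv (erefl p) dA).
rewrite chart_field_l -pr row_mxKl C1 opprD addrACA.
under eq_bigr do rewrite bracket_field1E// 2!mulrDl mulNr.
rewrite 2!big_split /= sumrN -addrA; congr (_ + _).
rewrite [X in _ - X]exchange_big /= -sumrB.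
transitivity (\sum_l \sum_k A.1 u 0 l * B.1 u 0 k * \sum_m c l k m * frame_coef x (cmap x a) m i).
  under eq_bigr do rewrite mulr_suml; rewrite exchange_big /=.
  apply: eq_bigr => l _; under eq_bigr do rewrite mulr_suml.
  rewrite exchange_big /=; apply: eq_bigr => k _.
  by rewrite mulr_sumr; apply: eq_bigr => m _; ring.
apply: eq_bigr => l _; rewrite -sumrB; apply: eq_bigr => k _.
by rewrite -frame_coef_structure// mulrBr [B.1 u 0 k * _]mulrC.
Qed.

(** Both sides are computed in a chart around the given point; there the
    commutator of first-order operators has components given by commutator_pd,
    and these are the components of the explicit field. *)
Lemma is_bracket_field W A B C : open W ->
  (forall u, W u -> field_differentiable A u /\ field_differentiable B u) ->
  (forall u, W u -> C.1 u = (bracket_field A B).1 u /\ C.2 u = (bracket_field A B).2 u) ->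
  is_bracket atlas e W A B C.
Proof.
move=> oW dAB CE O F oO sF a u Oa Wu.
have [x ax xa] : exists2 x, atlas x & cdom x a by case: lieG => -[_ _ _ +] _; apply.
set U := [set p : 'rV[R]_(n + d) |
         [/\ cimg x (lsubmx p), O (cinv x (lsubmx p)) & W (rsubmx p)]].
have oU : open U by exact: prod_dom_open.
pose p := row_mx (cmap x a) u.
have Up : U p.
  by rewrite /U /= row_mxKl row_mxKr cinvK//; split => //; exact: cimg_cmap.
have sFx : smooth_on U (in_chart x F) by exact: sF.
have [dA dB] := dAB u Wu; have [C1 C2] := CE u Wu.
have near_apply D : nbhs p [set q | \sum_r chart_field x D q r * pd r (in_chart x F) q =
    in_chart x (apply_field e D F) q].
  apply: open_near oU Up _ => q Uq; have [xq Oq Wq] := Uq.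
  rewrite /= /in_chart (apply_field_chart _ ax (cdom_cinv ax xq)) cmapK// ?hsubmxK//.
  exact: (sFx [::]).
have dV D : field_differentiable D u ->
    differentiable (fun q => \sum_r chart_field x D q r * pd r (in_chart x F) q) p.
  move=> dD; apply: differentiable_bigsum => r; apply: differentiableM.
    by apply: chart_field_diff => //; exact: cimg_cmap.
  exact: (sFx [:: r]).
have apply2 D D' : field_differentiable D' u -> apply_field e D (apply_field e D' F) a u =
    \sum_q chart_field x D p q *
      pd q (fun q => \sum_r chart_field x D' q r * pd r (in_chart x F) q) p.
  move=> dD'; rewrite (apply_field_chart _ ax xa); last first.
    exact: near_differentiable (near_apply D') (dV _ dD').
  by apply: eq_bigr => q _; rewrite -(near_pd _ (near_apply D')).
rewrite !apply2// (commutator_pd oU Up sFx); last 2 first.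
- by move=> i; apply: chart_field_diff => //; exact: cimg_cmap.
- by move=> i; apply: chart_field_diff => //; exact: cimg_cmap.
rewrite (apply_field_chart _ ax xa); last exact: (sFx [::]).
by apply: eq_bigr => r _; rewrite (chart_field_bracket r ax xa dA dB C1 C2).
Qed.

Lemma coord_smooth_prod W i :
  smooth_on_prod atlas (cdom x1) W (fun g _ => cmap x1 g 0 i).
Proof.
move=> x ax; apply: (smooth_on_lsub (D := [set v | cimg x v /\ cdom x1 (cinv x v)])
   (f := fun v => cmap x1 (cinv x v) 0 i)).
  by move=> p [].
by case: lieG => _ [+ _ _]; apply.
Qed.

Lemma left_frame_coord1 k i : e k (fun g => cmap x1 g 0 i) 1%g = E k i.
Proof.
have xv : cimg x1 u1 by exact: cimg_cmap.
rewrite /left_frame.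
have nE : nbhs u1 [set w : 'rV[R]_n | w 0 i = cmap x1 (1 * cinv x1 w)%g 0 i].
  by apply: open_near (cimg_open ax1) xv _ => w xw /=; rewrite mul1g cmapK.
rewrite -(near_eq_derive _ nE) diff_pd; last exact: differentiable_coord.
rewrite (bigD1 i)//= pd_coord eqxx mulr1 big1 ?addr0 ?mxE// => j ji.
by rewrite pd_coord (negbTE ji) mulr0.
Qed.

Lemma apply_coord1 A u i :
  apply_field e A (fun g _ => cmap x1 g 0 i) 1%g u = (A.1 u *m E) 0 i.
Proof.
rewrite /apply_field derive_cst addr0 mxE; apply: eq_bigr => k _.
by rewrite left_frame_coord1.
Qed.

(** Testing on the coordinates of the chart at the unit, where the frame is the
    matrix E, determines the component along G. *)
Lemma is_bracket_unique W A B C : open W ->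
  (forall u, W u -> field_differentiable A u /\ field_differentiable B u) ->
  is_bracket atlas e W A B C ->
  forall u, W u -> C.1 u = (bracket_field A B).1 u.
Proof.
move=> oW dAB CB u Wu.
have BB : is_bracket atlas e W A B (bracket_field A B) by exact: is_bracket_field.
apply: (can_inj (mulmxK Eunit)); apply/rowP => i.
rewrite -!apply_coord1.
have := CB _ _ (cdom_open ax1) (@coord_smooth_prod W i) _ _ x11 Wu.
by have <- := BB _ _ (cdom_open ax1) (@coord_smooth_prod W i) _ _ x11 Wu.
Qed.

End lie_group.

(** * Factorization of positive definite analytic matrices *)

Section loc_majorant_matrix.
Context {R : realType} {m : nat} (W : set 'rV[R]_m).
Local Notation lm := (loc_majorant W).

Definition loc_majorant_mx p q (M : 'rV[R]_m -> 'M[R]_(p, q)) :=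
  forall i j, lm (fun w => M w i j).

Lemma lm_mxM p q r (M : 'rV[R]_m -> 'M[R]_(p, q)) (N : 'rV[R]_m -> 'M[R]_(q, r)) :
  loc_majorant_mx M -> loc_majorant_mx N -> loc_majorant_mx (fun w => M w *m N w).
Proof.
move=> lM lN i j; under eq_fun do rewrite mxE.
by apply: lm_sum => k; exact: lm_mul.
Qed.

Lemma lm_mxT p q (M : 'rV[R]_m -> 'M[R]_(p, q)) :
  loc_majorant_mx M -> loc_majorant_mx (fun w => (M w)^T).
Proof. by move=> lM i j; under eq_fun do rewrite mxE; exact: lM. Qed.

Lemma lm_mxZ p q f (M : 'rV[R]_m -> 'M[R]_(p, q)) :
  lm f -> loc_majorant_mx M -> loc_majorant_mx (fun w => f w *: M w).
Proof. by move=> lf lM i j; under eq_fun do rewrite mxE; exact: lm_mul. Qed.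

Lemma lm_det p (M : 'rV[R]_m -> 'M[R]_p) : loc_majorant_mx M -> lm (fun w => \det (M w)).
Proof.
move=> lM; rewrite /determinant; apply: lm_sum => s.
apply: lm_mul; first exact: lm_cst.
by apply: lm_prod => i.
Qed.

Lemma lm_adj p (M : 'rV[R]_m -> 'M[R]_p) : loc_majorant_mx M ->
  loc_majorant_mx (fun w => \adj (M w)).
Proof.
move=> lM i j; under eq_fun do rewrite mxE /cofactor.
apply: lm_mul; first exact: lm_cst.
apply: lm_det => k l; under eq_fun do rewrite !mxE.
exact: lM.
Qed.

Lemma lm_mx_eq p q (M N : 'rV[R]_m -> 'M[R]_(p, q)) : open W ->
  (forall w, W w -> M w = N w) -> loc_majorant_mx M -> loc_majorant_mx N.
Proof.
by move=> oW MN lM i j; apply: (lm_eq oW) (lM i j) => w Ww; rewrite MN.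
Qed.

Lemma lm_block p1 p2 q1 q2 (A : 'rV[R]_m -> 'M[R]_(p1, q1)) B C D :
  loc_majorant_mx A -> loc_majorant_mx B -> loc_majorant_mx C -> loc_majorant_mx D ->
  loc_majorant_mx (fun w => block_mx (A w) (B w) (C w) (D w) : 'M[R]_(p1 + p2, q1 + q2)).
Proof.
move=> lA lB lC lD i j; rewrite -[i]splitK -[j]splitK.
case: (fintype.split i) => i'; case: (fintype.split j) => j' /=.
- by under eq_fun do rewrite block_mxEul; exact: lA.
- by under eq_fun do rewrite block_mxEur; exact: lB.
- by under eq_fun do rewrite block_mxEdl; exact: lC.
- by under eq_fun do rewrite block_mxEdr; exact: lD.
Qed.

Definition posdef p (S : 'M[R]_p) := S^T = S /\
  forall x : 'rV[R]_p, x != 0 -> 0 < (x *m S *m x^T) 0 0.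

(** Induction on the size: the corner alpha is a positive analytic function,
    the Schur complement D - alpha^-1 B^T B is again positive definite with
    analytic entries, and the factor is assembled from its factor, the square
    root of alpha and B divided by it. Only inverses and square roots of
    positive functions occur, hence the entries stay analytic. *)
Lemma cholesky p (S : 'rV[R]_m -> 'M[R]_p) : open W -> loc_majorant_mx S ->
  (forall w, W w -> posdef (S w)) ->
  exists2 L : 'rV[R]_m -> 'M[R]_p, loc_majorant_mx L &
    forall w, W w -> L w *m (L w)^T = S w /\ 0 < \det (L w).
Proof.
move=> oW; elim: p S => [|p IH] S lS pS.
  exists (fun=> 0); first by move=> [].
  by move=> w Ww; rewrite det_mx00; split => //; apply/matrixP => -[].
pose S1 w : 'M[R]_(1 + p) := S w.
pose al w := S1 w 0 0.
pose B w : 'rV[R]_p := ursubmx (S1 w).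
pose D w : 'M[R]_p := drsubmx (S1 w).
have SE w : W w -> S1 w = block_mx (al w)%:M (B w) (B w)^T (D w).
  move=> Ww; have [ST _] := pS w Ww.
  rewrite -[LHS]submxK; congr block_mx.
    by rewrite [LHS]mx11_scalar; congr (_%:M); rewrite !mxE /al; congr (S1 w _ _); apply/val_inj.
  by rewrite /B trmx_ursub; congr dlsubmx; rewrite /S1 ST.
(* completing the square in t gives both the positivity of alpha (y = 0) and
   that of the Schur complement (t the minimizer) *)
have quad w (t : R) (y : 'rV[R]_p) : W w ->
    (row_mx t%:M y *m S1 w *m (row_mx t%:M y)^T) 0 0 =
    al w * t ^+ 2 + 2 * t * (y *m (B w)^T) 0 0 + (y *m D w *m y^T) 0 0.
  move=> Ww; rewrite SE// mul_row_block tr_row_mx mul_row_col tr_scalar_mx.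
  rewrite !mul_scalar_mx !mulmxDl !mul_mx_scalar.
  have BT : (B w *m y^T) 0 0 = (y *m (B w)^T) 0 0.
    rewrite (_ : B w *m y^T = (y *m (B w)^T)^T); first by rewrite mxE.
    by rewrite trmx_mul trmxK.
  rewrite -scalemxAl.
  move: (y *m (B w)^T) (B w *m y^T) (y *m D w *m y^T) BT => P Q Z BT.
  by rewrite !mxE BT eqxx mulr1n; ring.
have al0 w : W w -> 0 < al w.
  move=> Ww; have [_ pdw] := pS w Ww.
  have pd (x : 'rV[R]_(1 + p)) : x != 0 -> 0 < (x *m S1 w *m x^T) 0 0 by exact: pdw.
  have := quad w 1 0 Ww; have z0 : (0 : 'M[R]_1) 0 0 = 0 by rewrite mxE.
  rewrite !mul0mx z0 mulr0 expr1n mulr1 !addr0 => <-.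
  apply: pd; rewrite row_mx_eq0 negb_and; apply/orP; left.
  by apply/eqP => /matrixP/(_ 0 0); rewrite !mxE eqxx => /eqP; rewrite oner_eq0.
have lal : lm al by exact: lS.
have lB : loc_majorant_mx B by move=> i j; under eq_fun do rewrite !mxE; exact: lS.
have lD : loc_majorant_mx D by move=> i j; under eq_fun do rewrite !mxE; exact: lS.
have lai : lm (fun w => (al w)^-1) by exact: lm_inv.
pose S' w := D w - (al w)^-1 *: ((B w)^T *m B w).
have [||L' lL' LP] := IH S'.
- move=> i j.
  have -> : (fun w => S' w i j) =
      fun w => D w i j + - ((al w)^-1 * ((B w)^T *m B w) i j).
    by apply/funext => w; rewrite /S'; move: (D w) (_ *m B w) => X Y; rewrite !mxE.
  apply: lm_add; first exact: lD.
  apply: lm_opp; apply: lm_mul => //; move: i j.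
  by apply: lm_mxM => //; exact: lm_mxT.
- move=> w Ww; have [ST pdw] := pS w Ww; have a0 := al0 w Ww.
  have pd (x : 'rV[R]_(1 + p)) : x != 0 -> 0 < (x *m S1 w *m x^T) 0 0 by exact: pdw.
  have DT : (D w)^T = D w by rewrite /D trmx_drsub /S1 ST.
  split; first by rewrite /S' linearB linearZ /= trmx_mul trmxK DT.
  move=> y y0; have := pd (row_mx (- (al w)^-1 * (y *m (B w)^T) 0 0)%:M y).
  rewrite quad// => H.
  have -> : (y *m S' w *m y^T) 0 0 = al w * (- (al w)^-1 * (y *m (B w)^T) 0 0) ^+ 2 +
      2 * (- (al w)^-1 * (y *m (B w)^T) 0 0) * (y *m (B w)^T) 0 0 + (y *m D w *m y^T) 0 0.
    rewrite /S' mulmxBr mulmxBl -scalemxAr -scalemxAl.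
    have -> : y *m ((B w)^T *m B w) *m y^T = (y *m (B w)^T) *m (y *m (B w)^T)^T.
      by rewrite trmx_mul trmxK !mulmxA.
    rewrite [LHS]mxE [X in _ + X]mxE [X in _ - X]mxE.
    rewrite [(_ *m (_ *m _)^T) 0 0]mxE big_ord1 [(_^T) 0 0]mxE.
    set z := (y *m _) 0 0; field; by rewrite gt_eqF.
  apply: H; apply: contra_neq y0 => /eqP.
  by rewrite row_mx_eq0 => /andP[_ /eqP].
have lsq : lm (fun w => Num.sqrt (al w)) by exact: lm_sqrt.
have lsqi : lm (fun w => (Num.sqrt (al w))^-1).
  by apply: lm_inv => // w Ww; rewrite sqrtr_gt0 al0.
exists (fun w => block_mx (Num.sqrt (al w))%:M 0 ((Num.sqrt (al w))^-1 *: (B w)^T) (L' w)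
   : 'M[R]_(1 + p)).
  apply: (@lm_block 1 p 1 p (fun w => (Num.sqrt (al w))%:M) (fun=> 0)
    (fun w => (Num.sqrt (al w))^-1 *: (B w)^T) L') => //.
  - move=> i j; rewrite !ord1; under eq_fun do rewrite mxE eqxx mulr1n.
    exact: lsq.
  - by move=> i j; under eq_fun do rewrite mxE; exact: lm_cst.
  - by apply: lm_mxZ => //; exact: lm_mxT.
move=> w Ww; have a0 := al0 w Ww; have [LL dL] := LP w Ww.
have s0 : Num.sqrt (al w) != 0 by rewrite gt_eqF// sqrtr_gt0.
split; last by rewrite (@det_lblock _ 1 p) det_scalar1 mulr_gt0// sqrtr_gt0.
rewrite (@tr_block_mx _ 1 p 1 p) (@mulmx_block _ 1 p 1 p 1 p) -[RHS]/(S1 w) SE// !trmx0.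
rewrite !tr_scalar_mx !mul0mx !mulmx0 !addr0 linearZ /= trmxK.
rewrite -scalar_mxM -expr2 sqr_sqrtr; last exact: ltW.
rewrite mul_scalar_mx mul_mx_scalar !scalerA divff// !scale1r LL /S'.
rewrite -scalemxAl -scalemxAr scalerA -invfM -expr2 sqr_sqrtr ?(ltW a0)//.
by rewrite addrC subrK.
Qed.

End loc_majorant_matrix.

(** * The operator as a sum of squares *)

Lemma smooth_slice (R : realType) n d (G : topGroupType) (atlas : set (chart R G n))
    (O : set G) (W : set 'rV[R]_d) F a : is_lie_group atlas ->
  smooth_on_prod atlas O W F -> O a -> smooth_on W (F a).
Proof.
move=> lieG sF Oa s w Ww.
have [x ax xa] : exists2 x, atlas x & cdom x a by case: lieG => -[_ _ _ +] _; apply.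
have E : F a = fun w => in_chart x F (row_mx (cmap x a) w).
  by apply/funext => z; rewrite /in_chart row_mxKl row_mxKr (cinvK lieG ax xa).
have -> : iter_pd s (F a) =
    fun w => iter_pd (map (@rshift n d) s) (in_chart x F) (row_mx (cmap x a) w).
  rewrite E; elim: s => [|i s IH] //=.
  by apply/funext => z; rewrite IH pd_slice_r.
apply: differentiable_slice_r; apply: (sF x ax).
by rewrite /= row_mxKl row_mxKr (cinvK lieG ax xa); split => //; exists a.
Qed.

Lemma apply_field_vert (R : realType) n d (G : topologicalType)
    (e : 'I_n -> (G -> R) -> G -> R) (Y : 'rV[R]_d -> 'rV[R]_d) F a u :
  apply_field e (fun=> 0, Y) F a u = 'D_(Y u) (F a) u.
Proof. by rewrite /apply_field /= big1 ?add0r// => k _; rewrite mxE mul0r. Qed.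

(** The first-order part of b - s Laplacian + sum_k X_k^2 when the second-order
    parts cancel. *)
Definition drift_of (R : realType) n d (kappa : 'rV[R]_n -> R)
    (psi : 'rV[R]_d -> 'rV[R]_n) (b : 'rV[R]_d -> 'rV[R]_d) (s : R)
    (X : 'rV[R]_d -> 'M[R]_d) (u : 'rV[R]_d) : 'rV[R]_d :=
  \row_j (b u 0 j
    - s * (\sum_i (vol_density kappa psi u)^-1 * pd i (fun w => vol_density kappa psi w *
                 invmx (metric kappa psi w) i j) u)
    + \sum_k \sum_i X u k i * pd i (fun w => X w k j) u).

(** If X^T X is s times the inverse metric, then the rows X_k satisfy
    sum_k X_k^2 = s Laplacian up to first-order terms. *)
Lemma laplace_sum_of_squares (R : realType) n d (kappa : 'rV[R]_n -> R)
    (psi : 'rV[R]_d -> 'rV[R]_n) (b : 'rV[R]_d -> 'rV[R]_d) (s : R)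
    (X : 'rV[R]_d -> 'M[R]_d) (W : set 'rV[R]_d) f u :
  open W -> W u -> smooth_on W f ->
  vol_density kappa psi u != 0 -> differentiable (vol_density kappa psi) u ->
  (forall i j, differentiable (fun w => invmx (metric kappa psi w) i j) u) ->
  (forall i j, differentiable (fun w => X w i j) u) ->
  (X u)^T *m X u = s *: invmx (metric kappa psi u) ->
  'D_(b u) f u - s * laplace kappa psi f u =
  'D_(drift_of kappa psi b s X u) f u -
  \sum_k 'D_(row k (X u)) (fun w => 'D_(row k (X w)) f w) u.
Proof.
move=> oW Wu sf v0 dv dg dX XX.
have df w : W w -> differentiable f w by exact: (sf [::]).
have dpf j : differentiable (pd j f) u by exact: (sf [:: j]).
have step S i := @pd_sum_mul R d S (fun j => pd j f) u i ^~ dpf.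
have lapE : laplace kappa psi f u =
   \sum_j (\sum_i (vol_density kappa psi u)^-1 * pd i (fun w => vol_density kappa psi w *
                 invmx (metric kappa psi w) i j) u) * pd j f u +
   \sum_i \sum_j invmx (metric kappa psi u) i j * pd i (pd j f) u.
  rewrite /laplace mulr_sumr.
  transitivity (\sum_i \sum_j ((vol_density kappa psi u)^-1 *
      pd i (fun w => vol_density kappa psi w * invmx (metric kappa psi w) i j) u * pd j f u +
      invmx (metric kappa psi u) i j * pd i (pd j f) u)).
    apply: eq_bigr => i _.
    rewrite (step (fun j w => vol_density kappa psi w * invmx (metric kappa psi w) i j)).
      rewrite mulr_sumr; apply: eq_bigr => j _; rewrite mulrDr mulrA; congr (_ + _).
      by rewrite -mulrA mulKf.
    by move=> j; exact: differentiableM.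
  under eq_bigr do rewrite big_split /=.
  rewrite big_split /=; congr (_ + _).
  by rewrite exchange_big /=; apply: eq_bigr => j _; rewrite mulr_suml.
have frameE : \sum_k 'D_(row k (X u)) (fun w => 'D_(row k (X w)) f w) u =
   \sum_j (\sum_k \sum_i X u k i * pd i (fun w => X w k j) u) * pd j f u +
   \sum_i \sum_j (\sum_k X u k i * X u k j) * pd i (pd j f) u.
  transitivity (\sum_k \sum_i \sum_j (X u k i * pd i (fun w => X w k j) u * pd j f u +
      X u k i * X u k j * pd i (pd j f) u)).
    apply: eq_bigr => k _.
    have nE : nbhs u [set w | 'D_(row k (X w)) f w = \sum_j X w k j * pd j f w].
      apply: open_near oW Wu _ => w Ww /=; rewrite diff_pd; last exact: df.
      by apply: eq_bigr => j _; rewrite mxE.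
    rewrite (near_eq_derive _ nE) diff_pd; last first.
      by apply: differentiable_bigsum => j; exact: differentiableM.
    apply: eq_bigr => i _; rewrite mxE (step (fun j w => X w k j))//.
    by rewrite mulr_sumr; apply: eq_bigr => j _; rewrite mulrDr !mulrA.
  under eq_bigr => k _ do (under eq_bigr => i _ do rewrite big_split /=; rewrite big_split /=).
  rewrite big_split /=; congr (_ + _).
    under eq_bigr => k _ do rewrite exchange_big /=.
    rewrite exchange_big /=; apply: eq_bigr => j _; rewrite mulr_suml.
    by apply: eq_bigr => k _; rewrite mulr_suml.
  rewrite exchange_big /=; apply: eq_bigr => i _.
  rewrite exchange_big /=; apply: eq_bigr => j _.
  by rewrite mulr_suml.
have XXE i j : \sum_k X u k i * X u k j = s * invmx (metric kappa psi u) i j.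
  have /matrixP/(_ i j) := XX; rewrite [in X in _ = X]mxE => <-.
  by rewrite mxE; apply: eq_bigr => k _; rewrite mxE.
rewrite frameE lapE !diff_pd; [|exact: df..].
under [X in _ - (_ + X)]eq_bigr => i _ do
  (under eq_bigr => j _ do rewrite XXE -mulrA; rewrite -mulr_sumr).
rewrite -[X in _ - (_ + X)]mulr_sumr mulrDr !opprD !addrA; congr (_ - _).
rewrite mulr_sumr -!sumrB; apply: eq_bigr => j _.
by rewrite [drift_of _ _ _ _ _ _ _ _]mxE; ring.
Qed.

Section fokker_planck_form.
Context {R : realType} {n d : nat} {G : topGroupType}.
Variables (atlas : set (chart R G n)) (e : 'I_n -> (G -> R) -> G -> R).
Variables (c : 'I_n -> 'I_n -> 'I_n -> R) (eps : R) (M : set 'rV[R]_n).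
Variables (kappa : 'rV[R]_n -> R).
Hypotheses (lieG : is_lie_group atlas) (eps0 : 0 < eps).
Hypotheses (kappa0 : forall y, M y -> 0 < kappa y).
Hypothesis (akappa : analytic_function d M kappa).
Variables (W : set 'rV[R]_d) (psi : 'rV[R]_d -> 'rV[R]_n) (O : set 'rV[R]_n).
Hypothesis lp : local_param M W psi O.
Hypothesis tangent : forall u, W u -> (euler_arnold c (psi u) <= 'J psi u)%MS.

Local Notation lm := (loc_majorant W).

Let oW : open W. Proof. by case: lp => -[]. Qed.

Let MW u : W u -> M (psi u).
Proof. exact: local_param_mem lp. Qed.

Let lapsi j : lm (fun u => psi u 0 j).
Proof. by have [[_ _ + _ _] _] := lp => /(_ j)/analytic_onP. Qed.

Let lakappa : lm (fun u => kappa (psi u)).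
Proof. exact/analytic_onP/akappa/lp. Qed.

Let laJ : loc_majorant_mx W (fun u => 'J psi u).
Proof.
move=> i j; apply: (lm_eq oW _ (lm_pd i (lapsi j))) => u Wu.
rewrite jacobianE//; apply: (analytic_map_diff (W := W)) => // k.
exact/analytic_onP.
Qed.

Let lametric : loc_majorant_mx W (metric kappa psi).
Proof. by apply: lm_mxZ => //; apply: lm_mxM => //; exact: lm_mxT. Qed.

Lemma metric_posdef u : W u -> posdef (metric kappa psi u).
Proof.
move=> Wu; split; first by rewrite /metric linearZ /= trmx_mul trmxK.
move=> x x0; rewrite /metric -scalemxAr -scalemxAl mxE mulr_gt0//; first exact/kappa0/MW.
have -> : x *m ('J psi u *m ('J psi u)^T) *m x^T = (x *m 'J psi u) *m (x *m 'J psi u)^T.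
  by rewrite trmx_mul !mulmxA.
have xJ0 : x *m 'J psi u != 0.
  have [[_ _ _ rf _] _] := lp.
  by rewrite mulmx_free_eq0// rf.
move/rV0Pn : xJ0 => [i xi0].
rewrite mxE (bigD1 i)//= ltr_pwDl//.
  by rewrite [(_^T) i 0]mxE -expr2 exprn_even_gt0.
by apply: sumr_ge0 => j _; rewrite [(_^T) j 0]mxE -expr2 sqr_ge0.
Qed.

(** If the metric is L L^T, the matrix X = sqrt(s) L^-1 has X^T X equal to s
    times the inverse metric, and it is analytic because L^-1 is the adjugate
    divided by the positive function det L, which is also the volume density.
    The inverse Xi of X is returned for expressing vertical fields through the
    X_j. *)
Lemma hormander_form_exists : exists V X,
  hormander_form atlas e (@velocity R n) (euler_arnold c) eps kappa W psi V X /\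
  exists Xi : 'rV[R]_d -> 'M[R]_d, loc_majorant_mx W Xi /\
    forall u, W u -> Xi u *m (\matrix_j X j u) = 1%:M.
Proof.
have [L laL LP] := cholesky oW lametric metric_posdef.
pose s : R := eps ^+ 2 / 2.
have s0 : 0 < s by rewrite divr_gt0// exprn_gt0.
pose sg := Num.sqrt s.
have sg0 : 0 < sg by rewrite sqrtr_gt0.
have ladetL : lm (fun w => \det (L w)) by exact: lm_det.
have laidet : lm (fun w => (\det (L w))^-1).
  by apply: lm_inv => // w /LP[].
pose Xm w := (sg * (\det (L w))^-1) *: \adj (L w).
have laX : loc_majorant_mx W Xm.
  apply: lm_mxZ; last exact: lm_adj.
  by apply: lm_mul => //; exact: lm_cst.
have XmL w : W w -> Xm w *m L w = sg%:M.
  move=> /LP[_ d0]; rewrite /Xm -scalemxAl mul_adj_mx scale_scalar_mx -mulrA.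
  by rewrite mulVf ?mulr1// gt_eqF.
have metric_unit w : W w -> metric kappa psi w \in unitmx.
  move=> /LP[<- d0]; rewrite unitmx_mul unitmx_tr andbb unitmxE unitfE.
  by rewrite gt_eqF.
have XX w : W w -> (Xm w)^T *m Xm w = s *: invmx (metric kappa psi w).
  move=> Ww; have [LL d0] := LP w Ww.
  apply: (can_inj (mulmxK (metric_unit w Ww))).
  rewrite -scalemxAl mulVmx ?metric_unit// -LL mulmxA -[_ *m Xm w *m _]mulmxA XmL//.
  rewrite mul_mx_scalar -scalemxAl -trmx_mul.
  have LX : L w *m Xm w = sg%:M.
    have Lu : L w \in unitmx by rewrite unitmxE unitfE gt_eqF.
    apply: (can_inj (mulmxK Lu)).
    by rewrite -mulmxA XmL// mul_mx_scalar mul_scalar_mx.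
  by rewrite LX tr_scalar_mx scale_scalar_mx -expr2 sqr_sqrtr ?(ltW s0)// scalemx1.
have volE w : W w -> vol_density kappa psi w = \det (L w).
  move=> /LP[LL d0]; rewrite /vol_density -LL det_mulmx det_tr -expr2 sqrtr_sqr.
  by rewrite gtr0_norm.
have lavol : lm (vol_density kappa psi).
  by apply: (lm_eq oW _ ladetL) => w /volE ->.
have lainv : loc_majorant_mx W (fun w => invmx (metric kappa psi w)).
  apply: (@lm_mx_eq _ _ _ _ _ (fun w => s^-1 *: ((Xm w)^T *m Xm w)) _ oW).
    by move=> w Ww; rewrite XX// scalerA mulVf ?gt_eqF// scale1r.
  apply: lm_mxZ; first exact: lm_cst.
  by apply: lm_mxM => //; exact: lm_mxT.
pose b w := euler_arnold c (psi w) *m pinvmx ('J psi w).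
have lab j : lm (fun w => b w 0 j).
  have lea : loc_majorant_mx W (fun w => euler_arnold c (psi w)).
    move=> i k; rewrite ord1; under eq_fun do rewrite euler_arnoldE.
    apply: lm_sum => i'; apply: lm_mul => //.
    by apply: lm_sum => l; apply: lm_mul => //; exact: lm_cst.
  suff : loc_majorant_mx W b by apply.
  (* on tangent vectors the chosen left inverse of J agrees with
     J^T (J J^T)^-1, whose entries are analytic *)
  apply: (@lm_mx_eq _ _ _ _ _ (fun w => kappa (psi w) *:
     (euler_arnold c (psi w) *m ('J psi w)^T *m invmx (metric kappa psi w))) _ oW); last first.
    by apply: lm_mxZ => //; apply: lm_mxM => //; apply: lm_mxM => //; exact: lm_mxT.
  move=> w Ww; rewrite -{1}(mulmxKpV (tangent Ww)) -/(b w) -[_ *m _ *m (_^T)]mulmxA.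
  have -> : 'J psi w *m ('J psi w)^T = (kappa (psi w))^-1 *: metric kappa psi w.
    by rewrite /metric scalerA mulVf ?scale1r// gt_eqF// kappa0//; exact: MW.
  rewrite -scalemxAr -scalemxAl scalerA mulfV ?scale1r ?mulmxK ?metric_unit//.
  by rewrite gt_eqF// kappa0//; exact: MW.
pose V := drift_of kappa psi b s Xm.
have laV : analytic_map W V.
  move=> j; apply/analytic_onP; rewrite /V /drift_of; under eq_fun do rewrite mxE.
  apply: lm_add; [apply: lm_add => //; apply: lm_opp; apply: lm_mul; [exact: lm_cst|]|].
    apply: lm_sum => i; apply: lm_mul.
      by apply: lm_inv => // w Ww; rewrite volE//; have [] := LP w Ww.
    by apply: lm_pd; exact: lm_mul.
  apply: lm_sum => k; apply: lm_sum => i; apply: lm_mul => //.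
  exact: lm_pd.
have XE w : \matrix_j row j (Xm w) = Xm w by apply/row_matrixP => i; rewrite rowK.
have XiX w : W w -> (sg^-1 *: L w) *m Xm w = 1%:M.
  move=> Ww; apply: mulmx1C; rewrite -scalemxAr XmL// scale_scalar_mx.
  by rewrite mulVf// gt_eqF.
exists V, (fun j w => row j (Xm w)); split; last first.
  exists (fun w => sg^-1 *: L w); split; first by apply: lm_mxZ => //; exact: lm_cst.
  by move=> u Wu; rewrite XE XiX.
split => //.
- by move=> j i; apply/analytic_onP; under eq_fun do rewrite mxE; exact: laX.
- by move=> u Wu; rewrite XE; have [_] := mulmx1_unit (XiX u Wu).
- move=> Og F oOg sF a u Oa Wu.
  have sf := smooth_slice lieG sF Oa.
  rewrite /fp_operator {1}/apply_field /= -!addrA; congr (_ + _).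
  have -> : \sum_j apply_field e (fun=> 0, fun w => row j (Xm w))
       (apply_field e (fun=> 0, fun w => row j (Xm w)) F) a u =
     \sum_k 'D_(row k (Xm u)) (fun w => 'D_(row k (Xm w)) (F a) w) u.
    apply: eq_bigr => j _; rewrite apply_field_vert /=.
    have -> // : apply_field e (fun=> 0, fun w => row j (Xm w)) F a =
      fun w => 'D_(row j (Xm w)) (F a) w.
    by apply/funext => w; rewrite apply_field_vert.
  apply: (@laplace_sum_of_squares R n d kappa psi b s Xm W (F a) u oW Wu sf).
  + by rewrite volE// gt_eqF//; have [] := LP u Wu.
  + exact: lm_diff lavol Wu.
  + by move=> i j; exact: lm_diff (lainv i j) Wu.
  + by move=> i j; exact: lm_diff (laX i j) Wu.
  + exact: XX.
Qed.

End fokker_planck_form.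

(** * Linear subspaces and analytic continuation *)

Lemma derive_mulmx (R : realType) d n (f : 'rV[R]_d -> 'rV[R]_n) (K : 'M[R]_n) u v k :
  differentiable f u ->
  'D_v (fun w => (f w *m K) 0 k) u = ('D_v f u *m K) 0 k.
Proof.
move=> df.
have -> : (fun w => (f w *m K) 0 k) = fun w => linear_form (fun i => K i k) (f w).
  by apply/funext => w; rewrite mxE.
have [dl pl] := pd_linear_form (fun i => K i k) (f u).
rewrite chain_D// mxE; apply: eq_bigr => i _.
by rewrite derive_rV// pl.
Qed.

Lemma derive_ker (R : realType) d n (W : set 'rV[R]_d) (f : 'rV[R]_d -> 'rV[R]_n)
    (K : 'M[R]_n) c0 u v : open W -> W u -> differentiable f u ->
  (forall w, W w -> (f w - c0) *m K = 0) -> 'D_v f u *m K = 0.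
Proof.
move=> oW Wu df H; apply/rowP => k; rewrite -derive_mulmx// [RHS]mxE.
rewrite -(derive_cst ((c0 *m K) 0 k) u v); apply: near_eq_derive.
apply: open_near oW Wu _ => w Ww; have := H w Ww.
by rewrite mulmxBl => /eqP; rewrite subr_eq0 => /eqP ->.
Qed.

(** Membership in a subspace as a linear equation, which can be
    differentiated and analytically continued. *)
Lemma vspace_ker (R : realType) n (h : {vspace 'rV[R]_n}) :
  exists K : 'M[R]_n, forall x, x \in h <-> x *m K = 0.
Proof.
exists (lin1_mx (\1 - projv h)%VF) => x; rewrite mul_rV_lin1 /= add_lfunE opp_lfunE id_lfunE.
split=> [xh|/eqP]; first by rewrite projv_id// subrr.
by rewrite subr_eq0 => /eqP ->; exact: memv_proj.
Qed.

(** A subspace of maximal dimension among those contained in S is all of S. *)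
Lemma subspace_vspace (R : realType) n (S : set 'rV[R]_n) : S 0 ->
  (forall x y, S x -> S y -> S (x + y)) -> (forall a x, S x -> S (a *: x)) ->
  exists h : {vspace 'rV[R]_n}, forall x, x \in h <-> S x.
Proof.
move=> S0 SD SZ.
pose P k := `[< exists h : {vspace 'rV[R]_n}, (forall x, x \in h -> S x) /\ \dim h = k >].
have exP : exists k, P k.
  exists 0%N; apply/asboolP; exists 0%VS; split; last exact: dimv0.
  by move=> x; rewrite memv0 => /eqP ->.
have ubP k : P k -> (k <= \dim {:'rV[R]_n})%N.
  by move=> /asboolP[h [_ <-]]; exact/dimvS/subvf.
have [k /asboolP[h [hS hk]] kmax] := ex_maxnP exP ubP.
exists h => x; split; first exact: hS.
move=> Sx; apply: contrapT => /negP xh.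
have /kmax : P (\dim (h + <[x]>)%VS).
  apply/asboolP; exists (h + <[x]>)%VS; split => // y /memv_addP[a ah [b]].
  by move=> /vlineP[t ->] ->; apply: SD; [exact: hS|exact: SZ].
rewrite leqNgt -hk => /negP; apply.
rewrite (ltn_leqif (dimv_leqif_sup (addvSl _ _))).
by apply: contra xh => /subvP; apply; rewrite (subvP (addvSr _ _))// memv_line.
Qed.

Lemma loc_majorant_affine (R : realType) d n (W : set 'rV[R]_d)
    (f : 'rV[R]_d -> 'rV[R]_n) (K : 'M[R]_n) z0 k : analytic_map W f ->
  loc_majorant W (fun w => ((f w - z0) *m K) 0 k).
Proof.
move=> af; under eq_fun do rewrite mxE.
apply: lm_sum => j; apply: lm_mul; last exact: lm_cst.
under eq_fun do rewrite !mxE.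
by apply: lm_add; [exact/analytic_onP/af|exact: lm_cst].
Qed.

(** The points of M near which M lies in the affine subspace form an open
    subset of M. It is closed in M: near a limit point p, the pull-back of the
    linear equations to a ball of parameters vanishes near the parameter of
    some good point, hence on the whole ball by the identity theorem. *)
Lemma analytic_continuation (R : realType) n d (M : set 'rV[R]_n) (K : 'M[R]_n) z0 :
  analytic_submanifold d M -> connected M -> M z0 ->
  nbhs z0 [set q | M q -> (q - z0) *m K = 0] ->
  forall q, M q -> (q - z0) *m K = 0.
Proof.
move=> aM cM Mz0 nz0.
pose Z := [set q : 'rV[R]_n | nbhs q [set q' | M q' -> (q' - z0) *m K = 0]].
have oZ : open Z by rewrite openE => q /nbhs_interior.
suff BM : M `&` Z = M.
  move=> q Mq; have [_ /nbhs_singleton] : (M `&` Z) q by rewrite BM.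
  exact.
apply: cM.
- by exists z0.
- by exists Z.
exists (closure (M `&` Z)); first exact: closed_closure.
apply/seteqP; split; first by move=> q [Mq Zq]; split => //; exact: subset_closure.
move=> p [Mp clp]; split => //.
have [W [psi [Om [lp Op]]]] := aM p Mp.
have [[oW _ apsi _ psiW] _] := lp.
have [u Wu up] : (psi @` W) p by rewrite psiW.
have /nbhs_normP[r /= r0 rW] : nbhs u W by exact: open_nbhs_nbhs.
have Ww w : `|w - u| < r -> W w by move=> H; apply: rW; rewrite /= distrC.
have n1 := local_param_near lp Wu r0.
rewrite up in n1.
have [q [[Mq Zq] /(_ Mq)[w1 [_ w1q w1r]]]] := clp _ n1.
have zero w : `|w - u| < r -> (psi w - z0) *m K = 0.
  move=> wr; apply/rowP => k; rewrite [RHS]mxE.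
  pose g w := ((psi w - z0) *m K) 0 k.
  have lag : loc_majorant W g by exact: loc_majorant_affine.
  rewrite -/(g w) -[w](subrK w1) addrC.
  apply: (identity_segment lag).
    by move=> s s01; apply: Ww; exact: ball_convex.
  have cw1 : {for w1, continuous psi}.
    by apply: differentiable_continuous; exact: analytic_map_diff apsi (Ww _ w1r).
  have n2 : nbhs w1 (W `&` psi @^-1` [set q' | M q' -> (q' - z0) *m K = 0]).
    apply: filterI; first by apply: open_nbhs_nbhs; split => //; exact: Ww.
    by apply: cw1; rewrite w1q; exact: Zq.
  apply: filterS n2 => w' [Ww' H]; rewrite /g H ?mxE//.
  exact: local_param_mem lp Ww'.
apply: filterS n1 => y yw My.
by have [w [_ <- wr]] := yw My; exact: zero.
Qed.

Lemma lie_bracketDl (R : realType) n (c : 'I_n -> 'I_n -> 'I_n -> R) x y z :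
  lie_bracket c (x + y) z = lie_bracket c x z + lie_bracket c y z.
Proof.
apply/rowP => k; rewrite !mxE -big_split; apply: eq_bigr => i _.
by rewrite -big_split; apply: eq_bigr => j _; rewrite mxE mulrDr mulrDl.
Qed.

Lemma lie_bracket0r (R : realType) n (c : 'I_n -> 'I_n -> 'I_n -> R) x :
  lie_bracket c x 0 = 0.
Proof.
by apply/rowP => k; rewrite !mxE big1// => i _; rewrite big1// => j _; rewrite mxE mulr0.
Qed.

Lemma lie_bracket0l (R : realType) n (c : 'I_n -> 'I_n -> 'I_n -> R) x :
  lie_bracket c 0 x = 0.
Proof.
by apply/rowP => k; rewrite !mxE big1// => i _; rewrite big1// => j _; rewrite mxE mulr0 mul0r.
Qed.

(** * The Hormander module *)

Section module.
Context {R : realType} {n d : nat} {G : topGroupType}.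
Variables (atlas : set (chart R G n)) (x1 : chart R G n) (E : 'M[R]_n).
Hypotheses (lieG : is_lie_group atlas) (ax1 : atlas x1) (x11 : cdom x1 1%g).
Hypothesis (Eunit : E \in unitmx).
Local Notation e := (left_frame x1 E).
Variable c : 'I_n -> 'I_n -> 'I_n -> R.
Hypothesis scE : structure_constants atlas e c.
Variable (W : set 'rV[R]_d).
Hypothesis oW : open W.
Implicit Types A B C : vfield R n d.

Lemma analytic_field_differentiable A u : analytic_field W A -> W u -> field_differentiable A u.
Proof.
move=> [a1 a2] Wu; split=> i; apply: (lm_diff (W := W)) => //; exact/analytic_onP.
Qed.

Lemma bracket_of A B C : analytic_field W A -> analytic_field W B ->
  (forall u, W u -> C.1 u = (bracket_field c A B).1 u /\ C.2 u = (bracket_field c A B).2 u) ->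
  is_bracket atlas e W A B C.
Proof.
move=> aA aB; apply: (is_bracket_field lieG ax1 x11 scE oW) => u Wu.
by split; exact: analytic_field_differentiable.
Qed.

Lemma bracket_eq A B C : analytic_field W A -> analytic_field W B ->
  is_bracket atlas e W A B C -> forall u, W u -> C.1 u = (bracket_field c A B).1 u.
Proof.
move=> aA aB; apply: (is_bracket_unique lieG ax1 x11 Eunit scE oW) => u Wu.
by split; exact: analytic_field_differentiable.
Qed.

Lemma analytic_map_eq p (f g : 'rV[R]_d -> 'rV[R]_p) :
  (forall u, W u -> f u = g u) -> analytic_map W f -> analytic_map W g.
Proof.
move=> fg af i; apply/analytic_onP/(lm_eq oW (f := fun u => f u 0 i)).
  by move=> u Wu; rewrite fg.
exact/analytic_onP.
Qed.

Lemma analytic_mapD p (f g : 'rV[R]_d -> 'rV[R]_p) : analytic_map W f ->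
  analytic_map W g -> analytic_map W (fun u => f u + g u).
Proof.
move=> af ag i; apply/analytic_onP; under eq_fun do rewrite mxE.
by apply: lm_add; exact/analytic_onP.
Qed.

Lemma analytic_mapZ p h (f : 'rV[R]_d -> 'rV[R]_p) : analytic_on W h ->
  analytic_map W f -> analytic_map W (fun u => h u *: f u).
Proof.
move=> ah af i; apply/analytic_onP; under eq_fun do rewrite mxE.
by apply: lm_mul; exact/analytic_onP.
Qed.

Lemma analytic_on_cst (a : R) : analytic_on W (fun=> a).
Proof. exact/analytic_onP/lm_cst. Qed.

Lemma analytic_map_cst p (a : 'rV[R]_p) : analytic_map W (fun=> a).
Proof. by move=> i; exact: analytic_on_cst. Qed.

Lemma analytic_map_derive p (f : 'rV[R]_d -> 'rV[R]_p) i : analytic_map W f ->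
  analytic_map W (fun u => 'D_(delta_mx 0 i) f u).
Proof.
move=> af k; apply/analytic_onP.
apply: (lm_eq oW (f := pd i (fun u => f u 0 k))).
  by move=> u Wu; rewrite derive_rV//; exact: analytic_map_diff af Wu.
exact/lm_pd/analytic_onP.
Qed.

Lemma analytic_map_lie (f g : 'rV[R]_d -> 'rV[R]_n) : analytic_map W f ->
  analytic_map W g -> analytic_map W (fun u => lie_bracket c (f u) (g u)).
Proof.
move=> af ag k; apply/analytic_onP; under eq_fun do rewrite mxE.
apply: lm_sum => i; apply: lm_sum => j; apply: lm_mul; [apply: lm_mul|].
- exact: lm_cst.
- exact/analytic_onP.
- exact/analytic_onP.
Qed.

Lemma derive_eqW p (f g : 'rV[R]_d -> 'rV[R]_p) u v : W u ->
  (forall w, W w -> f w = g w) -> 'D_v f u = 'D_v g u.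
Proof. by move=> Wu fg; apply: near_eq_derive; exact: open_near Wu fg. Qed.

Lemma derive_sum_delta p (f : 'rV[R]_d -> 'rV[R]_p) u v : differentiable f u ->
  'D_v f u = \sum_i v 0 i *: 'D_(delta_mx 0 i) f u.
Proof.
move=> df; rewrite deriveE// {1}(row_sum_delta v) linear_sum.
by apply: eq_bigr => i _; rewrite linearZ /= deriveE.
Qed.

Variables (X0 : vfield R n d) (X : 'I_d -> 'rV[R]_d -> 'rV[R]_d).
Hypotheses (aX0 : analytic_field W X0) (aX : forall j, analytic_map W (X j)).
Local Notation HM := (hormander_module atlas e W X0 (fun j => (fun=> 0, X j))).

Lemma hm_analytic A : HM A -> analytic_field W A.
Proof.
apply => //; last by move=> j; split; [exact: analytic_map_cst|exact: aX].
split => //.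
- by split; exact: analytic_map_cst.
- by move=> A' B' [a1 a2] [b1 b2]; split; exact: analytic_mapD.
- by move=> f A' af [a1 a2]; split; exact: analytic_mapZ.
Qed.

Lemma hmX j : HM (fun=> 0, X j).
Proof. by move=> N _ NX _; exact: NX. Qed.

Lemma hm0 : HM (fun=> 0, fun=> 0).
Proof. by move=> N [_ + _ _ _]. Qed.

Lemma hmD A B : HM A -> HM B -> HM (fun u => A.1 u + B.1 u, fun u => A.2 u + B.2 u).
Proof.
move=> hA hB N sN NX N0; have [_ _ ND _ _] := sN.
by apply: ND; [exact: hA|exact: hB].
Qed.

Lemma hmZ f A : analytic_on W f -> HM A ->
  HM (fun u => f u *: A.1 u, fun u => f u *: A.2 u).
Proof.
move=> af hA N sN NX N0; have [_ _ _ NZ _] := sN.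
by apply: NZ => //; exact: hA.
Qed.

Lemma hm_bracket A B C : HM A -> HM B -> analytic_field W C ->
  (forall u, W u -> C.1 u = (bracket_field c A B).1 u /\ C.2 u = (bracket_field c A B).2 u) -> HM C.
Proof.
move=> hA hB aC CE N sN NX N0; have [_ _ _ _ NB] := sN.
apply: (NB A B) => //; [exact: hA|exact: hB|].
by apply: bracket_of => //; exact: hm_analytic.
Qed.

Lemma hm_bracket0 B C : HM B -> analytic_field W C ->
  (forall u, W u -> C.1 u = (bracket_field c X0 B).1 u /\ C.2 u = (bracket_field c X0 B).2 u) ->
  HM C.
Proof.
move=> hB aC CE N sN NX N0.
apply: (N0 B) => //; first exact: hB.
by apply: bracket_of => //; exact: hm_analytic.
Qed.

Lemma hm_sum (I : finType) (F : I -> vfield R n d) : (forall i, HM (F i)) ->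
  HM (fun u => \sum_i (F i).1 u, fun u => \sum_i (F i).2 u).
Proof.
move=> hF; elim: (index_enum I) => [|i s IH].
  suff -> : (fun u => \sum_(i <- [::]) (F i).1 u, fun u => \sum_(i <- [::]) (F i).2 u)
    = (fun=> 0, fun=> 0) :> vfield R n d by exact: hm0.
  by congr pair; apply/funext => u; rewrite big_nil.
suff -> : (fun u => \sum_(j <- i :: s) (F j).1 u, fun u => \sum_(j <- i :: s) (F j).2 u)
  = (fun u => (F i).1 u + \sum_(j <- s) (F j).1 u,
     fun u => (F i).2 u + \sum_(j <- s) (F j).2 u) :> vfield R n d.
  exact: hmD (hF i) IH.
by congr pair; apply/funext => u; rewrite big_cons.
Qed.

(** The G-components of those fields of the module which have no component
    along W; the values of fields off W carry no information. *)
Definition horizontal (Y : 'rV[R]_d -> 'rV[R]_n) := exists2 A, HM A &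
  forall u, W u -> A.1 u = Y u /\ A.2 u = 0.

Lemma horizontal_analytic Y : horizontal Y -> analytic_map W Y.
Proof.
move=> [A /hm_analytic[a1 _] AE]; apply: analytic_map_eq a1 => u Wu.
by have [] := AE u Wu.
Qed.

Lemma horizontal_eq Y Y' : (forall u, W u -> Y u = Y' u) -> horizontal Y -> horizontal Y'.
Proof. by move=> YY [A hA AE]; exists A => // u Wu; rewrite -YY//; exact: AE. Qed.

Lemma horizontal0 : horizontal (fun=> 0).
Proof. by exists (fun=> 0, fun=> 0) => //; exact: hm0. Qed.

Lemma horizontalD Y Y' : horizontal Y -> horizontal Y' -> horizontal (fun u => Y u + Y' u).
Proof.
move=> [A hA AE] [B hB BE]; exists (fun u => A.1 u + B.1 u, fun u => A.2 u + B.2 u).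
  exact: hmD.
by move=> u Wu /=; have [-> ->] := AE u Wu; have [-> ->] := BE u Wu; rewrite addr0.
Qed.

Lemma horizontalZ f Y : analytic_on W f -> horizontal Y -> horizontal (fun u => f u *: Y u).
Proof.
move=> af [A hA AE]; exists (fun u => f u *: A.1 u, fun u => f u *: A.2 u).
  exact: hmZ.
by move=> u Wu /=; have [-> ->] := AE u Wu; rewrite scaler0.
Qed.

Lemma horizontal_sum (I : finType) (Y : I -> 'rV[R]_d -> 'rV[R]_n) : (forall i, horizontal (Y i)) ->
  horizontal (fun u => \sum_i Y i u).
Proof.
move=> hY; elim: (index_enum I) => [|i s IH].
  by apply: horizontal_eq horizontal0 => u _; rewrite big_nil.
by apply: horizontal_eq (horizontalD (hY i) IH) => u _; rewrite big_cons.
Qed.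

Lemma horizontal_lie Y Y' : horizontal Y -> horizontal Y' ->
  horizontal (fun u => lie_bracket c (Y u) (Y' u)).
Proof.
move=> hY hY'; have [A hA AE] := hY; have [B hB BE] := hY'.
exists (fun u => lie_bracket c (Y u) (Y' u), fun=> 0) => //.
apply: (hm_bracket hA hB).
  by split; [apply: analytic_map_lie; exact: horizontal_analytic|exact: analytic_map_cst].
move=> u Wu /=; have [-> ->] := AE u Wu; have [-> ->] := BE u Wu.
by rewrite !derive0 !subr0 addr0.
Qed.

Variable Xi : 'rV[R]_d -> 'M[R]_d.
Hypotheses (laXi : loc_majorant_mx W Xi) (XiX : forall u, W u -> Xi u *m (\matrix_j X j u) = 1%:M).

(** The X_j form a basis at each point, and the coefficients of Y in it are
    analytic, so the module contains all vertical fields. *)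
Lemma vertical Y : analytic_map W Y -> exists2 A, HM A &
  forall u, W u -> A.1 u = 0 /\ A.2 u = Y u.
Proof.
move=> aY.
have laY : loc_majorant_mx W Y by move=> i j; rewrite ord1; exact/analytic_onP/aY.
exists (fun u => \sum_j (Y u *m Xi u) 0 j *: (0 : 'rV[R]_n),
        fun u => \sum_j (Y u *m Xi u) 0 j *: X j u).
  apply: (@hm_sum _ (fun j => (fun u => (Y u *m Xi u) 0 j *: (0 : 'rV[R]_n),
     fun u => (Y u *m Xi u) 0 j *: X j u))) => j.
  apply: (hmZ (f := fun u => (Y u *m Xi u) 0 j) _ (hmX j)).
  apply/analytic_onP; move: 0 j; exact: lm_mxM.
move=> u Wu /=; split; first by rewrite big1// => j _; rewrite scaler0.
rewrite -[RHS]mulmx1 -(XiX Wu) mulmxA [RHS]mulmx_sum_row.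
by apply: eq_bigr => j _; rewrite rowK.
Qed.

(** By bracketing with the vertical field d/du^i. *)
Lemma horizontal_derive i Y : horizontal Y -> horizontal (fun u => 'D_(delta_mx 0 i) Y u).
Proof.
move=> hY; have [A hA AE] := hY.
have [B hB BE] := vertical (analytic_map_cst (delta_mx 0 i)).
exists (fun u => 'D_(delta_mx 0 i) Y u, fun=> 0) => //.
apply: (hm_bracket hB hA).
  by split; [apply: analytic_map_derive; exact: horizontal_analytic|exact: analytic_map_cst].
move=> u Wu /=; have [-> ->] := BE u Wu; have [_ ->] := AE u Wu.
rewrite lie_bracket0l add0r !derive0 !subr0; split.
  by apply: derive_eqW => // w Ww; have [] := AE w Ww.
rewrite (derive_eqW (g := fun=> 0) _ Wu) ?derive_cst//.
by move=> w Ww; have [] := AE w Ww.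
Qed.

(** The bracket [X_0, (Y, 0)] is (lie_bracket X_0 Y + D_V Y, 0), and the
    derivative term is already horizontal by horizontal_derive. *)
Lemma horizontal_X0 Y : horizontal Y -> horizontal (fun u => lie_bracket c (X0.1 u) (Y u)).
Proof.
move=> hY; have [A hA AE] := hY.
have dY u : W u -> differentiable Y u.
  by move=> Wu; exact: analytic_map_diff (horizontal_analytic hY) Wu.
pose DY u := \sum_i X0.2 u 0 i *: 'D_(delta_mx 0 i) Y u.
have hDY : horizontal DY.
  apply: horizontal_sum => i; apply: (horizontalZ (f := fun u => X0.2 u 0 i));
    last exact: horizontal_derive.
  by have [_] := aX0; apply.
have hC : horizontal (fun u => lie_bracket c (X0.1 u) (Y u) + DY u).
  exists (fun u => lie_bracket c (X0.1 u) (Y u) + DY u, fun=> 0) => //.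
  apply: (hm_bracket0 hA).
    split; last exact: analytic_map_cst.
    apply: analytic_mapD; last exact: horizontal_analytic.
    by apply: analytic_map_lie; [case: aX0|exact: horizontal_analytic].
  move=> u Wu /=; have [-> ->] := AE u Wu.
  rewrite !derive0 !subr0; split.
    rewrite /DY -derive_sum_delta; last exact: dY.
    by congr (_ + _); apply: derive_eqW => // w Ww; have [] := AE w Ww.
  rewrite (derive_eqW (g := fun=> 0) _ Wu) ?derive_cst//.
  by move=> w Ww; have [] := AE w Ww.
apply: horizontal_eq (horizontalD hC (horizontalZ (analytic_on_cst (-1)) hDY)) => u _.
by rewrite scaleN1r addrK.
Qed.

(** The bracket [X_0, d/du^i] is minus the derivative of X_0, and its vertical
    part is removed by vertical. *)
Lemma horizontal_dX0 i : horizontal (fun u => 'D_(delta_mx 0 i) X0.1 u).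
Proof.
have [a1 a2] := aX0.
have [B hB BE] := vertical (analytic_map_cst (delta_mx 0 i)).
have [B' hB' BE'] := vertical (analytic_map_derive i a2).
have hC : HM (fun u => -1 *: 'D_(delta_mx 0 i) X0.1 u, fun u => -1 *: 'D_(delta_mx 0 i) X0.2 u).
  apply: (hm_bracket0 hB).
    by split; apply: analytic_mapZ; [exact: analytic_on_cst|exact: analytic_map_derive|
       exact: analytic_on_cst|exact: analytic_map_derive].
  move=> u Wu /=; have [-> ->] := BE u Wu.
  rewrite lie_bracket0r !scaleN1r; split.
    rewrite (derive_eqW (f := B.1) (g := fun=> 0) _ Wu) ?derive_cst ?addr0 ?add0r//.
    by move=> w Ww; have [] := BE w Ww.
  rewrite (derive_eqW (f := B.2) (g := fun=> delta_mx 0 i) _ Wu) ?derive_cst ?add0r//.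
  by move=> w Ww; have [] := BE w Ww.
have hD := hmZ (analytic_on_cst (-1)) (hmD hC hB').
eexists; first exact: hD.
move=> u Wu /=; have [-> ->] := BE' u Wu.
by rewrite !scaleN1r addr0 opprK addNr oppr0.
Qed.

End module.

(** * The condition and the hull *)

Section equivalence.
Context {R : realType} {n d : nat} {G : topGroupType}.
Variables (atlas : set (chart R G n)) (x1 : chart R G n) (E : 'M[R]_n).
Hypotheses (lieG : is_lie_group atlas) (ax1 : atlas x1) (x11 : cdom x1 1%g).
Hypothesis (Eunit : E \in unitmx).
Local Notation e := (left_frame x1 E).
Variable c : 'I_n -> 'I_n -> 'I_n -> R.
Hypothesis scE : structure_constants atlas e c.
Variables (eps : R) (M : set 'rV[R]_n) (kappa : 'rV[R]_n -> R).

(** For p-closed h, the fields with G-component in h form one of the submodules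
    over which the module is the intersection. Derivatives of such fields
    cause no problem, because h is cut out by linear equations. *)
Lemma hormander_hull_full (v b : 'rV[R]_n -> 'rV[R]_n) : M !=set0 ->
  (forall y, v y = y) ->
  hormander d atlas e v b eps kappa M -> p_hull c M = setT.
Proof.
move=> [z0 Mz0] vE horm; apply/seteqP; split => // x _ h [h1 h2 h3].
have [W [psi [Om [u0 [V [X [lp Wu0 psiu0 hf span]]]]]]] := horm 1%g z0 Mz0.
have [[oW _ apsi _ _] _] := lp.
have [aV aX _ _] := hf.
have MW u : W u -> M (psi u) by exact: local_param_mem lp.
have [K hK] := vspace_ker h.
pose N := [set A : vfield R n d | analytic_field W A /\ forall u, W u -> A.1 u *m K = 0].
have aX0 : analytic_field W (fun w => v (psi w), V).
  by split => //; apply: (analytic_map_eq oW) apsi => u _ /=; rewrite vE.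
have NK A u w : N A -> W u -> 'D_w A.1 u *m K = 0.
  move=> [[a1 _] AK] Wu; apply: (derive_ker w oW Wu (c0 := 0)).
    exact: analytic_map_diff a1 Wu.
  by move=> w' Ww'; rewrite subr0; exact: AK.
have NN : lie_submodule atlas e W N.
  split.
  - by move=> A [].
  - by split; [split; exact: analytic_map_cst|move=> u _; rewrite mul0mx].
  - move=> A B [[a1 a2] AK] [[b1 b2] BK]; split; first by split; exact: analytic_mapD.
    by move=> u Wu /=; rewrite mulmxDl AK// BK// addr0.
  - move=> f A af [[a1 a2] AK]; split; first by split; exact: analytic_mapZ.
    by move=> u Wu /=; rewrite -scalemxAl AK// scaler0.
  - move=> A B C NA NB aC CB; split => // u Wu.
    have [aA AK] := NA; have [aB BK] := NB.
    rewrite (bracket_eq lieG ax1 x11 Eunit scE oW aA aB CB Wu) /=.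
    rewrite mulmxBl mulmxDl !NK// addr0 subr0.
    by apply/hK; apply: h1; apply/hK; [exact: AK|exact: BK].
have HN A : hormander_module atlas e W (fun w => v (psi w), V)
    (fun j => (fun=> 0, X j)) A -> N A.
  apply => //.
    move=> j; split; first by split; [exact: analytic_map_cst|exact: aX].
    by move=> u _; rewrite mul0mx.
  move=> B C NB aC CB; split => // u Wu; have [aB BK] := NB.
  rewrite (bracket_eq lieG ax1 x11 Eunit scE oW aX0 aB CB Wu) /=.
  rewrite mulmxBl mulmxDl NK// addr0.
  have -> : 'D_(B.2 u) (fun w => v (psi w)) u *m K = 0.
    apply: (derive_ker _ oW Wu (c0 := z0)).
      by have [a1 _] := aX0; exact: analytic_map_diff a1 Wu.
    by move=> w Ww; apply/hK; rewrite vE; apply: h2 => //; exact: MW.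
  rewrite subr0; apply/hK; rewrite vE; apply: h3; first exact: MW.
  by apply/hK; exact: BK.
(* the frame at the unit is the matrix E, so this tangent vector has the
   G-component x *)
have [A /HN[_ AK] At] := span x1 ax1 x11 (x *m E, 0).
have Ax : A.1 u0 = x.
  apply: (can_inj (mulmxK Eunit)).
  move: At => /(congr1 fst) /= <-; apply/rowP => i; rewrite !mxE.
  apply: eq_bigr => k _; congr (_ * _).
  by rewrite (left_frame_coord1 E lieG ax1 x11).
by apply/hK; rewrite -Ax; exact: AK.
Qed.

Hypotheses (eps0 : 0 < eps) (aM : analytic_submanifold d M) (cM : connected M).
Hypotheses (kappa0 : forall y, M y -> 0 < kappa y) (akappa : analytic_function d M kappa).
Hypothesis tangent : forall W (psi : 'rV[R]_d -> 'rV[R]_n) O u,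
  local_param M W psi O -> W u -> (euler_arnold c (psi u) <= 'J psi u)%MS.

(** The values at u0 of the horizontal fields form a p-closed subspace h; that
    M lies in z0 + h follows from the derivatives of psi being horizontal,
    since an analytic function all of whose derivatives vanish at u0 is zero
    nearby. *)
Lemma hull_full_hormander : p_hull c M = setT ->
  hormander d atlas e (@velocity R n) (euler_arnold c) eps kappa M.
Proof.
move=> full a z0 Mz0.
have [W [psi [Om [lp Oz0]]]] := aM Mz0.
have [[oW _ apsi _ psiW] _] := lp.
have [u0 Wu0 psiu0] : (psi @` W) z0 by rewrite psiW.
have tg u : W u -> (euler_arnold c (psi u) <= 'J psi u)%MS by exact: tangent lp.
have [V [X [hf [Xi [laXi XiX]]]]] :=
  hormander_form_exists e lieG eps0 kappa0 akappa lp tg.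
exists W, psi, Om, u0, V, X; split => // x ax xa [t1 t2].
have [aV aX _ _] := hf.
pose X0 : vfield R n d := (fun w => @velocity R n (psi w), V).
have aX0 : analytic_field W X0.
  by split => //; apply: (analytic_map_eq oW) apsi => u _ /=; rewrite velocity_id.
pose horizontal := @horizontal R n d G atlas x1 E W X0 X.
pose S := [set y | exists2 Y, horizontal Y & Y u0 = y].
have [h hS] : exists h : {vspace 'rV[R]_n}, forall y, y \in h <-> S y.
  apply: subspace_vspace.
  - by exists (fun=> 0) => //; exact: horizontal0.
  - move=> _ _ [Y hY <-] [Y' hY' <-]; exists (fun u => Y u + Y' u) => //.
    exact: horizontalD.
  - move=> s _ [Y hY <-]; exists (fun u => s *: Y u) => //.
    by apply: (horizontalZ (f := fun=> s)) => //; exact: analytic_on_cst.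
have [K hK] := vspace_ker h.
have SK y : S y -> y *m K = 0 by move=> /hS/hK.
pose g k w := ((psi w - z0) *m K) 0 k.
have lag k : loc_majorant W (g k) by exact: loc_majorant_affine.
(* derivatives of psi of positive order are horizontal; rcons, because the
   innermost derivative is the one that comes from X_0 *)
have derg s i : exists2 Y, horizontal Y & forall k u, W u ->
    iter_pd (rcons s i) (g k) u = (Y u *m K) 0 k.
  elim: s => [|j s [Y hY YE]] /=.
    exists (fun u => 'D_(delta_mx 0 i) X0.1 u).
      exact: (horizontal_dX0 lieG ax1 x11 scE oW aX0 aX laXi XiX).
    move=> k u Wu.
    have dpsi : differentiable psi u by exact: analytic_map_diff apsi Wu.
    rewrite /X0 /= velocity_id -derive_mulmx// /pd /g.
    have -> : (fun w => ((psi w - z0) *m K) 0 k) =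
        fun w => (psi w *m K) 0 k - (z0 *m K) 0 k.
      by apply/funext => w; rewrite mulmxBl mxE [X in _ + X]mxE.
    have dK : differentiable (fun w => (psi w *m K) 0 k) u.
      under eq_fun do rewrite mxE.
      apply: differentiable_bigsum => l; apply: differentiableM; last exact: differentiable_cst.
      exact: differentiable_coord_of.
    rewrite deriveB; [|exact: diff_derivable|exact: derivable_cst].
    by rewrite derive_cst subr0.
  exists (fun u => 'D_(delta_mx 0 j) Y u).
    exact: (horizontal_derive lieG ax1 x11 scE oW aX laXi XiX j hY).
  move=> k u Wu; have aY := horizontal_analytic oW aX hY.
  have dY : differentiable Y u by exact: analytic_map_diff aY Wu.
  rewrite -derive_mulmx//; apply: near_pd.
  by apply: open_near oW Wu _ => w Ww; exact: YE.
have flatg k : flat (g k) u0.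
  move=> s; case/lastP: s => [|s i].
    by rewrite /iter_pd /= /g psiu0 subrr mul0mx mxE.
  have [Y hY ->] := derg s i => //.
  by rewrite SK ?mxE//; exists Y.
have near0 : nbhs u0 [set w | (psi w - z0) *m K = 0].
  have : nbhs u0 [set w | forall k, g k w = 0].
    near=> w; near: w; apply: filter_forall => k.
    exact: flat_near (lag k) Wu0 (flatg k).
  by apply: filterS => w H; apply/rowP => k; rewrite [RHS]mxE; exact: H.
have nz0 : nbhs z0 [set q | M q -> (q - z0) *m K = 0].
  have /nbhs_normP[r /= r0 rP] := near0.
  have := local_param_near lp Wu0 r0; rewrite psiu0.
  apply: filterS => y yw My; have [w [_ <- wu]] := yw My.
  by apply: rP; rewrite /= distrC.
have Mz := analytic_continuation aM cM Mz0 nz0.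
have hlie y y' : y \in h -> y' \in h -> lie_bracket c y y' \in h.
  move=> /hS[Y hY <-] /hS[Y' hY' <-]; apply/hS.
  exists (fun u => lie_bracket c (Y u) (Y' u)) => //.
  exact: (horizontal_lie lieG ax1 x11 scE oW aX hY hY').
have hfull y : y \in h.
  have : p_hull c M y by rewrite full.
  apply; split => //.
    move=> s1 s2 Ms1 Ms2; apply/hK.
    have -> : s1 - s2 = (s1 - z0) - (s2 - z0) by rewrite opprB addrA subrK.
    by rewrite mulmxBl !Mz// subrr.
  move=> s y' Ms y'h.
  have -> : s = z0 + (s - z0) by rewrite addrC subrK.
  rewrite lie_bracketDl memvD//; last by apply: hlie => //; apply/hK; exact: Mz.
  move: y'h => /hS[Y hY <-]; apply/hS.
  exists (fun u => lie_bracket c (X0.1 u) (Y u)).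
    exact: (horizontal_X0 lieG ax1 x11 scE oW aX0 aX laXi XiX hY).
  by rewrite /X0 /= velocity_id psiu0.
(* the tangent vector (t1, t2) is the sum of a horizontal and a vertical value;
   Xm relates the frame to the coordinates of the chart *)
pose Xm : 'M[R]_n := \matrix_(k, i) frame_coef x1 E x (cmap x a) k i.
have Xmu : Xm \in unitmx by exact: (frame_coef_unit lieG ax1 x11 Eunit ax xa).
have /hS[Y hY Yu0] := hfull (t1 *m invmx Xm).
have [A hA AE] := hY.
have [B hB BE] := vertical atlas x1 E X0 laXi XiX (@analytic_map_cst R d W d t2).
exists (fun u => A.1 u + B.1 u, fun u => A.2 u + B.2 u); first exact: hmD.
rewrite /field_value /=.
have [A1 A2] := AE u0 Wu0; have [B1 B2] := BE u0 Wu0.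
rewrite A1 A2 B1 B2 addr0 add0r Yu0; congr pair.
rewrite -[RHS]mulmx1 -(mulVmx Xmu) mulmxA.
apply/rowP => i; rewrite [RHS]mxE mxE; apply: eq_bigr => k _; congr (_ * _).
by rewrite (frame_coord E lieG ax1 x11 k i ax xa) mxE.
Unshelve. all: by end_near. Qed.

End equivalence.

Theorem theorem3p2 (R : realType) (n d : nat) (G : topGroupType)
  (atlas : set (chart R G n)) (x1 : chart R G n) (E : 'M[R]_n)
  (c : 'I_n -> 'I_n -> 'I_n -> R) (eps : R) (M : set 'rV[R]_n)
  (m : {measure set (borelRn R n) -> \bar R}) (kappa : 'rV[R]_n -> R) :
  let e := left_frame x1 E in
  let Z := @sharp R n @` M in
  is_lie_group atlas ->
  atlas x1 -> cdom x1 1%g -> E \in unitmx ->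
  structure_constants atlas e c ->
  0 < eps ->
  analytic_submanifold d M -> M !=set0 -> connected M ->
  euler_arnold_invariant c M ->
  thickening_limit c M m ->
  (forall y, M y -> 0 < kappa y) ->
  analytic_function d M kappa ->
  metric_volume d M kappa m ->
  (hormander d atlas e (@velocity R n) (euler_arnold c) eps kappa M
     <-> p_hull c Z = setT) /\
  (hormander d atlas e id (fun z => q_sym c z z) eps kappa Z
     <-> p_hull c Z = setT).
Proof.
move=> e Z lieG ax1 x11 Eunit scE eps0 aM M0 cM _ tl kappa0 akappa _.
have -> : Z = M by rewrite /Z /sharp image_id.
have -> : (fun z => q_sym c z z) = euler_arnold c.
  by apply/funext => z; exact: q_sym_euler_arnold.
suff H : hormander d atlas e (@velocity R n) (euler_arnold c) eps kappa M
     <-> p_hull c M = setT by split => //; move: H; rewrite velocity_id.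
split=> [horm|full].
  by apply: hormander_hull_full horm => // y; rewrite velocity_id.
apply: hull_full_hormander full => // W psi Om u lp Wu.
exact: euler_arnold_tangent tl lp Wu.
Qed.
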